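(* Suppose the symbol function $q\in L^2(\partial\mathbb D)$ is a polynomial in $z$ and $\overline z$, let $u$ be an inner function, and let $A_q$ be the truncated Toeplitz operator on $K_u$ with symbol $q$. (a) If $u$ is an infinite Blaschke product with zeros $z_1,z_2,\dots$, then for $p\ge 2$, $A_q\in S_p$ if and only if $\{q(z_i)\}\in \ell^p$, and $A_q$ is compact if and only if $\{q(z_i)\}$ tends to zero. (b) If $u$ is a continuous singular inner function with measure $\sigma$, then $A_q$ is compact if and only if $q$ vanishes on the support of $\sigma$, and in this case $A_q$ is the zero operator. (c) If $u$ is an atomic singular inner function with atoms at the points $e^{i\theta_n}$, then $A_q$ is compact if and only if $q(e^{i\theta_n})=0$ for every $n$, and in this case $A_q$ is the zero operator.
   Context: $\mathbb D$ is the open unit disk, $H^2$ is the Hardy space of $\mathbb D$, identified with its boundary values in $L^2=L^2(\partial\mathbb D)$. $K_u=H^2\ominus uH^2$, $P_u$ is the orthogonal projection of $L^2$ onto $K_u$, and $A_q f=P_u(qf)$ for $f\in K_u$. An operator is in $S_p$ ($p<\infty$) if its sequence of singular values is in $\ell^p$. Zeros of a Blaschke product are listed according to multiplicity, and $q(z_i)$ is the value of the polynomial $q$ in $z,\overline z$ at $z=z_i$. A continuous singular inner function is $u(z)=\exp\left(-\int_0^{2\pi}\frac{e^{i\theta}+z}{e^{i\theta}-z}\,d\sigma(\theta)\right)$ with $\sigma$ a finite, nonnegative, continuous (atomless), singular measure; its support is regarded as a subset of $\partial\mathbb D$ via $\theta\mapsto e^{i\theta}$. An atomic singular inner function is $u(z)=\exp\left(-\sum_n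 r_n\frac{e^{i\theta_n}+z}{e^{i\theta_n}-z}\right)$ with $r_n>0$, $\sum_n r_n<\infty$ and the points $e^{i\theta_n}$ distinct.
   Formalization: In (c), ''in this case A_q is the zero operator'' is proved only for infinitely many atoms: with one atom at 1, u=exp(-(1+z)/(1-z)) and q=1-z, A_q is compact but not zero. The compactness equivalence in (c) covers finite and infinite families of atoms. *)

(* Defs.v *)
From HB Require Import structures.
From mathcomp Require Import all_boot all_order all_algebra.
From mathcomp Require Import polyXY complex.
From mathcomp Require Import all_classical all_reals all_analysis.
Import Order.TTheory GRing.Theory Num.Theory.
Import numFieldNormedType.Exports.

Set Implicit Arguments.
Unset Strict Implicit.
Unset Printing Implicit Defensive.

Local Open Scope classical_set_scope.
Local Open Scope ring_scope.

Section Circle.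
Variable R : realType.

(* [`|z| : R[i]] is complex-valued; this is the real-valued modulus. *)
Definition cmod (z : R[i]) : R := ComplexField.Normc.normc z.

Definition expi (t : R) : R[i] := Complex (cos t) (sin t).

Definition cexp (z : R[i]) : R[i] :=
  (expR (complex.Re z))%:C%C * expi (complex.Im z).

Definition cintegral (mu : {measure set (measurableTypeR R) -> \bar R})
    (D : set R) (f : R -> R[i]) : R[i] :=
  Complex (Rintegral mu D (fun t => complex.Re (f t)))
          (Rintegral mu D (fun t => complex.Im (f t))).

(* A function on the unit circle is given as a function of the angle in
   [0, 2 pi]; values at other angles are irrelevant. *)
Definition angles : set R := `[0, 2 * pi]%classic.

Definition L2circle : set (R -> R[i]) :=
  [set f | [/\ measurable_fun angles (fun t => complex.Re (f t)),
               measurable_fun angles (fun t => complex.Im (f t)) &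
               (\int[lebesgue_measure]_(t in angles) ((cmod (f t)) ^+ 2)%:E
                  < +oo)%E]].

Definition inner_prod (f g : R -> R[i]) : R[i] :=
  ((2 * pi)^-1)%:C%C *
  cintegral lebesgue_measure angles (fun t => f t * conjc (g t)).

Definition norm2 (f : R -> R[i]) : R :=
  Num.sqrt ((2 * pi)^-1 *
            Rintegral lebesgue_measure angles (fun t => (cmod (f t)) ^+ 2)).

(* Equality in L^2 *)
Definition eq2 (f g : R -> R[i]) : Prop :=
  f = g %[ae lebesgue_measure in angles].

Definition analytic_disk (F : R[i] -> R[i]) : Prop :=
  exists a : nat -> R[i], forall w, cmod w < 1 ->
    (fun n => \sum_(0 <= k < n) a k * w ^+ k : R[i]^o) @ \oo --> (F w : R[i]^o).

(* f is the boundary function of F: the L^2 limit of the dilates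
   t |-> F (r e^(it)) as r tends to 1 from below. *)
Definition boundary_values (F : R[i] -> R[i]) (f : R -> R[i]) : Prop :=
  L2circle f /\
  (fun r : R => (\int[lebesgue_measure]_(t in angles)
     ((cmod (F (r%:C%C * expi t) - f t)) ^+ 2)%:E)%E) @ 1^'- --> 0%E.

Definition hardy_disk (F : R[i] -> R[i]) : Prop :=
  analytic_disk F /\
  exists M : R, forall r : R, 0 <= r < 1 ->
    (\int[lebesgue_measure]_(t in angles)
       ((cmod (F (r%:C%C * expi t))) ^+ 2)%:E <= M%:E)%E.

Definition H2 : set (R -> R[i]) :=
  [set f | exists2 F, hardy_disk F & boundary_values F f].

Definition inner_function (u : R[i] -> R[i]) : Prop :=
  [/\ analytic_disk u,
      (forall w, cmod w < 1 -> cmod (u w) <= 1) &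
      exists2 ub, boundary_values u ub &
        {ae lebesgue_measure, forall t : R, angles t -> cmod (ub t) = 1}].

Definition mulH2 (u : R[i] -> R[i]) : set (R -> R[i]) :=
  [set f | exists2 F, hardy_disk F & boundary_values (fun w => u w * F w) f].

Definition model_space (u : R[i] -> R[i]) : set (R -> R[i]) :=
  [set f | H2 f /\ forall g, mulH2 u g -> inner_prod f g = 0].

(* A representative of the orthogonal projection of f onto K, which is
   determined only up to eq2 *)
Definition orth_proj (K : set (R -> R[i])) (f : R -> R[i]) : R -> R[i] :=
  xget (fun=> 0)
    [set g | K g /\ forall k, K k -> inner_prod (f - g) k = 0].

Definition toeplitz (u : R[i] -> R[i]) (q f : R -> R[i]) : R -> R[i] :=
  orth_proj (model_space u) (fun t => q t * f t).

Definition zero_op (K : set (R -> R[i])) (T : (R -> R[i]) -> R -> R[i]) :=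
  forall f, K f -> eq2 (T f) (fun=> 0).

Definition compact_op (K : set (R -> R[i])) (T : (R -> R[i]) -> R -> R[i]) :=
  forall f : nat -> R -> R[i], (forall n, K (f n)) ->
    (exists M : R, forall n, norm2 (f n) <= M) ->
    exists (phi : nat -> nat) (g : R -> R[i]),
      [/\ {homo phi : m n / (m < n)%N}, K g &
          (fun n => norm2 (T (f (phi n)) - g)) @ \oo --> 0].

Definition adjoint_op (K : set (R -> R[i]))
    (T S : (R -> R[i]) -> R -> R[i]) : Prop :=
  (forall f, K f -> K (S f)) /\
  (forall f g, K f -> K g -> inner_prod (T f) g = inner_prod f (S g)).

(* s lists the square roots of the eigenvalues of T^* T in nonincreasing order,
   each positive one repeated according to multiplicity; the list is padded
   with zeros if only finitely many are positive, in which case the vectors e n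
   with s n = 0 are irrelevant. *)
Definition singular_values (K : set (R -> R[i]))
    (T : (R -> R[i]) -> R -> R[i]) (s : nat -> R) : Prop :=
  [/\ (forall n, 0 <= s n),
      {homo s : m n / (m <= n)%N >-> n <= m} &
      exists (S : (R -> R[i]) -> R -> R[i]) (e : nat -> R -> R[i]),
      [/\ adjoint_op K T S,
          (forall n, K (e n)),
          (forall m n, 0 < s m -> 0 < s n ->
             inner_prod (e m) (e n) = (m == n)%:R),
          (forall n, 0 < s n ->
             eq2 (S (T (e n))) (fun t => ((s n) ^+ 2)%:C%C * e n t)) &
          (forall f, K f ->
             (forall n, 0 < s n -> inner_prod f (e n) = 0) ->
             eq2 (S (T f)) (fun=> 0))]].

Definition lp_seq (p : R) (a : nat -> R) : Prop :=
  (\sum_(0 <= n <oo) (`|a n| `^ p)%:E < +oo)%E.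

Definition schatten (p : R) (K : set (R -> R[i]))
    (T : (R -> R[i]) -> R -> R[i]) : Prop :=
  compact_op K T /\ exists2 s, singular_values K T s & lp_seq p s.

Definition blaschke_factor (a w : R[i]) : R[i] :=
  if a == 0 then w
  else (cmod a)%:C%C / a * ((a - w) / (1 - conjc a * w)).

Definition infinite_blaschke (u : R[i] -> R[i]) (z : nat -> R[i]) : Prop :=
  [/\ (forall n, cmod (z n) < 1),
      cvgn (series (fun n => 1 - cmod (z n))) &
      exists2 c : R[i], cmod c = 1 &
      forall w, cmod w < 1 ->
        (fun n => c * \prod_(0 <= k < n) blaschke_factor (z k) w : R[i]^o)
          @ \oo --> (u w : R[i]^o)].

Definition herglotz (z w : R[i]) : R[i] := (z + w) / (z - w).

Definition continuous_singular_inner (u : R[i] -> R[i])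
    (sigma : {finite_measure set (measurableTypeR R) -> \bar R}) : Prop :=
  [/\ sigma (~` angles) = 0%E,
      (forall t : R, sigma [set t] = 0%E),
      (exists N : set (measurableTypeR R),
         [/\ measurable N, lebesgue_measure N = 0%E & sigma (~` N) = 0%E]) &
      forall w, cmod w < 1 ->
        u w = cexp (- cintegral sigma angles (fun t => herglotz (expi t) w))].

Definition circle_support
    (sigma : {finite_measure set (measurableTypeR R) -> \bar R}) : set R[i] :=
  expi @` [set t : R | forall U : set R, open U -> U t -> (0 < sigma U)%E].

(* The atoms are the points e^(i theta n) with 0 < r n. Zero weights only serve
   to let one sequence encode both finite and infinite families of atoms. *)
Definition atomic_singular_inner (u : R[i] -> R[i]) (r theta : nat -> R)
    : Prop :=
  [/\ (forall n, 0 <= r n),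
      cvgn (series r),
      (forall m n, 0 < r m -> 0 < r n ->
         expi (theta m) = expi (theta n) -> m = n) &
      forall w, cmod w < 1 ->
        exists2 h : R[i],
          (fun n => \sum_(0 <= k < n)
             (r k)%:C%C * herglotz (expi (theta k)) w : R[i]^o)
             @ \oo --> (h : R[i]^o) &
          u w = cexp (- h)].

(* The outer variable of q stands for z, the inner one for its conjugate. *)
Definition polyval (q : {poly {poly R[i]}}) (z : R[i]) : R[i] :=
  q.[z, conjc z].

Definition symbol (q : {poly {poly R[i]}}) (t : R) : R[i] :=
  polyval q (expi t).

End Circle.

(* Main.v *)
Require Import Defs.
From HB Require Import structures.
From mathcomp Require Import all_boot all_order all_algebra.
From mathcomp Require Import polyXY complex.
From mathcomp Require Import all_classical all_reals all_analysis.
From mathcomp Require Import measurable_realfun ring lra.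
Import Order.TTheory GRing.Theory Num.Theory.
Import numFieldNormedType.Exports.
Set Implicit Arguments.
Unset Strict Implicit.
Unset Printing Implicit Defensive.
Local Open Scope classical_set_scope.
Local Open Scope ring_scope.

(* For f in the model space, A_q f is the projection of q f, so everything is
   read off from how much mass unit vectors of K_u can put where q is large.

   Sufficiency.  If e_1, ..., e_n are orthonormal in K_u, the reproducing kernel
   gives  sum_k |e_k(w)|^2 <= (1 - |u(w)|^2) / (1 - |w|^2),  and the right-hand
   side is at most  sum_j m_j / |1 - conj(zeta_j) w|^2,  where zeta_j runs over
   the zeros with m_j = 1 - |zeta_j|^2 (Blaschke) or over the atoms with
   m_j = 2 r_j (atomic case), so that sum_j m_j is finite.  Hence a weight W with
   W(z) <= a_j + B |z - zeta_j|^2  satisfies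
   sum_k int W |e_k|^2 <= sum_j (a_j + 4 B m_j).
   With W close to |q|^2 this makes A_q a norm limit of operators of finite rank,
   and with W = |q|^p, Jensen's inequality bounds the Schatten norm.

   Necessity.  Normalized reproducing kernels at points w tending to the circle
   with |u(w)| bounded away from 1 tend weakly to 0, while the quadratic form of
   A_q at them is close to q(w); so q tends to 0 along such points.  For Schatten
   classes one tests A_q on the Malmquist-Takenaka basis, and Jensen's inequality
   with the weights |<g_j, e_k>|^2 gives sum_j ||A_q g_j||^p <= sum_k s_k^p.

   If q vanishes at infinitely many points of the circle it vanishes on the
   circle, whence A_q = 0. *)

(** Vectors are functions rather than classes, and [orth_proj] only picks a representative, so A_q
    is linear only up to null functions; the abstract part therefore works with a semi-inner product
    and recovers linearity from the adjoint relation. Weak limits are taken along an ultrafilter: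
    all Fourier coefficients then converge at once, and Riesz-Fischer turns their limits into a
    vector.

    The points with |u| bounded away from 1 are found in three ways. At a zero, u = 0. On the radius
    towards an atom of mass r, |u| <= exp(-r). For an atomless measure, if |u| stayed above exp(-1)
    near a point of the support, the Poisson integrals of sigma would be bounded there; sigma would
    then have a bounded density near that point, whereas a singular measure with a bounded density
    is 0.

    In the continuous case the support may be finite, and then there are not infinitely many zeros
    of q to exploit; but an atomless measure with finite support is 0, |u| = 1, and K_u is
    trivial. *)

Lemma cvg_finsum (K : numFieldType) (V : normedModType K) (T I : Type)
    (F : set_system T) {FF : Filter F} (r : seq I) (P : pred I)
    (f : I -> T -> V) (l : I -> V) :
  (forall i, P i -> f i @ F --> l i) ->
  (fun t => \sum_(i <- r | P i) f i t) @ F --> \sum_(i <- r | P i) l i.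
Proof. by move=> fl; apply: cvg_big => //; exact: add_continuous. Qed.

(** * Complex moduli and limits *)

Section Complex.
Variable R : realType.
Implicit Types (z w : R[i]) (r s : R).

Lemma normE z : `|z| = (cmod z)%:C%C. Proof. by case: z. Qed.
Lemma cmodE z : cmod z = complex.Re `|z|. Proof. by rewrite normE. Qed.
Lemma cmod0 : cmod (0 : R[i]) = 0. Proof. exact: ComplexField.Normc.normc0. Qed.
Lemma cmod1 : cmod (1 : R[i]) = 1. Proof. exact: ComplexField.Normc.normc1. Qed.
Lemma cmodM z w : cmod (z * w) = cmod z * cmod w.
Proof. exact: ComplexField.Normc.normcM. Qed.
Lemma cmodV z : cmod z^-1 = (cmod z)^-1.
Proof. exact: ComplexField.Normc.normcV. Qed.
Lemma cmodN z : cmod (- z) = cmod z. Proof. by rewrite !cmodE normrN. Qed.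
Lemma cmod_ge0 z : 0 <= cmod z. Proof. by case: z => a b; exact: sqrtr_ge0. Qed.
Lemma cmod_eq0 z : (cmod z == 0) = (z == 0).
Proof.
by apply/eqP/eqP => [/ComplexField.Normc.eq0_normc //|->]; exact: cmod0.
Qed.
Lemma cmod_gt0 z : (0 < cmod z) = (z != 0).
Proof. by rewrite lt_neqAle cmod_ge0 andbT eq_sym cmod_eq0. Qed.
Lemma cmodD z w : cmod (z + w) <= cmod z + cmod w.
Proof. by rewrite -lecR rmorphD /= -!normE ler_normD. Qed.
Lemma cmodB z w : cmod (z - w) <= cmod z + cmod w.
Proof. by rewrite (le_trans (cmodD _ _))// cmodN. Qed.
Lemma cmod_distC z w : cmod (z - w) = cmod (w - z).
Proof. by rewrite -cmodN opprB. Qed.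
Lemma cmod_conj z : cmod (conjc z) = cmod z.
Proof. by case: z => a b; rewrite /cmod /= sqrrN. Qed.
Lemma cmod_real r : cmod r%:C%C = `|r|.
Proof. by rewrite /cmod /= expr0n/= addr0 sqrtr_sqr. Qed.
Lemma cmodX z n : cmod (z ^+ n) = cmod z ^+ n.
Proof. by elim: n => [|n IH]; rewrite ?expr0 ?cmod1// !exprS cmodM IH. Qed.
Lemma cmod_sqrE z : cmod z ^+ 2 = complex.Re z ^+ 2 + complex.Im z ^+ 2.
Proof. by case: z => a b; rewrite /cmod /= sqr_sqrtr// addr_ge0 ?sqr_ge0. Qed.
Lemma mul_conjc z : z * conjc z = (cmod z ^+ 2)%:C%C.
Proof. by rewrite -sqr_normc normE -rmorphXn. Qed.
Lemma Re_le_cmod z : `|complex.Re z| <= cmod z.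
Proof. by case: z => a b; rewrite /cmod /= -sqrtr_sqr ler_wsqrtr// lerDl sqr_ge0. Qed.
Lemma Im_le_cmod z : `|complex.Im z| <= cmod z.
Proof. by case: z => a b; rewrite /cmod /= -sqrtr_sqr ler_wsqrtr// lerDr sqr_ge0. Qed.
Lemma cmod_le_ReIm z : cmod z <= `|complex.Re z| + `|complex.Im z|.
Proof.
rewrite -(@ler_pXn2r _ 2)// ?nnegrE ?addr_ge0 ?cmod_ge0 ?normr_ge0//.
rewrite cmod_sqrE sqrrD !real_normK ?num_real// addrAC lerDl.
by rewrite mulrn_wge0// mulr_ge0.
Qed.
Lemma cmod_sum (I : Type) (s : seq I) (P : pred I) (f : I -> R[i]) :
  cmod (\sum_(i <- s | P i) f i) <= \sum_(i <- s | P i) cmod (f i).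
Proof.
elim/big_ind2 : _ => //; first by rewrite cmod0.
by move=> a b c d h1 h2; rewrite (le_trans (cmodD _ _))// lerD.
Qed.
Lemma cmod_prod (I : Type) (s : seq I) (P : pred I) (f : I -> R[i]) :
  cmod (\prod_(i <- s | P i) f i) = \prod_(i <- s | P i) cmod (f i).
Proof.
by elim/big_ind2 : _ => //; [rewrite cmod1 | move=> a b c d <- <-; rewrite cmodM].
Qed.
Lemma cmod_dist_le z w : cmod z - cmod w <= cmod (z - w).
Proof. by rewrite lerBlDr (le_trans _ (cmodD _ _))// subrK. Qed.
Lemma cmod_dist z w : `|cmod z - cmod w| <= cmod (z - w).
Proof.
rewrite ler_norml cmod_dist_le andbT lerNl opprB cmod_distC.
exact: cmod_dist_le.
Qed.
Lemma ReM_real r z : complex.Re (r%:C%C * z) = r * complex.Re z.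
Proof. by case: z => a b /=; rewrite mul0r subr0. Qed.
Lemma ImM_real r z : complex.Im (r%:C%C * z) = r * complex.Im z.
Proof. by case: z => a b /=; rewrite mul0r addr0. Qed.
Lemma ReD z w : complex.Re (z + w) = complex.Re z + complex.Re w.
Proof. by case: z w => a b []. Qed.
Lemma ImD z w : complex.Im (z + w) = complex.Im z + complex.Im w.
Proof. by case: z w => a b []. Qed.
Lemma ReN z : complex.Re (- z) = - complex.Re z. Proof. by case: z. Qed.
Lemma ImN z : complex.Im (- z) = - complex.Im z. Proof. by case: z. Qed.
Lemma ReM z w : complex.Re (z * w) =
  complex.Re z * complex.Re w - complex.Im z * complex.Im w.
Proof. by case: z w => a b []. Qed.
Lemma ImM z w : complex.Im (z * w) =
  complex.Re z * complex.Im w + complex.Im z * complex.Re w.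
Proof. by case: z w => a b []. Qed.
Lemma Re_conj z : complex.Re (conjc z) = complex.Re z. Proof. by case: z. Qed.
Lemma Im_conj z : complex.Im (conjc z) = - complex.Im z. Proof. by case: z. Qed.
Lemma Re_sum (I : Type) (s : seq I) (P : pred I) (f : I -> R[i]) :
  complex.Re (\sum_(i <- s | P i) f i) = \sum_(i <- s | P i) complex.Re (f i).
Proof. by elim/big_ind2 : _ => // a b c d <- <-; rewrite ReD. Qed.
Lemma complexP z w :
  complex.Re z = complex.Re w -> complex.Im z = complex.Im w -> z = w.
Proof. by case: z w => a b [c d] /= -> ->. Qed.

Lemma cmod_expi (t : R) : cmod (expi t) = 1.
Proof. by rewrite /cmod /= cos2Dsin2 sqrtr1. Qed.
Lemma cmod_cexp z : cmod (cexp z) = expR (complex.Re z).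
Proof. by rewrite /cexp cmodM cmod_expi mulr1 cmod_real ger0_norm ?expR_ge0. Qed.

(** Balls of [R[i]^o] have radii in [R[i]]; a positive element of [R[i]] is real, so real radii
    suffice and limits can be handled through the real-valued modulus. *)
Lemma ccvgP (T : Type) (F : set_system T) {FF : Filter F} (f : T -> R[i]) (l : R[i]) :
  (f @ F --> (l : R[i]^o)) <-> (fun x => cmod (f x - l)) @ F --> (0 : R).
Proof.
split.
  move/(@cvgrPdist_lt _ R[i]^o) => h; apply/cvgrPdist_lt => e e0.
  have := h e%:C%C; rewrite ltcR => /(_ e0).
  apply: filterS => t; rewrite normE ltcR sub0r normrN ger0_norm ?cmod_ge0//.
  by rewrite cmod_distC.
move=> /cvgrPdist_lt h; apply/(@cvgrPdist_lt _ R[i]^o) => e e0.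
have [e' ee] : exists e' : R, e = e'%:C%C.
  by apply/complex_realP; rewrite gtr0_real.
move: e0; rewrite ee ltcR => /h.
apply: filterS => t; rewrite normE ltcR sub0r normrN ger0_norm ?cmod_ge0//.
by rewrite cmod_distC.
Qed.

Lemma ccvg_ltP (T : Type) (F : set_system T) {FF : Filter F} (f : T -> R[i]) (l : R[i]) :
  (f @ F --> (l : R[i]^o)) <->
  forall e : R, 0 < e -> \forall t \near F, cmod (f t - l) < e.
Proof.
split.
  move=> /ccvgP/cvgrPdist_lt h e /h; apply: filterS => t.
  by rewrite sub0r normrN ger0_norm ?cmod_ge0.
move=> h; apply/ccvgP/cvgrPdist_lt => e /h; apply: filterS => t.
by rewrite sub0r normrN ger0_norm ?cmod_ge0.
Qed.

Lemma ccvg_Re (T : Type) (F : set_system T) {FF : Filter F} (f : T -> R[i]) (l : R[i]) :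
  (f @ F --> (l : R[i]^o)) -> (fun x => complex.Re (f x)) @ F --> complex.Re l.
Proof.
move=> /ccvgP /cvgrPdist_lt h; apply/cvgrPdist_lt => e /h.
apply: filterS => t; rewrite sub0r normrN ger0_norm ?cmod_ge0//; apply: le_lt_trans.
by rewrite -ReN -ReD cmod_distC Re_le_cmod.
Qed.

Lemma ccvg_Im (T : Type) (F : set_system T) {FF : Filter F} (f : T -> R[i]) (l : R[i]) :
  (f @ F --> (l : R[i]^o)) -> (fun x => complex.Im (f x)) @ F --> complex.Im l.
Proof.
move=> /ccvgP /cvgrPdist_lt h; apply/cvgrPdist_lt => e /h.
apply: filterS => t; rewrite sub0r normrN ger0_norm ?cmod_ge0//; apply: le_lt_trans.
by rewrite -ImN -ImD cmod_distC Im_le_cmod.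
Qed.

Lemma ccvg_cmod (T : Type) (F : set_system T) {FF : Filter F} (f : T -> R[i]) (l : R[i]) :
  (f @ F --> (l : R[i]^o)) -> (fun x => cmod (f x)) @ F --> cmod l.
Proof.
move=> /ccvgP /cvgrPdist_lt h; apply/cvgrPdist_lt => e /h.
apply: filterS => t; rewrite sub0r normrN ger0_norm ?cmod_ge0//; apply: le_lt_trans.
by rewrite cmod_distC cmod_dist.
Qed.

Lemma ccvg_ReIm (T : Type) (F : set_system T) {FF : Filter F} (f : T -> R[i]) (l : R[i]) :
  (fun x => complex.Re (f x)) @ F --> complex.Re l ->
  (fun x => complex.Im (f x)) @ F --> complex.Im l ->
  f @ F --> (l : R[i]^o).
Proof.
move=> h1 h2; apply/ccvgP; apply/cvgrPdist_lt => e e0.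
have e20 : 0 < e / 2 by rewrite divr_gt0.
move/cvgrPdist_lt : h1 => /(_ _ e20); move/cvgrPdist_lt : h2 => /(_ _ e20).
apply: filterS2 => t H2 H1.
rewrite sub0r normrN ger0_norm ?cmod_ge0// cmod_distC.
by rewrite (le_lt_trans (cmod_le_ReIm _))// ReD ReN ImD ImN [e]splitr ltrD.
Qed.

Lemma ccvg_cst (T : Type) (F : set_system T) {FF : Filter F} (l : R[i]) :
  (fun _ : T => l) @ F --> (l : R[i]^o).
Proof. exact: (@cvg_cst R[i]^o). Qed.

Lemma ccvgB (T : Type) (F : set_system T) {FF : Filter F} (f g : T -> R[i]) (a b : R[i]) :
  f @ F --> (a : R[i]^o) -> g @ F --> (b : R[i]^o) ->
  (fun x => f x - g x) @ F --> (a - b : R[i]^o).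
Proof. exact: (@cvgB _ R[i]^o). Qed.

Lemma ccvgM (T : Type) (F : set_system T) {FF : Filter F} (f g : T -> R[i]) (a b : R[i]) :
  f @ F --> (a : R[i]^o) -> g @ F --> (b : R[i]^o) ->
  (fun x => f x * g x) @ F --> (a * b : R[i]^o).
Proof. exact: (@cvgM R[i]). Qed.

Lemma cvg_sqrt (T : Type) (F : set_system T) {FF : Filter F} (f : T -> R) (l : R) :
  f @ F --> l -> (fun x => Num.sqrt (f x)) @ F --> Num.sqrt l.
Proof. by move=> fl; apply: continuous_cvg fl; exact: sqrt_continuous. Qed.

Lemma rcvg_unique (T : Type) (F : set_system T) {FF : ProperFilter F}
    (f : T -> R) (a b : R) : f @ F --> a -> f @ F --> b -> a = b.
Proof. exact: norm_cvg_unique. Qed.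

Lemma ccvg_unique (T : Type) (F : set_system T) {FF : ProperFilter F}
    (f : T -> R[i]) (a b : R[i]) :
  f @ F --> (a : R[i]^o) -> f @ F --> (b : R[i]^o) -> a = b.
Proof. exact: (@norm_cvg_unique _ R[i]^o). Qed.

Lemma rcvg_le (T : Type) (F : set_system T) {FF : ProperFilter F}
    (f g : T -> R) (a b : R) : f @ F --> a -> g @ F --> b ->
  (\forall t \near F, f t <= g t) -> a <= b.
Proof.
move=> fa gb fg; rewrite -subr_ge0.
apply: (@closed_cvg _ _ F _ (g \- f) (fun x => 0 <= x)).
- exact: closed_ge.
- by apply: filterS fg => t; rewrite /= subr_ge0.
- exact: cvgB.
Qed.

End Complex.

Record semi_ip (R : realType) (V : lmodType R[i]) (L : set V)
    (ip : V -> V -> R[i]) : Prop := SemiIp {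
  dom0 : L 0;
  domD : forall f g, L f -> L g -> L (f + g);
  domZ : forall a f, L f -> L (a *: f);
  ipDl : forall f g h, L f -> L g -> L h -> ip (f + g) h = ip f h + ip g h;
  ipZl : forall a f g, L f -> L g -> ip (a *: f) g = a * ip f g;
  ipC : forall f g, L f -> L g -> ip g f = conjc (ip f g);
  ip_ge0 : forall f, L f -> 0 <= complex.Re (ip f f) }.

(** * Semi-inner product spaces *)

(* Functions in L^2 are not identified when they agree almost everywhere, so
   [ip] is only semi-definite and is constrained only on the subset [L]. *)
Section SemiInnerProduct.
Context {R : realType} {V : lmodType R[i]} {L : set V} {ip : V -> V -> R[i]}.
Hypothesis H : semi_ip L ip.
Implicit Types (f g h : V) (a b : R[i]).

Definition nrm f : R := Num.sqrt (complex.Re (ip f f)).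

Lemma domN f : L f -> L (- f).
Proof. by rewrite -scaleN1r; exact: (domZ H). Qed.
Lemma domB f g : L f -> L g -> L (f - g).
Proof. by move=> Lf Lg; apply: (domD H) =>//; exact: domN. Qed.
Lemma dom_sum (I : Type) (r : seq I) (P : pred I) (F : I -> V) :
  (forall i, P i -> L (F i)) -> L (\sum_(i <- r | P i) F i).
Proof.
by move=> LF; elim/big_ind : _ =>//; [exact: (dom0 H)|exact: (domD H)].
Qed.

Lemma ipDr f g h : L f -> L g -> L h -> ip f (g + h) = ip f g + ip f h.
Proof.
move=> Lf Lg Lh; rewrite (ipC H)//; last exact: (domD H).
by rewrite (ipDl H)// rmorphD /= -!(ipC H).
Qed.
Lemma ipZr a f g : L f -> L g -> ip f (a *: g) = conjc a * ip f g.
Proof.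
move=> Lf Lg; rewrite (ipC H)//; last exact: (domZ H).
by rewrite (ipZl H)// rmorphM /= -(ipC H).
Qed.
Lemma ip0l f : L f -> ip 0 f = 0.
Proof. by move=> Lf; rewrite -(scale0r f) (ipZl H)// mul0r. Qed.
Lemma ip0r f : L f -> ip f 0 = 0.
Proof. by move=> Lf; rewrite -(scale0r f) ipZr// conjc0 mul0r. Qed.
Lemma ipNl f g : L f -> L g -> ip (- f) g = - ip f g.
Proof. by move=> Lf Lg; rewrite -scaleN1r (ipZl H)// mulN1r. Qed.
Lemma ipNr f g : L f -> L g -> ip f (- g) = - ip f g.
Proof. by move=> Lf Lg; rewrite -scaleN1r ipZr// rmorphN1 mulN1r. Qed.
Lemma ipBl f g h : L f -> L g -> L h -> ip (f - g) h = ip f h - ip g h.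
Proof. by move=> Lf Lg Lh; rewrite (ipDl H) ?ipNl//; exact: domN. Qed.
Lemma ipBr f g h : L f -> L g -> L h -> ip f (g - h) = ip f g - ip f h.
Proof. by move=> Lf Lg Lh; rewrite ipDr ?ipNr//; exact: domN. Qed.
Lemma ip_suml (I : Type) (r : seq I) (P : pred I) (F : I -> V) g :
  (forall i, P i -> L (F i)) -> L g ->
  ip (\sum_(i <- r | P i) F i) g = \sum_(i <- r | P i) ip (F i) g.
Proof.
move=> LF Lg; elim: r => [|i r IH]; first by rewrite !big_nil ip0l.
rewrite !big_cons; case: ifPn =>// Pi.
by rewrite (ipDl H) ?IH//; [exact: LF|exact: dom_sum].
Qed.
Lemma ip_sumr (I : Type) (r : seq I) (P : pred I) (F : I -> V) g :
  (forall i, P i -> L (F i)) -> L g ->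
  ip g (\sum_(i <- r | P i) F i) = \sum_(i <- r | P i) ip g (F i).
Proof.
move=> LF Lg; rewrite (ipC H)//; last exact: dom_sum.
rewrite ip_suml// rmorph_sum /=; apply: eq_bigr => i Pi.
by rewrite -(ipC H)//; exact: LF.
Qed.

Lemma nrm_ge0 f : 0 <= nrm f. Proof. exact: sqrtr_ge0. Qed.
Lemma nrm_sqr f : L f -> nrm f ^+ 2 = complex.Re (ip f f).
Proof. by move=> Lf; rewrite sqr_sqrtr//; exact: (ip_ge0 H). Qed.
Lemma ipff f : L f -> ip f f = (nrm f ^+ 2)%:C%C.
Proof.
move=> Lf; rewrite nrm_sqr//; apply: complexP =>//=.
have := congr1 (@complex.Im R) (ipC H Lf Lf).
by rewrite Im_conj => /eqP; rewrite -subr_eq0 opprK -mulr2n mulrn_eq0 /= => /eqP.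
Qed.
Lemma nrm0 : nrm 0 = 0.
Proof. by rewrite /nrm ip0l ?sqrtr0//; exact: (dom0 H). Qed.
Lemma nrm_sqrD f g : L f -> L g ->
  nrm (f + g) ^+ 2 = nrm f ^+ 2 + nrm g ^+ 2 + complex.Re (ip f g) *+ 2.
Proof.
move=> Lf Lg; have Lfg : L (f + g) by exact: (domD H).
rewrite !nrm_sqr// (ipDl H)// !ipDr// (ipC H Lf Lg) !ReD Re_conj mulr2n; ring.
Qed.
Lemma nrmZ a f : L f -> nrm (a *: f) = cmod a * nrm f.
Proof.
move=> Lf; rewrite /nrm (ipZl H) ?ipZr//; last exact: (domZ H).
rewrite mulrA mul_conjc ReM_real sqrtrM ?sqr_ge0// sqrtr_sqr ger0_norm//.
exact: cmod_ge0.
Qed.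
Lemma nrmN f : L f -> nrm (- f) = nrm f.
Proof. by move=> Lf; rewrite -scaleN1r nrmZ// cmodN cmod1 mul1r. Qed.
Lemma nrm_distC f g : L f -> L g -> nrm (f - g) = nrm (g - f).
Proof. by move=> Lf Lg; rewrite -nrmN ?opprB//; exact: domB. Qed.
Lemma nrm_sqrB f g : L f -> L g ->
  nrm (f - g) ^+ 2 = nrm f ^+ 2 + nrm g ^+ 2 - complex.Re (ip f g) *+ 2.
Proof.
move=> Lf Lg; rewrite nrm_sqrD// ?nrmN// ?ipNr// ?ReN ?mulNrn//.
exact: domN.
Qed.

Lemma ip_CS f g : L f -> L g -> cmod (ip f g) <= nrm f * nrm g.
Proof.
move=> Lf Lg.
have key a : L (a *: g) -> 0 <= nrm f ^+ 2 + (cmod a * nrm g) ^+ 2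
    - complex.Re (conjc a * ip f g) *+ 2.
  by move=> La; rewrite -nrmZ// -ipZr// -nrm_sqrB// sqr_ge0.
have {}key a : 0 <= nrm f ^+ 2 + (cmod a * nrm g) ^+ 2
    - complex.Re (conjc a * ip f g) *+ 2 by apply: key; exact: (domZ H).
set c := ip f g in key *.
(* Taking [a = t c] with [t] real makes the cross term real. *)
have k2 (t : R) : 0 <= nrm f ^+ 2 + (t * cmod c * nrm g) ^+ 2
    - (t * cmod c ^+ 2) *+ 2.
  have := key (t%:C%C * c).
  have -> : conjc (t%:C%C * c) * c = t%:C%C * (c * conjc c).
    by rewrite (rmorphM (@conjc R)) /= oppr0 -mulrA (mulrC _ c).
  rewrite cmodM cmod_real mul_conjc ReM_real /=.
  by rewrite !exprMn real_normK ?num_real.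
(* A vector of norm 0 need not be 0. The expression is then affine in [t], and its nonnegativity for
   every [t] forces [c = 0]. Otherwise [t] is taken at the minimum of the quadratic. *)
have [g0|g0] := eqVneq (nrm g) 0.
  rewrite g0 mulr0; have [->//|c0] := eqVneq (cmod c) 0.
  have c20 : 0 < cmod c ^+ 2 by rewrite exprn_gt0// lt_neqAle eq_sym c0 cmod_ge0.
  have := k2 ((nrm f ^+ 2 + 1) / (cmod c ^+ 2)).
  rewrite g0 mulr0 expr0n/= addr0 mulfVK ?gt_eqF//.
  have := sqr_ge0 (nrm f); lra.
have gp : 0 < nrm g by rewrite lt_neqAle eq_sym g0 nrm_ge0.
have := k2 ((nrm g ^+ 2)^-1).
have -> : nrm f ^+ 2 + ((nrm g ^+ 2)^-1 * cmod c * nrm g) ^+ 2 -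
   ((nrm g ^+ 2)^-1 * cmod c ^+ 2) *+ 2 =
   ((nrm f * nrm g) ^+ 2 - cmod c ^+ 2) / nrm g ^+ 2.
  by field.
rewrite pmulr_lge0 ?invr_gt0 ?exprn_gt0// subr_ge0.
by rewrite ler_pXn2r// ?nnegrE ?cmod_ge0// mulr_ge0 ?nrm_ge0.
Qed.

Lemma nrmD f g : L f -> L g -> nrm (f + g) <= nrm f + nrm g.
Proof.
move=> Lf Lg; rewrite -(@ler_pXn2r _ 2)// ?nnegrE ?addr_ge0 ?nrm_ge0//.
rewrite nrm_sqrD// sqrrD addrAC lerD2r lerD2l lerMn2r /=.
apply: le_trans (ip_CS Lf Lg); apply: le_trans (Re_le_cmod _).
exact: ler_norm.
Qed.
Lemma nrmB f g : L f -> L g -> nrm (f - g) <= nrm f + nrm g.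
Proof. by move=> Lf Lg; rewrite -(nrmN Lg) nrmD//; exact: domN. Qed.
Lemma nrm_triangle f g h : L f -> L g -> L h ->
  nrm (f - h) <= nrm (f - g) + nrm (g - h).
Proof.
by move=> Lf Lg Lh; rewrite -(subrKA g f (- h)) nrmD//; exact: domB.
Qed.
Lemma nrm_dist f g : L f -> L g -> `|nrm f - nrm g| <= nrm (f - g).
Proof.
have h f' g' : L f' -> L g' -> nrm f' - nrm g' <= nrm (f' - g').
  move=> Lf Lg; rewrite lerBlDr -{1}(subrK g' f') nrmD//; exact: domB.
move=> Lf Lg; rewrite ler_norml h// andbT lerNl opprB nrm_distC//.
exact: h.
Qed.
Lemma ip_nrm0l f g : L f -> L g -> nrm f = 0 -> ip f g = 0.
Proof.
move=> Lf Lg f0; apply/eqP; rewrite -cmod_eq0 eq_le cmod_ge0 andbT.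
by rewrite (le_trans (ip_CS Lf Lg))// f0 mul0r.
Qed.

(** The predicate accommodates all of [nat], an initial segment of it, and the indices of the
    positive singular values, outside of which the vectors are arbitrary. *)
Definition orthonormal_on (P : pred nat) (e : nat -> V) :=
  forall m n, P m -> P n -> ip (e m) (e n) = (m == n)%:R.

Section Bessel.
Variables (P : pred nat) (e : nat -> V).
Hypotheses (Le : forall n, P n -> L (e n)) (oe : orthonormal_on P e).
#[local] Hint Extern 0 (L (e _)) => by apply: Le : core.
#[local] Hint Extern 0 (L (_ *: _)) => apply: (domZ H) : core.

Lemma ip_lincomb (c : nat -> R[i]) N k : P k -> (k < N)%N ->
  ip (\sum_(i < N | P i) c i *: e i) (e k) = c k.
Proof.
move=> Pk kN; rewrite ip_suml//; last by move=> i Pi; apply: (domZ H); exact: Le.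
rewrite (bigD1 (Ordinal kN))//= (ipZl H)// oe// eqxx mulr1.
rewrite big1 ?addr0// => i /andP[Pi ik].
by rewrite (ipZl H)// oe//; move: ik; rewrite -val_eqE /= => /negbTE ->; rewrite mulr0.
Qed.

Lemma dom_lincomb (c : nat -> R[i]) N : L (\sum_(i < N | P i) c i *: e i).
Proof. by apply: dom_sum => i Pi; apply: (domZ H); exact: Le. Qed.

Lemma ip_lincomb2 (c d : nat -> R[i]) N :
  ip (\sum_(i < N | P i) c i *: e i) (\sum_(i < N | P i) d i *: e i) =
  \sum_(i < N | P i) c i * conjc (d i).
Proof.
rewrite ip_sumr//; last 2 first.
- by move=> i Pi; apply: (domZ H); exact: Le.
- exact: (dom_lincomb c).
apply: eq_bigr => i Pi; rewrite ipZr//; last exact: (dom_lincomb c).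
by rewrite ip_lincomb// mulrC.
Qed.

Lemma nrm_lincomb (c : nat -> R[i]) N :
  nrm (\sum_(i < N | P i) c i *: e i) ^+ 2 = \sum_(i < N | P i) cmod (c i) ^+ 2.
Proof.
rewrite nrm_sqr ?ip_lincomb2; last exact: (dom_lincomb c).
by rewrite Re_sum; apply: eq_bigr => i _; rewrite mul_conjc.
Qed.

Definition proj_sum f N := \sum_(i < N | P i) ip f (e i) *: e i.

Lemma dom_proj_sum f N : L (proj_sum f N).
Proof. exact: (dom_lincomb (fun i => ip f (e i))). Qed.

Lemma ip_proj_sum_perp f N k : L f -> P k -> (k < N)%N ->
  ip (f - proj_sum f N) (e k) = 0.
Proof.
move=> Lf Pk kN; rewrite ipBl//; last exact: dom_proj_sum.
by rewrite /proj_sum (ip_lincomb (fun i => ip f (e i)))// subrr.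
Qed.

Lemma bessel_eq f N : L f ->
  nrm (f - proj_sum f N) ^+ 2 =
  nrm f ^+ 2 - \sum_(i < N | P i) cmod (ip f (e i)) ^+ 2.
Proof.
move=> Lf; rewrite nrm_sqrB// /proj_sum ?(nrm_lincomb (fun i => ip f (e i))); last exact: (dom_proj_sum f).
rewrite ip_sumr//; last by move=> i Pi; apply: (domZ H); exact: Le.
have -> : complex.Re (\sum_(i < N | P i) ip f (ip f (e i) *: e i)) =
    \sum_(i < N | P i) cmod (ip f (e i)) ^+ 2.
  rewrite Re_sum; apply: eq_bigr => i Pi; rewrite ipZr//.
  by rewrite mulrC mul_conjc.
by rewrite mulr2n; ring.
Qed.

Lemma bessel f N : L f ->
  \sum_(i < N | P i) cmod (ip f (e i)) ^+ 2 <= nrm f ^+ 2.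
Proof. by move=> Lf; rewrite -subr_ge0 -bessel_eq// sqr_ge0. Qed.

End Bessel.

Lemma cvg_ipl (T : Type) (F : set_system T) (FF : Filter F) (f : T -> V) l g :
  (forall t, L (f t)) -> L l -> L g ->
  (fun t => nrm (f t - l)) @ F --> 0 ->
  (fun t => ip (f t) g) @ F --> (ip l g : R[i]^o).
Proof.
move=> Lf Ll Lg fl; apply/ccvgP.
have h : (fun t => nrm (f t - l) * nrm g) @ F --> 0.
  by rewrite -(mul0r (nrm g)); apply: cvgM => //; exact: cvg_cst.
apply: (squeeze_cvgr _ (cvg_cst (0 : R)) h).
apply: nearW => t; rewrite cmod_ge0 /= -ipBl// ip_CS//; exact: domB.
Qed.

Lemma cvg_nrm (T : Type) (F : set_system T) (FF : Filter F) (f : T -> V) l :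
  (forall t, L (f t)) -> L l ->
  (fun t => nrm (f t - l)) @ F --> 0 ->
  (fun t => nrm (f t)) @ F --> nrm l.
Proof.
move=> Lf Ll fl; apply/cvgrPdist_lt => e e0.
move/cvgrPdist_lt : fl => /(_ _ e0); apply: filterS => t.
rewrite sub0r normrN ger0_norm ?nrm_ge0//; apply: le_lt_trans.
by rewrite distrC nrm_dist.
Qed.

End SemiInnerProduct.
Arguments nrm {R V} ip f.
Arguments orthonormal_on {R V} ip P e.
Arguments proj_sum {R V} ip P e f N.

Record subspace_of (R : realType) (V : lmodType R[i]) (L K : set V) : Prop :=
  SubspaceOf {
  subKL : K `<=` L;
  sub0 : K 0;
  subD : forall f g, K f -> K g -> K (f + g);
  subZ : forall a f, K f -> K (a *: f) }.

(** * Operators with an adjoint, linear up to null vectors *)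

Section SelfAdjointSquare.
Context {R : realType} {V : lmodType R[i]} {L : set V} {ip : V -> V -> R[i]}.
Hypothesis H : semi_ip L ip.
Context {K : set V}.
Hypothesis HK : subspace_of L K.
Local Notation N := (nrm ip).
Implicit Types (f g h : V).

Let KL f : K f -> L f. Proof. exact: (subKL HK). Qed.
Let KD := subD HK.
Let KZ := subZ HK.
#[local] Hint Extern 0 (L _) => (by apply: KL) : core.

Lemma subN f : K f -> K (- f). Proof. by rewrite -scaleN1r; exact: KZ. Qed.
Lemma subB f g : K f -> K g -> K (f - g).
Proof. by move=> Kf Kg; apply: KD => //; exact: subN. Qed.
Lemma sub_sum (I : Type) (r : seq I) (P : pred I) (F : I -> V) :
  (forall i, P i -> K (F i)) -> K (\sum_(i <- r | P i) F i).
Proof. by move=> LF; elim/big_ind : _ => //; exact: (sub0 HK). Qed.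

Lemma nrm_null_eq f g : L f -> L g -> N (f - g) = 0 -> N f = N g.
Proof.
move=> Lf Lg fg; apply/eqP; rewrite -subr_eq0 -normr_le0 -fg.
exact: (nrm_dist H).
Qed.
Lemma ip_null_eq f g h : L f -> L g -> L h -> N (f - g) = 0 -> ip f h = ip g h.
Proof.
move=> Lf Lg Lh fg; apply/eqP; rewrite -subr_eq0 -(ipBl H)//.
by rewrite (ip_nrm0l H)//; exact: (domB H).
Qed.
Lemma nrm_null_test f : K f -> (forall g, K g -> ip f g = 0) -> N f = 0.
Proof. by move=> Kf h; rewrite /N h// sqrtr0. Qed.

Section Adjoint.
Variables (T S : V -> V) (B : R).
Hypotheses (KT : forall f, K f -> K (T f)) (KS : forall f, K f -> K (S f))
  (TS : forall f g, K f -> K g -> ip (T f) g = ip f (S g))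
  (TB : forall f, K f -> N (T f) <= B * N f).

Lemma adjC f g : K f -> K g -> ip (S f) g = ip f (T g).
Proof.
move=> Kf Kg; have KSf := KS Kf; have KTg := KT Kg.
by rewrite (ipC H (KL Kg))// -TS// -(ipC H).
Qed.
(** [T] is an arbitrary function with an adjoint. Moving it onto the other argument as [S] shows
    that the defect of additivity is orthogonal to all of [K], hence to itself. *)
Lemma opB f g : K f -> K g -> N (T (f - g) - (T f - T g)) = 0.
Proof.
move=> Kf Kg; have Kfg := subB Kf Kg; have KTf := KT Kf; have KTg := KT Kg.
have KTfg := KT Kfg; have KTB := subB KTf KTg.
apply: nrm_null_test => [|h Kh].
  exact: subB.
have KSh := KS Kh.
by rewrite !(ipBl H)// !TS// (ipBl H)// subrr.
Qed.
Lemma opZ a f : K f -> N (T (a *: f) - a *: T f) = 0.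
Proof.
move=> Kf; have Kaf := KZ a Kf; have KTf := KT Kf.
have KTaf := KT Kaf; have KaTf := KZ a KTf.
apply: nrm_null_test => [|h Kh].
  exact: subB.
have KSh := KS Kh.
by rewrite (ipBl H)// (ipZl H)// !TS// (ipZl H)// subrr.
Qed.
Lemma nrm_opB f g : K f -> K g -> N (T f - T g) <= B * N (f - g).
Proof.
move=> Kf Kg; have Kfg := subB Kf Kg; have KTf := KT Kf; have KTg := KT Kg.
have KTfg := KT Kfg; have KTB := subB KTf KTg.
by rewrite -(nrm_null_eq (KL KTfg) (KL KTB) (opB Kf Kg)) TB.
Qed.
Lemma adj_bound f : K f -> N (S f) <= B * N f.
Proof.
move=> Kf; have KSf := KS Kf; have KTSf := KT KSf.
have [->|n0] := eqVneq (N (S f)) 0.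
  have := TB Kf; have := nrm_ge0 (ip := ip) (T f); lra.
have np : 0 < N (S f) by rewrite lt_neqAle eq_sym n0 nrm_ge0.
rewrite -(ler_pM2l np) -expr2 (nrm_sqr H)// adjC//.
apply: le_trans (ler_norm _) _; apply: le_trans (Re_le_cmod _) _.
rewrite (le_trans (ip_CS H (KL Kf) (KL KTSf)))//.
have -> : N (S f) * (B * N f) = N f * (B * N (S f)) by ring.
by rewrite ler_wpM2l ?nrm_ge0// TB.
Qed.
End Adjoint.
End SelfAdjointSquare.

(** * Compact operators and singular values *)

Section Spectral.
Context {R : realType} {V : lmodType R[i]} {L : set V} {ip : V -> V -> R[i]}.
Hypothesis H : semi_ip L ip.
Context {K : set V}.
Hypothesis HK : subspace_of L K.
Local Notation N := (nrm ip).
Implicit Types (f g h : V).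

Definition compact_on (T : V -> V) :=
  forall f : nat -> V, (forall n, K (f n)) ->
    (exists M : R, forall n, N (f n) <= M) ->
    exists (phi : nat -> nat) (g : V),
      [/\ {homo phi : m n / (m < n)%N}, K g &
          (fun n => N (T (f (phi n)) - g)) @ \oo --> 0].

Variables (T S : V -> V) (B : R).
Hypotheses (KT : forall f, K f -> K (T f)) (KS : forall f, K f -> K (S f))
  (TS : forall f g, K f -> K g -> ip (T f) g = ip f (S g))
  (B0 : 0 <= B) (TB : forall f, K f -> N (T f) <= B * N f)
  (cT : compact_on T).

Let KL f : K f -> L f. Proof. exact: (subKL HK). Qed.
Let KZ := subZ HK.
Let KB := subB HK.
#[local] Hint Extern 0 (L _) => (by apply: KL) : core.

Definition perp_of (E : seq V) : set V :=
  [set f | K f /\ forall e, e \in E -> ip f e = 0].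

(** The norm of the restriction of [T] to the orthogonal complement of [E] in [K]. *)
Definition opsup E : R := sup [set N (T f) | f in [set f | perp_of E f /\ N f <= 1]].

Lemma perp0 E : (forall e, e \in E -> K e) -> perp_of E 0.
Proof.
by move=> KE; split; [exact: (sub0 HK)|move=> e /KE Ke; rewrite (ip0l H)//].
Qed.

Lemma opsup_has E : (forall e, e \in E -> K e) ->
  has_sup [set N (T f) | f in [set f | perp_of E f /\ N f <= 1]].
Proof.
move=> KE; split.
  by exists (N (T 0)), 0 => //; split; [exact: perp0|rewrite (nrm0 H) ler01].
exists B => _ [f [[Kf _] f1] <-].
by rewrite (le_trans (TB Kf))// -[leRHS]mulr1 ler_wpM2l.
Qed.

Lemma opsup_ge E f : (forall e, e \in E -> K e) -> perp_of E f -> N f <= 1 ->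
  N (T f) <= opsup E.
Proof.
move=> KE Ef f1; apply: ub_le_sup; first exact: (opsup_has KE).2.
by exists f.
Qed.

Lemma opsup_ge0 E : (forall e, e \in E -> K e) -> 0 <= opsup E.
Proof.
move=> KE; apply: le_trans (opsup_ge KE (perp0 KE) _); first exact: nrm_ge0.
by rewrite (nrm0 H) ler01.
Qed.

Lemma perpZ E a f : (forall e, e \in E -> K e) -> perp_of E f -> perp_of E (a *: f).
Proof.
move=> KE [Kf Ef]; split; first exact: KZ.
by move=> e Ee; have Ke := KE _ Ee; rewrite (ipZl H)// Ef// mulr0.
Qed.

Lemma opsup_bound E f : (forall e, e \in E -> K e) -> perp_of E f ->
  N (T f) <= opsup E * N f.
Proof.
move=> KE Ef; have Kf := Ef.1; have KTf := KT Kf.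
have [f0|f0] := eqVneq (N f) 0.
  by have := TB Kf; rewrite f0 !mulr0.
have fp : 0 < N f by rewrite lt_neqAle eq_sym f0 nrm_ge0.
pose a := ((N f)^-1)%:C%C : R[i].
have ca : cmod a = (N f)^-1 by rewrite cmod_real ger0_norm// invr_ge0 ltW.
have Kaf := KZ a Kf; have KTaf := KT Kaf; have KaTf := KZ a KTf.
have := opsup_ge KE (perpZ a KE Ef).
rewrite (nrmZ H)// ca mulVf// => /(_ (lexx _)).
have Eq := opZ H HK KT KS TS a Kf.
rewrite (nrm_null_eq H (KL KTaf) (KL KaTf) Eq) (nrmZ H)// ca mulrC.
by rewrite ler_pdivrMr.
Qed.

Definition eigen_list (E : seq V) := forall e, e \in E ->
  K e /\ exists mu : R, N (S (T e) - mu%:C%C *: e) = 0.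

Lemma eigen_listK E : eigen_list E -> forall e, e \in E -> K e.
Proof. by move=> hE e /hE[]. Qed.

(** [S T] is symmetric, so pairing [S (T f)] with an eigenvector [e] moves [S T] onto [e] and leaves
    a multiple of [ip f e]. *)
Lemma perp_invariant E f : eigen_list E -> perp_of E f -> perp_of E (S (T f)).
Proof.
move=> hE [Kf Ef]; have KTf := KT Kf; split; first exact: KS.
move=> e Ee; have [Ke [mu hmu]] := hE _ Ee.
have KTe := KT Ke; have KSTe := KS KTe; have Kme := KZ mu%:C%C Ke.
have KSTf := KS KTf.
rewrite (adjC H HK KT KS TS)// TS// (ipC H)//.
rewrite (ip_null_eq H (KL KSTe) (KL Kme) (KL Kf) hmu) (ipZl H)//.
by rewrite (ipC H (KL Kf) (KL Ke)) Ef// conjc0 mulr0 conjc0.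
Qed.

(** With M = [opsup E], expanding the square gives ||S T f||^2 + M^4 ||f||^2 - 2 M^2 ||T f||^2. The
    first two terms are at most M^4 each; for the first one, [S (T f)] stays in the complement of
    [E], where [T] has norm M. *)
Lemma near_maximizer E f : eigen_list E -> perp_of E f -> N f <= 1 ->
  N (S (T f) - (opsup E ^+ 2)%:C%C *: f) ^+ 2 <=
  (opsup E ^+ 2 - N (T f) ^+ 2) * (opsup E ^+ 2) *+ 2.
Proof.
move=> hE Ef f1; have KE := eigen_listK hE; have Kf := Ef.1.
have EST := perp_invariant hE Ef.
have KTf := KT Kf; have KSTf := KS KTf; have KTSTf := KT KSTf.
set M := opsup E; have M0 : 0 <= M := opsup_ge0 KE.
have KMf := KZ (M ^+ 2)%:C%C Kf.
have STM : N (S (T f)) <= M ^+ 2.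
  have [->|n0] := eqVneq (N (S (T f))) 0; first exact: sqr_ge0.
  have np : 0 < N (S (T f)) by rewrite lt_neqAle eq_sym n0 nrm_ge0.
  rewrite -(ler_pM2l np) -expr2 (nrm_sqr H)// (adjC H HK KT KS TS)//.
  apply: le_trans (ler_norm _) _; apply: le_trans (Re_le_cmod _) _.
  rewrite (le_trans (ip_CS H (KL KTf) (KL KTSTf)))//.
  have -> : N (S (T f)) * M ^+ 2 = M * (M * N (S (T f))) by ring.
  apply: ler_pM; rewrite ?nrm_ge0//; first exact: opsup_ge.
  exact: opsup_bound.
rewrite (nrm_sqrB H)// (nrmZ H)// cmod_real (ipZr H)//.
rewrite (adjC H HK KT KS TS)// conjc_real ReM_real -(nrm_sqr H)// ger0_norm ?sqr_ge0//.
rewrite -/M.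
have h1 : N (S (T f)) ^+ 2 <= M ^+ 4.
  by rewrite (_ : 4 = 2 * 2)%N// exprM ler_pXn2r// ?nnegrE ?nrm_ge0// sqr_ge0.
have h2 : (M ^+ 2 * N f) ^+ 2 <= M ^+ 4.
  rewrite exprMn -exprM -[leRHS]mulr1 ler_wpM2l ?exprn_ge0//.
  by rewrite exprn_ile1// nrm_ge0.
rewrite !mulr2n; move: h1 h2; rewrite (_ : M ^+ 4 = M ^+ 2 * M ^+ 2); last by ring.
nra.
Qed.

(** Along a maximizing sequence h_j, [near_maximizer] gives S T h_j - M^2 h_j -> 0, while
    compactness lets T h_j converge to some g on a subsequence. Hence h_j itself converges in norm,
    to S g / M^2, and the limit attains the supremum. *)
Lemma maximizer E : eigen_list E -> 0 < opsup E -> exists e,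
  [/\ perp_of E e, N e = 1, N (T e) = opsup E &
      N (S (T e) - (opsup E ^+ 2)%:C%C *: e) = 0].
Proof.
move=> hE M0; have KE := eigen_listK hE; set M := opsup E in M0 *.
have /choice[f fP] : forall j : nat, exists f,
    [/\ perp_of E f, N f <= 1 & M - j.+1%:R^-1 < N (T f)].
  move=> j; have j0 : 0 < (j.+1%:R^-1 : R) by rewrite invr_gt0.
  by have [_ [f [Ef f1] <-] ?] := sup_adherent j0 (opsup_has KE); exists f.
have Kf j : K (f j) by have [[]] := fP j.
have [] := cT Kf; first by exists 1 => n; have [] := fP n.
move=> phi [g [hphi Kg cg]].
have phi_ge n : (n <= phi n)%N.
  by elim: n => // n IH; apply: (leq_ltn_trans IH); exact: hphi.
pose h j := f (phi j).
have Kh j : K (h j) by exact: Kf.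
have KTh j : K (T (h j)) by exact: KT.
have KSTh j : K (S (T (h j))) by exact: KS.
have KSg := KS Kg.
have TM : (fun j => N (T (h j))) @ \oo --> M.
  have hM : (fun j : nat => M - j.+1%:R^-1) @ \oo --> M.
    rewrite -[X in _ --> X]subr0; apply: cvgB; first exact: cvg_cst.
    exact: cvg_harmonic.
  apply: (squeeze_cvgr _ hM (cvg_cst M)); apply: nearW => j.
  have [Ef f1 /ltW h1] := fP (phi j); rewrite opsup_ge// andbT.
  rewrite (le_trans _ h1)// lerB// lef_pV2 ?posrE// ler_nat.
  by rewrite ltnS.
have Mneq : M ^+ 2 != 0 by rewrite expf_neq0// gt_eqF.
pose c := (M ^+ 2)%:C%C : R[i].
have Kch j : K (c *: h j) by exact: KZ.
have c0 : cmod c = M ^+ 2 by rewrite cmod_real ger0_norm// sqr_ge0.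
pose e := c^-1 *: S g.
have Ke : K e by exact: KZ.
have ce : S g = c *: e.
  by rewrite scalerA mulfV ?scale1r// -cmod_eq0 c0.
have Kce : K (c *: e) by rewrite -ce.
have Khe j : K (h j - e) by exact: KB.
have d1 : (fun j => N (S (T (h j)) - c *: h j)) @ \oo --> 0.
  have sq : (fun j => Num.sqrt ((M ^+ 2 - N (T (h j)) ^+ 2) * (M ^+ 2) *+ 2))
     @ \oo --> 0.
    rewrite -[X in _ --> X]sqrtr0.
    apply: cvg_sqrt.
    have -> : (0 : R) = (M ^+ 2 - M ^+ 2) * M ^+ 2 *+ 2 by rewrite subrr mul0r mul0rn.
    apply: cvgMn; apply: cvgM; last exact: cvg_cst.
    by apply: cvgB; [exact: cvg_cst|rewrite !expr2; exact: cvgM].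
  apply: (squeeze_cvgr _ (cvg_cst 0) sq); apply: nearW => j.
  rewrite nrm_ge0/= -[leLHS]ger0_norm ?nrm_ge0// -sqrtr_sqr ler_wsqrtr//.
  by have [Ef f1 _] := fP (phi j); exact: near_maximizer.
have d2 : (fun j => N (S (T (h j)) - S g)) @ \oo --> 0.
  have sq : (fun j => B * N (T (h j) - g)) @ \oo --> 0.
    by rewrite -(mulr0 B); apply: cvgM => //; exact: cvg_cst.
  apply: (squeeze_cvgr _ (cvg_cst 0) sq); apply: nearW => j.
  rewrite nrm_ge0/= (nrm_opB H HK KS KT)//.
  - by move=> *; rewrite (adjC H HK KT KS TS).
  - by move=> *; rewrite (adj_bound H HK KT KS TS).
have he : (fun j => N (h j - e)) @ \oo --> 0.
  have sq : (fun j => (M ^+ 2)^-1 *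
      (N (S (T (h j)) - c *: h j) + N (S (T (h j)) - S g))) @ \oo --> 0.
    rewrite -(mulr0 (M ^+ 2)^-1); apply: cvgM; first exact: cvg_cst.
    by rewrite -(addr0 0); exact: cvgD.
  apply: (squeeze_cvgr _ (cvg_cst 0) sq); apply: nearW => j.
  rewrite nrm_ge0/= -(ler_pM2l (_ : 0 < M ^+ 2)) ?exprn_gt0// mulVKf//.
  rewrite -c0 -(nrmZ H)// scalerBr -ce (nrm_distC H (KL (KSTh j)) (KL (Kch j))).
  by apply: (nrm_triangle H); exact: KL.
have Ee : perp_of E e.
  split=> // x Ex; have Kx := KE _ Ex.
  have hx : (fun t => ip (h t) x) @ \oo --> (ip e x : R[i]^o).
    by apply: (cvg_ipl H) => // j; exact: KL.
  apply: (ccvg_unique hx); rewrite (_ : (fun t => _) = cst 0); first exact: (@cvg_cst R[i]^o).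
  by apply/funext => j; have [[_ Ef] _ _] := fP (phi j); exact: Ef.
have Ne1 : N e <= 1.
  apply: (@closed_cvg _ _ \oo _ (fun j => N (h j)) (fun x => x <= 1)).
  - exact: closed_le.
  - by apply: nearW => j; have [] := fP (phi j).
  - by apply: (cvg_nrm H) => // j; exact: KL.
have TeM : N (T e) = M.
  have KTe := KT Ke.
  apply: (rcvg_unique _ TM) => //; apply: (cvg_nrm H) => [j||]; try exact: KL.
  have sq : (fun j => B * N (h j - e)) @ \oo --> 0.
    by rewrite -(mulr0 B); apply: cvgM => //; exact: cvg_cst.
  apply: (squeeze_cvgr _ (cvg_cst 0) sq); apply: nearW => j.
  by rewrite nrm_ge0/= (nrm_opB H HK KT KS TS).
exists e; split=> //.
- apply/eqP; rewrite eq_le Ne1 /=.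
  by have := opsup_bound KE Ee; rewrite TeM -{1}(mulr1 M) ler_pM2l.
- have := near_maximizer hE Ee Ne1; rewrite -/M TeM subrr mul0r mul0rn => h0.
  by apply/eqP; rewrite -sqrf_eq0 eq_le h0 sqr_ge0.
Qed.

End Spectral.

Lemma extract_increasing (P : nat -> nat -> Prop) :
  (forall m j, exists n, (j < n)%N /\ P m n) ->
  exists phi : nat -> nat, {homo phi : m n / (m < n)%N} /\ forall m, P m (phi m).
Proof.
move=> h; have /choice[F FP] : forall mj : nat * nat, exists n,
    (mj.2 < n)%N /\ P mj.1 n by move=> [m j]; exact: h.
pose phi := fix phi n := if n is m.+1 then F (n, phi m) else F (0%N, 0%N).
exists phi; split; last by case=> [|m]; [have [] := FP (0, 0)%N|have [] := FP (m.+1, phi m)].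
apply: homo_ltn; first exact: ltn_trans.
by move=> n; have [] := FP (n.+1, phi n).
Qed.

(** Bounded scalar sequences converge along such a [U], which replaces diagonal extraction of
    subsequences. *)
Lemma ultra_oo : exists U : set_system nat, UltraFilter U /\ \oo `<=` U.
Proof. exact: ultraFilterLemma. Qed.

(** * Compactness criterion and singular value decomposition *)

Section SingularValues.
Context {R : realType} {V : lmodType R[i]} {L : set V} {ip : V -> V -> R[i]}.
Hypothesis H : semi_ip L ip.
Context {K : set V}.
Hypothesis HK : subspace_of L K.
Local Notation N := (nrm ip).
Implicit Types (f g h : V).

Let KL f : K f -> L f. Proof. exact: (subKL HK). Qed.
Let KZ := subZ HK.
Let KB := subB HK.
#[local] Hint Extern 0 (L _) => (by apply: KL) : core.

(** Stands in for completeness of [K]: no closedness is required of [subspace_of]. *)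
Definition weakly_compact :=
  forall (f : nat -> V) (U : set_system nat), UltraFilter U ->
  (forall n, K (f n)) -> (exists M : R, forall n, N (f n) <= M) ->
  exists l, K l /\ forall g, K g ->
    (fun n => ip (f n) g) @ U --> (ip l g : R[i]^o).

Definition finite_family (n : nat) (e : nat -> V) :=
  (forall k, (k < n)%N -> K (e k)) /\ orthonormal_on ip (fun k => (k < n)%N) e.

(** Choose a finite orthonormal family whose sum of [Q] is within [eps] of the supremum over all
    such families. Adjoining one more unit vector, orthogonal to the family, cannot gain more than
    [eps]. *)
Lemma finite_trace_small (Q : V -> R) (C M : R) :
  (forall f, K f -> 0 <= Q f <= M * N f ^+ 2) ->
  (forall a f, K f -> Q (a *: f) = cmod a ^+ 2 * Q f) ->
  (forall n e, finite_family n e -> \sum_(k < n) Q (e k) <= C) ->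
  forall eps, 0 < eps -> exists n e, finite_family n e /\
    forall f, K f -> (forall k, (k < n)%N -> ip f (e k) = 0) ->
      Q f <= eps * N f ^+ 2.
Proof.
move=> QM QZ QC eps eps0.
pose A := [set x | exists n e, finite_family n e /\ x = \sum_(k < n) Q (e k)].
have supA : has_sup A.
  split; last by exists C => _ [n [e [ne ->]]]; exact: QC.
  by exists 0; exists 0%N, (fun=> 0); split; [split|rewrite big_ord0].
have [_ [n [e [[Ke oe] ->]]] hx] := sup_adherent eps0 supA.
exists n, e; split=> // f Kf fe.
have [f0|f0] := eqVneq (N f) 0.
  by have /andP[_] := QM _ Kf; rewrite f0 expr0n /= !mulr0.
have fp : 0 < N f by rewrite lt_neqAle eq_sym f0 nrm_ge0.
pose a := ((N f)^-1)%:C%C : R[i].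
have ca : cmod a = (N f)^-1 by rewrite cmod_real ger0_norm// invr_ge0 ltW.
have Kaf := KZ a Kf.
pose e' k := if (k < n)%N then e k else a *: f.
have fe' : finite_family n.+1 e'.
  split=> [k _|i j]; first by rewrite /e'; case: ifP => // /Ke.
  rewrite !ltnS /e' => ile jle.
  case: ltnP => iln; case: ltnP => jln.
  - exact: oe.
  - have Kei := Ke _ iln.
    rewrite (ipC H)// (ipZl H)// fe// mulr0 conjc0.
    by rewrite (_ : i == j = false)//; apply/negbTE; rewrite neq_ltn (leq_trans iln).
  - have Kej := Ke _ jln.
    rewrite (ipZl H)// fe// mulr0.
    by rewrite (_ : i == j = false)//; apply/negbTE; rewrite neq_ltn (leq_trans jln)// orbT.
  - have -> : i == j by rewrite eqn_leq (leq_trans ile jln) (leq_trans jle iln).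
    rewrite (ipff H)// (nrmZ H)// ca mulVf// expr1n.
    by [].
have : \sum_(k < n.+1) Q (e' k) <= sup A.
  apply: ub_le_sup; first exact: supA.2.
  by exists n.+1, e'.
rewrite big_ord_recr /= (eq_bigr (fun k : 'I_n => Q (e k))); last first.
  by move=> i _; rewrite /e' ltn_ord.
rewrite /e' ltnn QZ// ca => h2.
have : (N f)^-1 ^+ 2 * Q f <= eps by lra.
by rewrite exprVn mulrC ler_pdivrMr ?exprn_gt0.
Qed.

Variables (T S : V -> V) (B : R).
Hypotheses (KT : forall f, K f -> K (T f)) (KS : forall f, K f -> K (S f))
  (TS : forall f g, K f -> K g -> ip (T f) g = ip f (S g))
  (B0 : 0 <= B) (TB : forall f, K f -> N (T f) <= B * N f).

(** Let [l] be the weak limit of [f] along an ultrafilter. The projection of [f n - l] on a finite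
    family has finitely many coefficients, all tending to 0, and [T] is small on the orthogonal
    remainder; so T (f n) tends to T l in norm. *)
Lemma compact_of_finite_rank_approx : weakly_compact ->
  (forall eps, 0 < eps -> exists n e, finite_family n e /\
    forall f, K f -> (forall k, (k < n)%N -> ip f (e k) = 0) ->
      N (T f) <= eps * N f) ->
  compact_on (K := K) (ip := ip) T.
Proof.
move=> W FA f Kf [M fM].
have [U [UU oU]] := ultra_oo.
have [l [Kl fl]] := W f U UU Kf (ex_intro _ M fM).
have KTl := KT Kl.
have M0 : 0 <= M by apply: le_trans (fM 0%N); exact: nrm_ge0.
pose M' := M + N l.
have M'0 : 0 <= M' by rewrite addr_ge0// nrm_ge0.
have Kd n : K (f n - l) by exact: KB.
have dM n : N (f n - l) <= M'.
  by rewrite (le_trans (nrmB H (KL (Kf n)) (KL Kl)))// lerD2r.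
have KTf n : K (T (f n)) by exact: KT.
have conv eps : 0 < eps -> U [set n | N (T (f n) - T l) < eps].
  move=> eps0.
  (* [M'] bounds the norm of [f n - l]; the added 1 keeps the denominator positive. *)
  have eta0 : 0 < eps / 2 / (M' + 1) by rewrite !divr_gt0// ltr_wpDl.
  have [m [e [[Ke oe] he]]] := FA _ eta0.
  have sm : (fun n => B * Num.sqrt (\sum_(k < m | (k < m)%N) cmod (ip (f n - l) (e k)) ^+ 2))
      @ U --> 0.
    rewrite -[X in _ --> X](mulr0 B); apply: cvgM; first exact: cvg_cst.
    rewrite -[X in _ --> X]sqrtr0; apply: cvg_sqrt.
    rewrite [X in _ --> X](_ : 0 = \sum_(k < m | (k < m)%N) (0 : R)); last by rewrite big1.
    apply: (@cvg_finsum R R _ _ U _ _ _ (fun (k : 'I_m) n => cmod (ip (f n - l) (e k)) ^+ 2) (fun=> 0)) => k km; rewrite -[X in _ --> X](expr0n R 2).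
    have Kek := Ke _ km.
    have /ccvgP h := fl _ Kek.
    rewrite (_ : (fun n => _) = (fun n => cmod (ip (f n) (e k) - ip l (e k)) ^+ 2)).
      by rewrite !expr2; exact: cvgM.
    by apply/funext => n; rewrite (ipBl H).
  have e20 : 0 < eps / 2 by rewrite divr_gt0.
  move/cvgrPdist_lt : sm => /(_ _ e20); apply: filterS => n /=.
  rewrite sub0r normrN ger0_norm ?mulr_ge0 ?sqrtr_ge0// => h1.
  set d := f n - l in h1 *.
  have Le k : (k < m)%N -> L (e k) by move=> km; have := Ke _ km.
  pose p := proj_sum ip (fun k => (k < m)%N) e d m.
  have Kp : K p by apply: (sub_sum HK) => i im; apply: KZ; exact: Ke.
  have Kdn : K d := Kd n.
  have Kdp : K (d - p) by exact: KB.
  have KTd := KT Kdn; have KTp := KT Kp; have KTdp := KT Kdp.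
  have KTB := KB (KTf n) KTl; have KTB' := KB KTd KTp.
  rewrite -(nrm_null_eq H (KL KTd) (KL KTB)); last exact: (opB H HK KT KS TS).
  have -> : N (T d) = N ((T d - T p) + T p) by rewrite subrK.
  rewrite (le_lt_trans (nrmD H (KL KTB') (KL KTp)))//.
  rewrite [eps]splitr ltr_leD//.
    rewrite -(nrm_null_eq H (KL KTdp) (KL KTB')); last exact: (opB H HK KT KS TS).
    have perp k : (k < m)%N -> ip (d - p) (e k) = 0.
      by move=> km; exact: (ip_proj_sum_perp H Le oe (KL Kdn) km km).
    rewrite (le_lt_trans (he _ Kdp perp))//.
    have Ndp : N (d - p) <= M'.
      rewrite (le_trans _ (dM n))// -(@ler_pXn2r _ 2)// ?nnegrE ?nrm_ge0//.
      rewrite (bessel_eq H Le oe)//.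
      by rewrite lerBlDr lerDl sumr_ge0// => i _; rewrite sqr_ge0.
    rewrite (@le_lt_trans _ _ (eps / 2 / (M' + 1) * M'))//.
      by rewrite ler_wpM2l// ltW.
    rewrite -mulrA gtr_pMr// mulrC ltr_pdivrMr ?ltr_wpDl// mul1r ltrDl//.
  rewrite (le_trans (TB Kp))//.
  have -> : N p = Num.sqrt (\sum_(k < m | (k < m)%N) cmod (ip d (e k)) ^+ 2).
    rewrite -(nrm_lincomb H Le oe (fun k => ip d (e k))) sqrtr_sqr ger0_norm//.
    exact: nrm_ge0.
  exact: ltW.
(* Sets of the ultrafilter meet every tail of [nat], so an ordinary increasing subsequence can be
   read off. *)
have [phi [hphi phiP]] : exists phi : nat -> nat,
    {homo phi : m n / (m < n)%N} /\
    forall m, N (T (f (phi m)) - T l) < m.+1%:R^-1.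
  apply: (@extract_increasing (fun m n => N (T (f n) - T l) < m.+1%:R^-1)) => m j.
  have m0 : 0 < (m.+1%:R^-1 : R) by rewrite invr_gt0.
  have Uj : U [set n | (j < n)%N] by apply: oU; exact: nbhs_infty_gt.
  have [n [h1 h2]] := filter_ex (filterI (conv _ m0) Uj).
  by exists n.
exists phi, (T l); split => //.
apply: (squeeze_cvgr _ (cvg_cst (0 : R)) (@cvg_harmonic R)).
by apply: nearW => n; rewrite nrm_ge0/= ltW.
Qed.

Hypothesis cT : compact_on (K := K) (ip := ip) T.

(** Greedy choice of the next singular vector. Once [T] is null on the complement of [E] the default
    0 is returned; it is an eigenvector in the sense of [eigen_list] and imposes no new
    orthogonality. *)
Let nxt (E : seq V) : V := xget 0 [set e | 0 < opsup (K := K) (ip := ip) T E /\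
  [/\ perp_of (K := K) (ip := ip) E e, N e = 1, N (T e) = opsup (K := K) (ip := ip) T E &
      N (S (T e) - (opsup (K := K) (ip := ip) T E ^+ 2)%:C%C *: e) = 0]].

Let chosen := fix chosen n := if n is m.+1 then nxt (chosen m) :: chosen m else [::].
Let sv n := opsup (K := K) (ip := ip) T (chosen n).
Let ev n := nxt (chosen n).

Let chosen_eigen n : eigen_list (K := K) (ip := ip) T S (chosen n).
Proof.
elim: n => [|n IH] //= e; rewrite inE => /orP[/eqP->|]; last exact: IH.
rewrite /nxt; case: xgetP => [x -> [_ [[Kx _] _ _ h]]|_].
  by split=> //; eexists; exact: h.
split; first exact: (sub0 HK).
exists 0; rewrite scale0r subr0.
have K0 := sub0 HK; have KT0 := KT K0; have KST0 := KS KT0.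
apply/eqP; rewrite eq_le nrm_ge0 andbT.
rewrite (le_trans (adj_bound H HK KT KS TS TB KT0))//.
rewrite (le_trans (ler_wpM2l B0 (TB K0)))//.
by rewrite (nrm0 H) !mulr0.
Qed.

Let chosenK n := eigen_listK (@chosen_eigen n).

Let sv_ge0 n : 0 <= sv n.
Proof. exact: (opsup_ge0 H HK B0 TB (@chosenK n)). Qed.

Let ev_spec n : 0 < sv n ->
  [/\ perp_of (K := K) (ip := ip) (chosen n) (ev n), N (ev n) = 1, N (T (ev n)) = sv n &
      N (S (T (ev n)) - (sv n ^+ 2)%:C%C *: ev n) = 0].
Proof.
move=> s0; rewrite /ev /nxt; case: xgetP => [x -> [_ //]|/(_ _) none].
have [e he] := maximizer H HK KT KS TS B0 TB cT (@chosen_eigen n) s0.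
by have := none e; case.
Qed.

Let evK n : K (ev n).
Proof. by have := @chosenK n.+1 (ev n); apply; rewrite inE eqxx. Qed.

Let chosenS m n : (m < n)%N -> ev m \in chosen n.
Proof.
elim: n => // n IH; rewrite ltnS leq_eqVlt => /orP[/eqP->|/IH mn] /=.
  by rewrite inE eqxx.
by rewrite inE mn orbT.
Qed.

Let chosen_ind n f : (forall k, (k < n)%N -> ip f (ev k) = 0) ->
  forall e, e \in chosen n -> ip f e = 0.
Proof.
elim: n => // n IH h e /=; rewrite inE => /orP[/eqP->|]; first exact: h.
by apply: IH => k kn; apply: h; rewrite ltnS ltnW.
Qed.

Let sv_anti : {homo sv : m n / (m <= n)%N >-> n <= m}.
Proof.
apply: homo_leq => [x|x y z h1 h2|n]; [exact: lexx|exact: le_trans h1|].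
apply: ge_sup; first exact: (opsup_has H HK B0 TB (@chosenK n.+1)).1.
move=> _ [f [[Kf fE] f1] <-].
apply: (opsup_ge H HK B0 TB (@chosenK n)) => //; split=> // e ein.
by apply: fE; rewrite /= inE ein orbT.
Qed.

Let ev_ortho : orthonormal_on ip (fun n => 0 < sv n) ev.
Proof.
have lt m n : 0 < sv m -> 0 < sv n -> (m < n)%N -> ip (ev n) (ev m) = 0.
  by move=> _ /ev_spec[[_ h] _ _ _] mn; apply: h; exact: chosenS.
move=> m n m0 n0; have [mn|nm|<-] := ltngtP m n.
- by rewrite (ipC H (KL (evK n)) (KL (evK m))) lt// conjc0.
- by rewrite lt.
- by rewrite (ipff H (KL (evK m))); have [_ -> _ _] := ev_spec m0; rewrite expr1n.
Qed.

(** The last clause is where compactness is used again. If [f] is orthogonal to all chosen vectors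
    and T f is not null, every singular value is at least ||T f|| / ||f||. The vectors T (ev n) are
    then pairwise orthogonal with norms bounded below; the limit of a subsequence would be
    orthogonal to each of them, hence to itself, although its norm is positive. *)
Lemma singular_value_decomposition : exists (s : nat -> R) (e : nat -> V),
  [/\ (forall n, 0 <= s n), {homo s : m n / (m <= n)%N >-> n <= m},
      (forall n, K (e n)), orthonormal_on ip (fun n => 0 < s n) e &
      [/\ (forall n, 0 < s n -> N (T (e n)) = s n),
          (forall n, 0 < s n -> N (S (T (e n)) - (s n ^+ 2)%:C%C *: e n) = 0) &
          (forall f, K f -> (forall n, 0 < s n -> ip f (e n) = 0) ->
             N (S (T f)) = 0)]].
Proof.
exists sv, ev; split=> //; split=> [n /ev_spec[]//|n /ev_spec[]//|f Kf fe].
suff Tf0 : N (T f) = 0.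
  apply/eqP; rewrite eq_le nrm_ge0 andbT.
  by rewrite (le_trans (adj_bound H HK KT KS TS TB (KT Kf)))// Tf0 mulr0.
have fev k : ip f (ev k) = 0.
  have [/fe//|] := ltP 0 (sv k).
  move=> h; rewrite /ev /nxt; case: xgetP => [x _ [+ _]|_].
    by rewrite ltNge h.
  by rewrite (ip0r H)//; exact: KL.
have perpf n : perp_of (K := K) (ip := ip) (chosen n) f.
  by split=> //; apply: chosen_ind.
have bnd n : N (T f) <= sv n * N f.
  exact: (opsup_bound H HK KT KS TS B0 TB (@chosenK n)).
apply/eqP/negPn/negP => Tfn0.
have Tfp : 0 < N (T f) by rewrite lt_neqAle eq_sym Tfn0 nrm_ge0.
have fp : 0 < N f.
  rewrite lt_neqAle eq_sym nrm_ge0 andbT; apply/eqP => f0.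
  by have := bnd 0%N; rewrite f0 mulr0 leNgt Tfp.
have svp n : N (T f) / N f <= sv n by rewrite ler_pdivrMr.
have ep : 0 < N (T f) / N f by rewrite divr_gt0.
have sp n : 0 < sv n by exact: lt_le_trans (svp n).
have KTe n : K (T (ev n)) by exact: KT.
have KSTe n : K (S (T (ev n))) by exact: KS.
have ortT m n : m != n -> ip (T (ev m)) (T (ev n)) = 0.
  move=> mn; rewrite -(adjC H HK KT KS TS)//.
  have [_ _ _ h] := ev_spec (sp m).
  have Kse := KZ (sv m ^+ 2)%:C%C (evK m).
  rewrite (ip_null_eq H (KL (KSTe m)) (KL Kse) (KL (evK n)) h).
  have Lm := KL (evK m); have Ln := KL (evK n).
  by rewrite (ipZl H)// ev_ortho// (negbTE mn) mulr0.
have [] := cT evK; first by exists 1 => n; have [_ -> _ _] := ev_spec (sp n).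
move=> phi [g [hphi Kg cg]].
have phi_inj m n : (m < n)%N -> phi m != phi n.
  by move=> /hphi; rewrite ltn_neqAle => /andP[].
have gT m : ip g (T (ev (phi m))) = 0.
  have h : (fun n => ip (T (ev (phi n))) (T (ev (phi m)))) @ \oo -->
      (ip g (T (ev (phi m))) : R[i]^o).
    by apply: (cvg_ipl H) => // n; exact: KL.
  apply: (ccvg_unique h).
  apply/ccvgP; apply: cvg_near_cst.
  exists m.+1 => // n /= mn; rewrite subr0 ortT ?cmod0//.
  by rewrite eq_sym phi_inj.
have gg : ip g g = 0.
  have h : (fun n => ip (T (ev (phi n))) g) @ \oo --> (ip g g : R[i]^o).
    by apply: (cvg_ipl H) => // n; exact: KL.
  apply: (ccvg_unique h).
  rewrite (_ : (fun n => _) = cst 0); first exact: (@cvg_cst R[i]^o).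
  apply/funext => n; rewrite (ipC H (KL Kg) (KL (KTe _))) gT conjc0//.
have Ng : N g = 0 by rewrite /nrm gg sqrtr0.
have : (fun n => N (T (ev (phi n)))) @ \oo --> N g.
  by apply: (cvg_nrm H) => // n; exact: KL.
rewrite Ng => /cvgrPdist_lt /(_ _ ep) [n _ /(_ n (leqnn n))].
rewrite /= sub0r normrN ger0_norm ?nrm_ge0//.
by have [_ _ -> _] := ev_spec (sp (phi n)); rewrite ltNge svp.
Qed.

End SingularValues.

(** * Norms of images in terms of singular values *)

Section SingularBound.
Context {R : realType} {V : lmodType R[i]} {L : set V} {ip : V -> V -> R[i]}.
Hypothesis H : semi_ip L ip.
Context {K : set V}.
Hypothesis HK : subspace_of L K.
Local Notation N := (nrm ip).
Implicit Types (f g h : V).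

Let KL f : K f -> L f. Proof. exact: (subKL HK). Qed.
Let KZ := subZ HK.
Let KB := subB HK.
#[local] Hint Extern 0 (L _) => (by apply: KL) : core.

Variables (T S : V -> V).
Hypotheses (KT : forall f, K f -> K (T f)) (KS : forall f, K f -> K (S f))
  (TS : forall f g, K f -> K g -> ip (T f) g = ip f (S g))
  (W : weakly_compact (K := K) (ip := ip))
  (cT : compact_on (K := K) (ip := ip) T).
Variables (s : nat -> R) (e : nat -> V).
Hypotheses (Ke : forall n, K (e n))
  (oe : orthonormal_on ip (fun n => 0 < s n) e)
  (se : forall n, 0 < s n -> N (S (T (e n)) - (s n ^+ 2)%:C%C *: e n) = 0)
  (ce : forall f, K f -> (forall n, 0 < s n -> ip f (e n) = 0) -> N (S (T f)) = 0).

(** For the partial expansion [p n] of [g] the norm of T (p n) is computed exactly from the singular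
    values. The remainders g - p n have a weak limit [l] along an ultrafilter, orthogonal to every
    singular vector, so T l is null by [ce]; compactness makes T (g - p n) converge in norm on a
    subsequence, and the limit must be null too. *)
Lemma nrm_op_singular_le g (C : R) : K g ->
  (forall n, \sum_(k < n | 0 < s k) s k ^+ 2 * cmod (ip g (e k)) ^+ 2 <= C) ->
  N (T g) ^+ 2 <= C.
Proof.
move=> Kg sC.
have Le k : 0 < s k -> L (e k) by move=> _; exact: KL.
pose p n := proj_sum ip (fun k => 0 < s k) e g n.
have Kp n : K (p n) by apply: (sub_sum HK) => i im; exact: KZ.
have Kh n : K (g - p n) by exact: KB.
have KTh n : K (T (g - p n)) by exact: KT.
have hM : exists M : R, forall n, N (g - p n) <= M.
  exists (N g) => n; rewrite -(@ler_pXn2r _ 2)// ?nnegrE ?nrm_ge0//.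
  rewrite (bessel_eq H Le oe)//.
  by rewrite lerBlDr lerDl sumr_ge0// => i _; rewrite sqr_ge0.
have [phi [y [hphi Ky cy]]] := cT Kh hM.
have phi_ge n : (n <= phi n)%N.
  by elim: n => // n IH; apply: (leq_ltn_trans IH); exact: hphi.
have [U [UU oU]] := ultra_oo.
have [l [Kl hl]] : exists l, K l /\ forall z, K z ->
    (fun n => ip (g - p (phi n)) z) @ U --> (ip l z : R[i]^o).
  by apply: W => //; have [M HM] := hM; exists M.
have le k : 0 < s k -> ip l (e k) = 0.
  move=> sk; apply: (ccvg_unique (hl _ (Ke k))).
  apply/ccvgP; apply: cvg_near_cst; apply: oU.
  exists k.+1 => // n /= kn; rewrite subr0 (ip_proj_sum_perp H Le oe) ?cmod0//.
  exact: leq_trans (phi_ge n).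
have KTl := KT Kl; have KSTl := KS KTl.
have Tl0 : N (T l) = 0.
  apply/eqP; rewrite -sqrf_eq0 (nrm_sqr H)// -(adjC H HK KT KS TS)//.
  by rewrite (ip_nrm0l H)//; exact: ce.
have y0 : N y = 0.
  apply: (nrm_null_test (K := K)) => // z Kz; have KSz := KS Kz.
  have h1 : (fun n => ip (T (g - p (phi n))) z) @ U --> (ip y z : R[i]^o).
    apply: cvg_trans (_ : (fun n => ip (T (g - p (phi n))) z) @ \oo --> (ip y z : R[i]^o)).
      by move=> A /=; exact: oU.
    by apply: (cvg_ipl H) => // n; exact: KL.
  apply: (ccvg_unique h1).
  rewrite (_ : (fun n => _) = (fun n => ip (g - p (phi n)) (S z))); last first.
    by apply/funext => n; rewrite TS.
  rewrite (_ : 0 = ip l (S z)); first exact: hl.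
  by rewrite -TS// (ip_nrm0l H).
have Th0 : (fun n => N (T (g - p (phi n)))) @ \oo --> 0.
  by rewrite -y0; apply: (cvg_nrm H) => // n; exact: KL.
have KTe k : K (T (e k)) by exact: KT.
have KTp n : K (T (p n)) by exact: KT.
have Tp n w : K w -> ip (T (p n)) w =
    \sum_(k < n | 0 < s k) ip g (e k) * ip (T (e k)) w.
  move=> Kw; have KSw := KS Kw; rewrite TS// (ip_suml H)//.
    by apply: eq_bigr => k sk; rewrite (ipZl H)// ?TS//; exact: Le.
  by move=> k sk; apply: KL; exact: KZ.
have Tpn n : N (T (p n)) ^+ 2 <= C.
  rewrite (nrm_sqr H)// Tp// Re_sum (le_trans _ (sC n))//.
  apply: ler_sum => k sk; have Kek := Ke k; have KSTe := KS (KTe k).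
  rewrite -(adjC H HK KT KS TS)//.
  have Kse := KZ (s k ^+ 2)%:C%C Kek.
  rewrite (ip_null_eq H (KL KSTe) (KL Kse) (KL (Kp n)) (se sk)).
  rewrite (ipZl H)//; try exact: KL.
  rewrite (ipC H (KL (Kp n)) (KL Kek)).
  rewrite /p /proj_sum (ip_lincomb H Le oe (fun k => ip g (e k)))//.
  by rewrite mulrCA ReM_real mul_conjc.
have C0 : 0 <= C by apply: le_trans (Tpn 0%N); rewrite sqr_ge0.
have TgC : N (T g) <= Num.sqrt C.
  have KTg := KT Kg.
  have lim1 : (fun n => Num.sqrt C + N (T (g - p (phi n)))) @ \oo --> Num.sqrt C.
    by rewrite -[X in _ --> X]addr0; apply: cvgD => //; exact: cvg_cst.
  apply: (rcvg_le (cvg_cst (N (T g))) lim1); apply: nearW => n.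
  have KTB := KB KTg (KTp (phi n)).
  have := opB H HK KT KS TS Kg (Kp (phi n)) => E.
  rewrite (nrm_null_eq H (KL (KTh (phi n))) (KL KTB) E).
  rewrite -{1}(subrK (T (p (phi n))) (T g)).
  rewrite (le_trans (nrmD H (KL KTB) (KL (KTp (phi n)))))// addrC lerD2r.
  rewrite -[leLHS]ger0_norm ?nrm_ge0// -sqrtr_sqr ler_wsqrtr//.
by rewrite -(sqr_sqrtr C0) ler_pXn2r// ?nnegrE ?nrm_ge0// sqrtr_ge0.
Qed.

End SingularBound.

(** * The space L^2 of the circle *)

Section Mean.
Variable R : realType.
Local Notation mu := (@lebesgue_measure R).
Local Notation A := (@angles R : set (measurableTypeR R)).
Implicit Types (g h : R -> R) (f : R -> R[i]).

Lemma measurable_angles : measurable A. Proof. exact: measurable_itv. Qed.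
#[local] Hint Resolve measurable_angles : core.

Lemma twopi_gt0 : 0 < 2 * pi :> R. Proof. by rewrite mulr_gt0 ?pi_gt0. Qed.

Lemma mu_angles : mu A = (2 * pi)%:E.
Proof. by rewrite lebesgue_measure_itv/= lte_fin twopi_gt0 oppr0 adde0. Qed.

Definition mean g : R := (2 * pi)^-1 * Rintegral mu A g.
Definition mint g : Prop := mu.-integrable A (EFin \o g).

Lemma mint_measurable g : mint g -> measurable_fun A g.
Proof. by move=> /measurable_int /measurable_EFinP. Qed.
Lemma mint_le g h : measurable_fun A g -> (forall t, A t -> `|g t| <= h t) ->
  mint h -> mint g.
Proof.
move=> mg gh ih; apply: (le_integrable _ _ _ ih) => //.
  exact/measurable_EFinP.
move=> t At /=; rewrite lee_fin (le_trans (gh _ At))// ler_norm//.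
Qed.
Lemma mint_cst c : mint (fun=> c).
Proof.
apply/integrableP; split; first exact: measurable_cst.
rewrite (eq_integral (cst `|c|%:E))//.
by rewrite integral_cst// [X in (_ * X)%E]mu_angles -EFinM ltry.
Qed.
Lemma mint_bounded g M : measurable_fun A g -> (forall t, A t -> `|g t| <= M) ->
  mint g.
Proof. by move=> mg gM; apply: (mint_le mg gM); exact: mint_cst. Qed.
Lemma mintD g h : mint g -> mint h -> mint (fun t => g t + h t).
Proof.
move=> ig ih; exact: (integrableD measurable_angles ig ih).
Qed.
Lemma mintZ c g : mint g -> mint (fun t => c * g t).
Proof. by move=> ig; exact: (integrableZl measurable_angles c ig). Qed.
Lemma mintN g : mint g -> mint (fun t => - g t).
Proof. by move=> ig; exact: (integrableN ig). Qed.
Lemma mint_eq g h : (forall t, A t -> g t = h t) -> mint g -> mint h.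
Proof.
move=> gh; apply: eq_integrable => // t /set_mem At /=.
by rewrite gh.
Qed.
Lemma mint_sum (I : Type) (r : seq I) (P : pred I) (g : I -> R -> R) :
  (forall i, P i -> mint (g i)) -> mint (fun t => \sum_(i <- r | P i) g i t).
Proof.
move=> ig; elim: r => [|i r IH].
  by under eq_fun do rewrite big_nil; exact: mint_cst.
have [Pi|Pi] := boolP (P i).
  by under eq_fun do rewrite big_cons Pi; apply: mintD => //; exact: ig.
by under eq_fun do rewrite big_cons (negbTE Pi).
Qed.

Lemma mean_ge0 g : (forall t, A t -> 0 <= g t) -> 0 <= mean g.
Proof. by move=> g0; rewrite mulr_ge0 ?invr_ge0 ?(ltW twopi_gt0)// Rintegral_ge0. Qed.
Lemma mean_le g h : mint g -> mint h -> (forall t, A t -> g t <= h t) ->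
  mean g <= mean h.
Proof.
by move=> ig ih gh; rewrite ler_pM2l ?invr_gt0 ?twopi_gt0// le_Rintegral.
Qed.
Lemma mean_eq g h : (forall t, A t -> g t = h t) -> mean g = mean h.
Proof.
by move=> gh; congr (_ * _); apply: eq_Rintegral => t /set_mem; exact: gh.
Qed.
Lemma meanD g h : mint g -> mint h -> mean (fun t => g t + h t) = mean g + mean h.
Proof. by move=> ig ih; rewrite /mean RintegralD// mulrDr. Qed.
Lemma meanZ c g : mint g -> mean (fun t => c * g t) = c * mean g.
Proof. by move=> ig; rewrite /mean RintegralZl// mulrCA. Qed.
Lemma meanN g : mint g -> mean (fun t => - g t) = - mean g.
Proof.
move=> ig; rewrite -mulN1r -meanZ//; apply: mean_eq => t _.
by rewrite mulN1r.
Qed.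
Lemma mean_cst c : mean (fun=> c) = c.
Proof.
rewrite /mean Rintegral_cst// [X in fine X]mu_angles /=.
by rewrite mulrC mulfK// gt_eqF// twopi_gt0.
Qed.
Lemma mean_sum (I : Type) (r : seq I) (P : pred I) (g : I -> R -> R) :
  (forall i, P i -> mint (g i)) ->
  mean (fun t => \sum_(i <- r | P i) g i t) = \sum_(i <- r | P i) mean (g i).
Proof.
move=> ig; elim: r => [|i r IH].
  rewrite (@mean_eq _ (fun=> 0)); first by rewrite mean_cst big_nil.
  by move=> t _; rewrite big_nil.
rewrite big_cons; case: ifPn => Pi.
  rewrite -IH -meanD; [|exact: ig|exact: mint_sum].
  by apply: mean_eq => t _; rewrite big_cons Pi.
by rewrite -IH; apply: mean_eq => t _; rewrite big_cons (negbTE Pi).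
Qed.

Lemma mint_integral g : mint g ->
  (\int[mu]_(t in A) (g t)%:E = (2 * pi * mean g)%:E)%E.
Proof.
move=> ig; rewrite /mean mulVKf ?gt_eqF ?twopi_gt0// /Rintegral fineK//.
exact: integrable_fin_num.
Qed.

Lemma mint_ge0 g : measurable_fun A g -> (forall t, A t -> 0 <= g t) ->
  (\int[mu]_(t in A) (g t)%:E < +oo)%E -> mint g.
Proof.
move=> mg g0 h; apply/integrableP; split; first exact/measurable_EFinP.
rewrite (@eq_integral _ (measurableTypeR R) _ _ _ (fun t => (g t)%:E))// => t /set_mem At /=.
by rewrite ger0_norm// g0.
Qed.

Lemma mean_eq0 g : mint g -> (forall t, A t -> 0 <= g t) -> mean g = 0 ->
  {ae mu, forall t, A t -> g t = 0}.
Proof.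
move=> ig g0 m0.
have : (\int[mu]_(t in A) `|(EFin \o g) t| = 0)%E.
  rewrite (@eq_integral _ (measurableTypeR R) _ _ _ (fun t => (g t)%:E)); last first.
    by move=> t /set_mem At /=; rewrite ger0_norm// g0.
  by rewrite mint_integral// m0 mulr0.
have mEg : measurable_fun A (EFin \o g) by exact: measurable_int ig.
move/(ae_eq_integral_abs _ measurable_angles mEg).
by apply: filterS => t h /h [].
Qed.

Lemma mean_ae g h : measurable_fun A g -> measurable_fun A h ->
  {ae mu, forall t, A t -> g t = h t} -> mean g = mean h.
Proof.
move=> mg mh gh; congr (_ * fine _); apply: ae_eq_integral => //.
- exact/measurable_EFinP.
- exact/measurable_EFinP.
- by apply: filterS gh => t + At => /(_ At) ->.
Qed.

Definition cmeas f : Prop :=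
  measurable_fun A (fun t => complex.Re (f t)) /\
  measurable_fun A (fun t => complex.Im (f t)).

Lemma cmeas_cst c : cmeas (fun=> c).
Proof. by split; exact: measurable_cst. Qed.
Lemma cmeasD f f' : cmeas f -> cmeas f' -> cmeas (fun t => f t + f' t).
Proof.
move=> [f1 f2] [f'1 f'2]; split.
  by under eq_fun do rewrite ReD; exact: measurable_funD.
by under eq_fun do rewrite ImD; exact: measurable_funD.
Qed.
Lemma cmeasM f f' : cmeas f -> cmeas f' -> cmeas (fun t => f t * f' t).
Proof.
move=> [f1 f2] [f'1 f'2]; split.
  under eq_fun do rewrite ReM; apply: measurable_funB; exact: measurable_funM.
by under eq_fun do rewrite ImM; apply: measurable_funD; exact: measurable_funM.
Qed.
Lemma cmeas_conj f : cmeas f -> cmeas (fun t => conjc (f t)).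
Proof.
move=> [f1 f2]; split; first by under eq_fun do rewrite Re_conj.
by under eq_fun do rewrite Im_conj; exact: measurable_funN.
Qed.
Lemma cmeas_cmod2 f : cmeas f -> measurable_fun A (fun t => cmod (f t) ^+ 2).
Proof.
move=> [f1 f2]; under eq_fun do rewrite cmod_sqrE.
by apply: measurable_funD; exact: measurable_funX.
Qed.
Lemma cmeas_cmod f : cmeas f -> measurable_fun A (fun t => cmod (f t)).
Proof.
move=> mf; have -> : (fun t => cmod (f t)) = Num.sqrt \o (fun t => cmod (f t) ^+ 2).
  by apply/funext => t; rewrite /= sqrtr_sqr ger0_norm ?cmod_ge0.
apply: measurableT_comp; last exact: cmeas_cmod2.
by apply: continuous_measurable_fun; exact: sqrt_continuous.
Qed.
Lemma cmeasX f n : cmeas f -> cmeas (fun t => f t ^+ n).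
Proof.
move=> mf; elim: n => [|n IH]; first exact: cmeas_cst.
by under eq_fun do rewrite exprS; exact: cmeasM.
Qed.
Lemma cmeas_cvg (F : nat -> R -> R[i]) f : (forall n, cmeas (F n)) ->
  (forall t, A t -> (fun n => F n t) @ \oo --> (f t : R[i]^o)) -> cmeas f.
Proof.
move=> mF Ff; split.
  apply: (@measurable_fun_cvg _ _ _ _ (fun n t => complex.Re (F n t))) => //.
    by move=> n; case: (mF n).
  by move=> t /Ff; exact: ccvg_Re.
apply: (@measurable_fun_cvg _ _ _ _ (fun n t => complex.Im (F n t))) => //.
  by move=> n; case: (mF n).
by move=> t /Ff; exact: ccvg_Im.
Qed.
Lemma cmeas_expi : cmeas (@expi R).
Proof.
split; apply: measurable_funTS; apply: continuous_measurable_fun.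
  exact: continuous_cos.
exact: continuous_sin.
Qed.

Lemma L2circleP f : L2circle f <-> cmeas f /\ mint (fun t => cmod (f t) ^+ 2).
Proof.
split=> [[h1 h2 h3]|[[h1 h2] h3]]; last first.
  by split=> //; rewrite mint_integral// ltry.
split=> //; apply: mint_ge0 => //; first exact: cmeas_cmod2.
by move=> t _; rewrite sqr_ge0.
Qed.

Lemma L2_bounded f M : cmeas f -> (forall t, A t -> cmod (f t) <= M) -> L2circle f.
Proof.
move=> mf fM; apply/L2circleP; split=> //.
apply: (@mint_bounded _ (M ^+ 2)); first exact: cmeas_cmod2.
move=> t At; rewrite ger0_norm ?sqr_ge0// ler_pXn2r// ?nnegrE ?cmod_ge0 ?fM//.
exact: le_trans (cmod_ge0 _) (fM _ At).
Qed.

Lemma L2_mulb (b f : R -> R[i]) M : cmeas b -> (forall t, A t -> cmod (b t) <= M) ->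
  L2circle f -> L2circle (fun t => b t * f t).
Proof.
move=> mb bM /L2circleP[mf if2]; apply/L2circleP; split; first exact: cmeasM.
apply: (mint_le _ _ (mintZ (M ^+ 2) if2)).
  by apply: cmeas_cmod2; exact: cmeasM.
move=> t At; rewrite ger0_norm ?sqr_ge0// cmodM exprMn ler_wpM2r ?sqr_ge0//.
rewrite ler_pXn2r// ?nnegrE ?cmod_ge0 ?bM//.
exact: le_trans (cmod_ge0 _) (bM _ At).
Qed.

Lemma L2_mint_prod f f' : L2circle f -> L2circle f' ->
  mint (fun t => complex.Re (f t * conjc (f' t))) /\
  mint (fun t => complex.Im (f t * conjc (f' t))).
Proof.
move=> /L2circleP[mf if2] /L2circleP[mf' if'2].
have [m1 m2] := cmeasM mf (cmeas_conj mf').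
have b t : cmod (f t * conjc (f' t)) <= cmod (f t) ^+ 2 + cmod (f' t) ^+ 2.
  rewrite cmodM cmod_conj.
  have := sqr_ge0 (cmod (f t) - cmod (f' t)).
  have := sqr_ge0 (cmod (f t)); have := sqr_ge0 (cmod (f' t)).
  nra.
split; apply: (mint_le _ _ (mintD if2 if'2)) => // t _.
  exact: le_trans (Re_le_cmod _) (b t).
exact: le_trans (Im_le_cmod _) (b t).
Qed.

Lemma inner_prodE f f' : inner_prod f f' =
  Complex (mean (fun t => complex.Re (f t * conjc (f' t))))
          (mean (fun t => complex.Im (f t * conjc (f' t)))).
Proof. by apply: complexP; rewrite ?ReM_real ?ImM_real. Qed.

Lemma L2_add f f' : L2circle f -> L2circle f' -> L2circle (fun t => f t + f' t).
Proof.
move=> /L2circleP[mf if2] /L2circleP[mf' if'2]; apply/L2circleP; split.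
  exact: cmeasD.
apply: (mint_le _ _ (mintZ 2 (mintD if2 if'2))).
  by apply: cmeas_cmod2; exact: cmeasD.
move=> t _; rewrite ger0_norm ?sqr_ge0//.
have := cmodD (f t) (f' t); have := cmod_ge0 (f t + f' t).
have := sqr_ge0 (cmod (f t) - cmod (f' t)); nra.
Qed.

Lemma L2_scale c f : L2circle f -> L2circle (fun t => c * f t).
Proof. by move=> h; apply: (@L2_mulb _ _ (cmod c)) => //; exact: cmeas_cst. Qed.

Lemma L2_zero : L2circle (fun=> 0 : R[i]).
Proof. by apply: (@L2_bounded _ 0); [exact: cmeas_cst|move=> *; rewrite cmod0]. Qed.

Lemma L2_semi_ip :
  @semi_ip R (R -> R[i]^o) (@L2circle R) (@inner_prod R).
Proof.
split.
- exact: L2_zero.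
- by move=> f f'; exact: L2_add.
- by move=> c f; exact: L2_scale.
- move=> f f' h Lf Lf' Lh; rewrite !inner_prodE.
  have [r1 i1] := L2_mint_prod Lf Lh; have [r2 i2] := L2_mint_prod Lf' Lh.
  apply: complexP; rewrite /= -meanD//; apply: mean_eq => t _.
    by rewrite -ReD -mulrDl.
  by rewrite -ImD -mulrDl.
- move=> c f h Lf Lh; rewrite !inner_prodE.
  have [r1 i1] := L2_mint_prod Lf Lh.
  apply: complexP; rewrite /= -?meanZ//.
    rewrite ReM/= -meanZ// -meanZ// -meanN//; last exact: mintZ.
    rewrite -meanD//; [|exact: mintZ|by apply: mintN; exact: mintZ].
    by apply: mean_eq => t _; rewrite -mulrA ReM.
  rewrite ImM/= -meanZ// -meanZ// -meanD//; [|exact: mintZ|exact: mintZ].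
  by apply: mean_eq => t _; rewrite -mulrA ImM.
- move=> f h Lf Lh; rewrite !inner_prodE.
  have [r1 i1] := L2_mint_prod Lf Lh.
  apply: complexP; rewrite /=.
    by apply: mean_eq => t _; rewrite !ReM !Re_conj !Im_conj; ring.
  rewrite -meanN//.
  by apply: mean_eq => t _; rewrite !ImM !Re_conj !Im_conj; ring.
- move=> f Lf; rewrite inner_prodE /=; apply: mean_ge0 => t _.
  by rewrite mul_conjc /= sqr_ge0.
Qed.

Lemma norm2E f : norm2 f = @nrm R (R -> R[i]^o) (@inner_prod R) f.
Proof.
rewrite /norm2 /nrm inner_prodE; congr Num.sqrt; apply: mean_eq => t _.
by rewrite mul_conjc.
Qed.

Lemma norm2_mean f : norm2 f = Num.sqrt (mean (fun t => cmod (f t) ^+ 2)).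
Proof. by []. Qed.

Lemma norm2_sqr f : norm2 f ^+ 2 = mean (fun t => cmod (f t) ^+ 2).
Proof. by rewrite norm2_mean sqr_sqrtr// mean_ge0// => t _; rewrite sqr_ge0. Qed.

Lemma eq2P f f' : eq2 f f' <-> {ae mu, forall t, A t -> f t = f' t}.
Proof. by []. Qed.

Lemma norm2_eq0 f : L2circle f -> norm2 f = 0 <-> eq2 f (fun=> 0).
Proof.
move=> Lf; have /L2circleP[mf if2] := Lf; split=> [f0|/eq2P f0].
  apply/eq2P; have : mean (fun t => cmod (f t) ^+ 2) = 0 by rewrite -norm2_sqr f0 expr0n.
  move/(mean_eq0 if2) => h.
  have {}h := h (fun t _ => sqr_ge0 (cmod (f t))).
  apply: filterS h => t h At; apply/eqP; rewrite -cmod_eq0 -sqrf_eq0.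
  by apply/eqP; exact: h.
rewrite norm2_mean (@mean_ae _ (fun=> 0)) ?mean_cst ?sqrtr0//.
- exact: cmeas_cmod2.
- by apply: filterS f0 => t + At => /(_ At) ->; rewrite cmod0 expr0n.
Qed.

Lemma norm2_le_cmod f f' : L2circle f -> L2circle f' ->
  (forall t, A t -> cmod (f t) <= cmod (f' t)) -> norm2 f <= norm2 f'.
Proof.
move=> /L2circleP[mf if2] /L2circleP[mf' if'2] ff'.
rewrite !norm2_mean ler_wsqrtr// mean_le// => t At.
by rewrite ler_pXn2r// ?nnegrE ?cmod_ge0// ff'.
Qed.

Lemma norm2_bounded f M : 0 <= M -> cmeas f -> (forall t, A t -> cmod (f t) <= M) ->
  norm2 f <= M.
Proof.
move=> M0 mf fM; have /L2circleP[_ if2] := L2_bounded mf fM.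
rewrite norm2_mean -(ger0_norm M0) -sqrtr_sqr ler_wsqrtr//.
rewrite -(mean_cst (M ^+ 2)) mean_le//; first exact: mint_cst.
by move=> t At; rewrite ler_pXn2r// ?nnegrE ?cmod_ge0// fM.
Qed.

Lemma norm2_mulb (b f : R -> R[i]) M : 0 <= M -> cmeas b ->
  (forall t, A t -> cmod (b t) <= M) -> L2circle f ->
  norm2 (fun t => b t * f t) <= M * norm2 f.
Proof.
move=> M0 mb bM Lf; have Lbf := L2_mulb mb bM Lf.
have /L2circleP[_ ib] := Lbf; have /L2circleP[_ if2] := Lf.
rewrite -(@ler_pXn2r _ 2)// ?nnegrE ?mulr_ge0 ?sqrtr_ge0//.
rewrite exprMn !norm2_sqr -meanZ// mean_le//; first exact: mintZ.
move=> t At; rewrite cmodM exprMn ler_wpM2r ?sqr_ge0//.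
by rewrite ler_pXn2r// ?nnegrE ?cmod_ge0// bM.
Qed.

End Mean.
#[global] Hint Resolve measurable_angles : core.

(** * Orthonormality of the exponentials *)

Section Exponentials.
Variable R : realType.

Lemma expiX (t : R) n : expi t ^+ n = expi (n%:R * t).
Proof.
elim: n => [|n IH]; first by rewrite mul0r /expi cos0 sin0.
rewrite exprS IH -natr1 mulrDl mul1r addrC /expi cosD sinD.
apply: complexP; rewrite /=; ring.
Qed.

Lemma expi_turns n : expi (n%:R * (2 * pi)) = 1 :> R[i].
Proof.
by rewrite -expiX (_ : expi (2 * pi) = 1) ?expr1n// /expi mulr_natl cos2pi sin2pi.
Qed.

Lemma mean_FTC (g G : R -> R) : continuous g ->
  (forall t : R, is_derive t (1 : R) G (g t)) -> G (2 * pi) = G 0 -> mean g = 0.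
Proof.
move=> cg dG G0; rewrite /mean /Rintegral.
have cG : continuous G.
  by move=> t; apply: differentiable_continuous; apply/derivable1_diffP; apply: ex_derive.
have := @continuous_FTC2 R g G 0 (2 * pi) (twopi_gt0 R).
rewrite G0 -EFinB subrr => ->; first by rewrite mulr0.
- by apply: continuous_subspaceT.
- split=> //.
  + by apply: cvg_at_right_filter; exact: cG.
  + by apply: cvg_at_left_filter; exact: cG.
- by move=> t _; rewrite derive1E; apply: derive_val.
Qed.

Lemma is_derive_scale_comp (f : R -> R) (c t d : R) :
  is_derive (c * t) (1 : R) f d -> is_derive t (1 : R) (fun t => f (c * t)) (c * d).
Proof.
move=> fd; rewrite mulrC.
apply: (@is_derive1_comp _ f (fun t => c * t)) => //.
have := @is_deriveZ R R R id c t 1 1 (is_derive_id _ _).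
by rewrite /GRing.scale/= mulr1.
Qed.

Lemma continuous_scale_comp (f : R -> R) (c : R) : continuous f ->
  continuous (fun t => f (c * t)).
Proof.
move=> cf t; apply: (@continuous_comp _ _ _ (fun t => c * t) f); last exact: cf.
exact: mulrl_continuous.
Qed.

Lemma mean_cos n : (0 < n)%N -> mean (fun t : R => cos (n%:R * t)) = 0.
Proof.
move=> n0; have nn : n%:R != 0 :> R by rewrite pnatr_eq0 -lt0n.
apply: (@mean_FTC _ (fun t => n%:R^-1 * sin (n%:R * t))).
- by apply: continuous_scale_comp; exact: continuous_cos.
- move=> t.
  have := @is_deriveZ R R R (fun t => sin (n%:R * t)) n%:R^-1 t 1 _
    (is_derive_scale_comp (is_derive_sin _)).
  by rewrite /GRing.scale/= mulKf.
- by have [_ ->] := expi_turns n; rewrite !mulr0 sin0 mulr0.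
Qed.

Lemma mean_sin n : (0 < n)%N -> mean (fun t : R => sin (n%:R * t)) = 0.
Proof.
move=> n0; have nn : n%:R != 0 :> R by rewrite pnatr_eq0 -lt0n.
apply: (@mean_FTC _ (fun t => - n%:R^-1 * cos (n%:R * t))).
- by apply: continuous_scale_comp; exact: continuous_sin.
- move=> t.
  have := @is_deriveZ R R R (fun t => cos (n%:R * t)) (- n%:R^-1) t 1 _
    (is_derive_scale_comp (is_derive_cos _)).
  by rewrite /GRing.scale/= mulNr mulKf// opprK.
- by have [-> _] := expi_turns n; rewrite mulr0 cos0.
Qed.

Lemma expi_conjK (t : R) : expi t * conjc (expi t) = 1.
Proof. by rewrite mul_conjc cmod_expi expr1n. Qed.

Lemma expiX_conj (t : R) n m : (m <= n)%N ->
  expi t ^+ n * conjc (expi t ^+ m) = expi t ^+ (n - m).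
Proof.
move=> mn; rewrite -{1}(subnK mn) exprD rmorphXn /= -mulrA -exprMn.
by rewrite expi_conjK expr1n mulr1.
Qed.

Definition zpow (k : nat) : R -> R[i] := fun t => expi t ^+ k.

Lemma cmod_zpow k t : cmod (zpow k t) = 1.
Proof. by rewrite /zpow cmodX cmod_expi expr1n. Qed.

Lemma cmeas_zpow k : cmeas (zpow k). Proof. by apply: cmeasX; exact: cmeas_expi. Qed.

Lemma L2_zpow k : L2circle (zpow k).
Proof.
apply: (@L2_bounded _ _ 1) => [|t _]; first exact: cmeas_zpow.
by rewrite cmod_zpow.
Qed.

Lemma inner_zpow j k : inner_prod (zpow j) (zpow k) = (j == k)%:R.
Proof.
have lt m n : (m < n)%N -> inner_prod (zpow n) (zpow m) = 0.
  move=> mn; rewrite inner_prodE; have nm : (0 < n - m)%N by rewrite subn_gt0.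
  apply: complexP; rewrite /=.
    rewrite -[RHS](mean_cos nm); apply: mean_eq => t _.
    by rewrite /zpow (expiX_conj _ (ltnW mn)) expiX.
  rewrite -[RHS](mean_sin nm); apply: mean_eq => t _.
  by rewrite /zpow (expiX_conj _ (ltnW mn)) expiX.
have [jk|kj|<-] := ltngtP j k.
- rewrite (ipC (L2_semi_ip R) (L2_zpow k) (L2_zpow j)) lt// conjc0//.
- exact: lt.
- rewrite inner_prodE; apply: complexP => /=.
    by rewrite -[RHS](mean_cst 1); apply: mean_eq => t _; rewrite mul_conjc cmod_zpow expr1n.
  by rewrite -[RHS](mean_cst 0); apply: mean_eq => t _; rewrite mul_conjc.
Qed.

End Exponentials.

(** * The Riesz-Fischer theorem *)

Section RieszFischer.
Variable R : realType.
Local Notation mu := (@lebesgue_measure R).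
Local Notation A := (@angles R : set (measurableTypeR R)).
Local Notation HI := (L2_semi_ip R).
Implicit Types (a b : nat -> R[i]) (f g : R -> R[i]).

Definition tsum a n : R -> R[i] := fun t => \sum_(k < n) a k * expi t ^+ k.

Lemma tsumE a n : tsum a n =
  \sum_(k < n | predT (k : nat)) (a k *: (@zpow R k : R -> R[i]^o) : R -> R[i]^o).
Proof. by apply/funext => t; rewrite fct_sumE. Qed.

Lemma ortho_zpow : @orthonormal_on R (R -> R[i]^o) (@inner_prod R) predT (@zpow R).
Proof. by move=> m n _ _; exact: inner_zpow. Qed.

Let L2z n : predT n -> L2circle (@zpow R n). Proof. by move=> _; exact: L2_zpow. Qed.

Lemma L2_tsum a n : L2circle (tsum a n).
Proof. by rewrite tsumE; apply: (dom_lincomb HI). Qed.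

Lemma norm2_tsum a n : norm2 (tsum a n) ^+ 2 = \sum_(k < n) cmod (a k) ^+ 2.
Proof. by rewrite norm2E tsumE (nrm_lincomb HI L2z ortho_zpow a). Qed.

Lemma inner_tsum_zpow a n k : (k < n)%N -> inner_prod (tsum a n) (@zpow R k) = a k.
Proof. by move=> kn; rewrite tsumE (ip_lincomb HI L2z ortho_zpow a). Qed.

Lemma L2_sub f g : L2circle f -> L2circle g -> L2circle (f - g).
Proof. exact: (domB HI). Qed.

Lemma norm2_ge0 f : 0 <= norm2 f. Proof. exact: sqrtr_ge0. Qed.

Lemma tsumB a b n : tsum a n - tsum b n = tsum (fun k => a k - b k) n.
Proof.
apply/funext => t; rewrite /tsum/= fctE -sumrB.
by apply: eq_bigr => k _; rewrite mulrBl.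
Qed.

Lemma tsum_diff a m n : (m <= n)%N ->
  tsum a n - tsum a m = tsum (fun k => if (k < m)%N then 0 else a k) n.
Proof.
move=> mn; apply/funext => t; rewrite fctE /tsum -(subnKC mn) !big_split_ord /=.
rewrite addrAC subrr add0r [X in _ = X + _]big1 ?add0r.
  by apply: eq_bigr => i _; rewrite ltnNge leq_addr.
by move=> i _; rewrite ltn_ord mul0r.
Qed.

Lemma norm2_tsum_diff a m n : (m <= n)%N ->
  norm2 (tsum a n - tsum a m) ^+ 2 =
  \sum_(k < n) cmod (a k) ^+ 2 - \sum_(k < m) cmod (a k) ^+ 2.
Proof.
move=> mn; rewrite tsum_diff// norm2_tsum -(subnKC mn) !big_split_ord /=.
rewrite addrAC subrr add0r [X in X + _ = _]big1 ?add0r.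
  by apply: eq_bigr => i _; rewrite ltnNge leq_addr.
by move=> i _; rewrite ltn_ord cmod0 expr0n.
Qed.

Lemma bounded_monotone_tail (s : nat -> R) (M : R) :
  {homo s : m n / (m <= n)%N >-> m <= n} -> (forall n, s n <= M) ->
  forall e, 0 < e -> exists N, forall m, (N <= m)%N -> s m - s N <= e.
Proof.
move=> hs sM e e0; have hS : has_sup (range s).
  by split; [exists (s 0%N), 0%N|exists M => _ [n _ <-]].
have [_ [N _ <-] hN] := sup_adherent e0 hS.
exists N => m Nm; have : s m <= sup (range s) by apply: ub_le_sup; [exact: hS.2|exists m].
lra.
Qed.

Definition ell2 a := exists M : R, forall n, \sum_(k < n) cmod (a k) ^+ 2 <= M.

Lemma sq_sums_homo a :
  {homo (fun n => \sum_(k < n) cmod (a k) ^+ 2) : m n / (m <= n)%N >-> m <= n}.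
Proof.
apply: homo_leq => [x|x y z|n]; [exact: lexx|exact: le_trans|].
by rewrite big_ord_recr /= lerDl sqr_ge0.
Qed.

Lemma cauchy_limit (T : nat -> R[i]) (C : R) :
  (forall j k, (j <= k)%N -> cmod (T k - T j) <= C * 2^-1 ^+ j) ->
  exists l, T @ \oo --> (l : R[i]^o) /\ forall j, cmod (l - T j) <= C * 2^-1 ^+ j.
Proof.
move=> hT.
have geo : (fun j => C * 2^-1 ^+ j) @ \oo --> (0 : R).
  rewrite -[X in _ --> X](mulr0 C); apply: cvgM; first exact: cvg_cst.
  by apply: cvg_expr; rewrite ger0_norm ?invr_ge0// invf_lt1// ltr1n.
have lim1 (p : R[i] -> R) : (forall z w, `|p z - p w| <= cmod (z - w)) ->
    cvgn (fun j => p (T j)).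
  move=> hp; apply/cauchy_cvgP/cauchy_exP => e e0.
  have e20 : 0 < e / 2 by rewrite divr_gt0.
  move/cvgrPdist_lt : geo => /(_ _ e20)[N _ /(_ N (leqnn N))].
  rewrite /= sub0r normrN => hN.
  exists (p (T N)); exists N => // n /= Nn; rewrite /ball/= distrC.
  rewrite (le_lt_trans (hp _ _))// (le_lt_trans (hT _ _ Nn))//.
  rewrite (le_lt_trans (ler_norm _))// (lt_le_trans hN)//; lra.
have cRe := lim1 (@complex.Re R) _; have cIm := lim1 (@complex.Im R) _.
have {}cRe : cvgn (fun j => complex.Re (T j)).
  by apply: cRe => z w; rewrite -ReN -ReD Re_le_cmod.
have {}cIm : cvgn (fun j => complex.Im (T j)).
  by apply: cIm => z w; rewrite -ImN -ImD Im_le_cmod.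
pose l := Complex (limn (fun j => complex.Re (T j))) (limn (fun j => complex.Im (T j))).
have Tl : T @ \oo --> (l : R[i]^o) by apply: ccvg_ReIm.
exists l; split=> // j.
have h : (fun k => cmod (T k - T j)) @ \oo --> cmod (l - T j).
  by apply: ccvg_cmod; apply: ccvgB; [exact: Tl|exact: ccvg_cst].
apply: (rcvg_le h (cvg_cst _)); exists j => // k /= jk; exact: hT.
Qed.

Lemma cmeas_if (p : R -> bool) f g :
  measurable_fun A p -> cmeas f -> cmeas g ->
  cmeas (fun t => if p t then f t else g t).
Proof.
move=> mp [f1 f2] [g1 g2]; split.
  rewrite (_ : (fun t => _) =
      (fun t => if p t then complex.Re (f t) else complex.Re (g t))).
    apply: measurable_fun_if => //.
      by apply: measurable_funS f1 => // t [].
    by apply: measurable_funS g1 => // t [].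
  by apply/funext => t; case: (p t).
rewrite (_ : (fun t => _) =
    (fun t => if p t then complex.Im (f t) else complex.Im (g t))).
  apply: measurable_fun_if => //.
    by apply: measurable_funS f2 => // t [].
  by apply: measurable_funS g2 => // t [].
by apply/funext => t; case: (p t).
Qed.

Lemma cmeasB f g : cmeas f -> cmeas g -> cmeas (f - g).
Proof.
move=> mf mg; have := cmeasD mf (cmeasM (cmeas_cst (-1)) mg).
by under eq_fun do rewrite mulN1r.
Qed.

(** Let D_j be the j-th block of the series. The weighted sum G = sum_j 4^j |D_j|^2 has finite
    integral, and wherever it is finite |D_j| <= sqrt(G) 2^-j. The partial sums [T j] then converge
    at a geometric rate with an error controlled by G, which gives the pointwise limit and its L^2
    distance at the same time. *)
Lemma riesz_fischer a : ell2 a ->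
  exists f, L2circle f /\ (fun n => norm2 (tsum a n - f)) @ \oo --> 0.
Proof.
move=> [M aM].
pose s n := \sum_(k < n) cmod (a k) ^+ 2.
have tail := bounded_monotone_tail (@sq_sums_homo a) aM.
(* Tails below 16^-j leave 4^-j after the weight 4^j, and the sum of 4^-j is the 4/3 in [iG]. *)
have [N [hN NP]] : exists N : nat -> nat, {homo N : m n / (m < n)%N} /\
    forall j m, (N j <= m)%N -> s m - s (N j) <= 16^-1 ^+ j.
  apply: (@extract_increasing (fun j n => forall m, (n <= m)%N -> s m - s n <= 16^-1 ^+ j)) => j k.
  have j0 : 0 < (16^-1 ^+ j : R) by rewrite exprn_gt0.
  have [n0 hn] := tail _ j0; exists (maxn n0 k.+1); split.
    by rewrite leq_max ltnSn orbT.
  move=> m; rewrite geq_max => /andP[n0m km].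
  apply: le_trans (hn m n0m); rewrite lerB//.
  by apply: sq_sums_homo; rewrite leq_max leqnn.
have hN' j k : (j <= k)%N -> (N j <= N k)%N.
  by rewrite leq_eqVlt => /orP[/eqP->//|/hN/ltnW].
pose T j := tsum a (N j).
pose D j : R -> R[i] := T j.+1 - T j.
have LT j : L2circle (T j) by exact: L2_tsum.
have LD j : L2circle (D j) by exact: L2_sub.
have mD j : measurable_fun A (fun t => 4 ^+ j * cmod (D j t) ^+ 2).
  have /L2circleP[mf _] := LD j.
  by apply: measurable_funM; [exact: measurable_cst|exact: cmeas_cmod2].
pose G t : \bar R := (\sum_(0 <= j <oo) (4 ^+ j * cmod (D j t) ^+ 2)%:E)%E.
have d0 t j : (0 <= (4 ^+ j * cmod (D j t) ^+ 2)%:E)%E.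
  by rewrite lee_fin mulr_ge0 ?exprn_ge0 ?cmod_ge0.
have G0 t : (0 <= G t)%E by apply: nneseries_ge0 => j _ _; exact: d0.
have mG : measurable_fun A G.
  apply: ge0_emeasurable_sum => j; first by move=> t At _; exact: d0.
  by move=> _; exact/measurable_EFinP.
have iG : (\int[mu]_(t in A) G t <= (2 * pi * (4 / 3))%:E)%E.
  rewrite integral_nneseries//; last by move=> j; exact/measurable_EFinP.
  have step j : (\int[mu]_(t in A) (4 ^+ j * cmod (D j t) ^+ 2)%:E <=
      (2 * pi * 4^-1 ^+ j)%:E)%E.
    have /L2circleP[_ iD] := LD j.
    rewrite mint_integral; last exact: mintZ.
    rewrite lee_fin ler_pM2l ?twopi_gt0// meanZ// -norm2_sqr norm2_tsum_diff ?hN'//.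
    have -> : 4^-1 ^+ j = 4 ^+ j * 16^-1 ^+ j :> R.
      by rewrite -exprMn; congr (_ ^+ j); field.
    by rewrite ler_wpM2l ?exprn_ge0//; apply: NP; exact: hN'.
  apply: (@le_trans _ _ (\sum_(0 <= j <oo) (2 * pi * 4^-1 ^+ j)%:E)%E).
    apply: lee_nneseries => [j _ _|j _]; last exact: step.
    by apply: integral_ge0 => t _; exact: d0.
  rewrite le_eqVlt; apply/orP; left; apply/eqP/cvg_lim => //.
  rewrite (_ : (fun n => _) = EFin \o (series (geometric (2 * pi) (4^-1 : R)))); last first.
    by apply/funext => n; rewrite /= sumEFin.
  apply: cvg_EFin; first exact: nearW.
  rewrite [X in _ --> X](_ : _ = 2 * pi / (1 - 4^-1)); last by field.
  apply: cvg_geometric_series.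
  by rewrite ger0_norm ?invr_ge0// invf_lt1// ltr1n.
(* Off [E] the function is set to 0, and its bound by a multiple of [G] in [ifT] holds because [G]
   is infinite there. *)
pose E t := (G t < +oo)%E.
have mE : measurable_fun A E.
  apply: (@measurable_fun_bool _ _ _ _ true).
  rewrite (_ : _ `&` _ = A `&` [set t | (G t < +oo)%E]).
    exact: emeasurable_fun_infty_o.
  by apply/seteqP; split=> t /=.
pose h j t := if E t then T j t else 0.
have bnd t : E t -> forall j k, (j <= k)%N ->
    cmod (T k t - T j t) <= 2 * Num.sqrt (fine (G t)) * 2^-1 ^+ j.
  move=> Et j k jk.
  have fG : G t \is a fin_num by rewrite ge0_fin_numE.
  have Dj i : cmod (D i t) <= Num.sqrt (fine (G t)) * 2^-1 ^+ i.
    have hi : 4 ^+ i * cmod (D i t) ^+ 2 <= fine (G t).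
      rewrite -lee_fin fineK//.
      apply: le_trans (nneseries_lim_ge i.+1 _); last by move=> n _ _; exact: d0.
      rewrite big_nat_recr//= leeDr// sume_ge0// => n _; exact: d0.
    rewrite -(@ler_pXn2r _ 2)// ?nnegrE ?cmod_ge0 ?mulr_ge0 ?sqrtr_ge0 ?exprn_ge0//.
    rewrite exprMn sqr_sqrtr ?fine_ge0// -exprM mulnC exprM.
    have -> : (2^-1 ^+ 2) = 4^-1 :> R by field.
    by rewrite exprVn ler_pdivlMr ?exprn_gt0// mulrC.
  have tele : cmod (T k t - T j t) <= \sum_(j <= i < k) cmod (D i t).
    rewrite -(telescope_sumr (fun i => T i t))//.
    exact: cmod_sum.
  apply: (le_trans tele).
  apply: (@le_trans _ _ (\sum_(j <= i < k) Num.sqrt (fine (G t)) * 2^-1 ^+ i)).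
    by apply: ler_sum => i _; exact: Dj.
  rewrite -mulr_sumr mulrAC mulrC ler_wpM2r ?sqrtr_ge0//.
  have -> : \sum_(j <= i < k) 2^-1 ^+ i = 2 * 2^-1 ^+ j - 2 * 2^-1 ^+ k :> R.
    rewrite -opprB -(telescope_sumr (fun i => 2 * 2^-1 ^+ i : R))// -sumrN.
    by apply: eq_bigr => i _; rewrite exprS; field.
  by rewrite lerBlDr lerDl mulr_ge0// exprn_ge0.
have /choice[f fP] : forall t, exists l, (fun j => h j t) @ \oo --> (l : R[i]^o) /\
    (E t -> forall j, cmod (l - T j t) <= 2 * Num.sqrt (fine (G t)) * 2^-1 ^+ j) .
  move=> t; rewrite /h; have [Et|/negP nEt] := boolP (E t).
    by have [l [h1 h2]] := cauchy_limit (bnd t Et); exists l.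
  by exists 0; split; [exact: ccvg_cst|].
have mh j : cmeas (h j).
  have /L2circleP[mT _] := LT j.
  exact: (cmeas_if mE mT (cmeas_cst 0)).
have mf : cmeas f.
  by apply: cmeas_cvg mh _ => t _; have [] := fP t.
have mfT j : cmeas (f - T j).
  by apply: cmeasB => //; have /L2circleP[] := LT j.
have ifT j : (\int[mu]_(t in A) (cmod ((f - T j) t) ^+ 2)%:E <=
    (4 * 4^-1 ^+ j * (2 * pi * (4 / 3)))%:E)%E.
  have c0 : 0 < 4 * 4^-1 ^+ j :> R by rewrite mulr_gt0// exprn_gt0.
  have c0E : (0 <= (4 * 4^-1 ^+ j : R)%:E)%E by rewrite lee_fin ltW.
  rewrite EFinM; apply: le_trans (lee_wpmul2l c0E iG).
  rewrite -ge0_integralZl//.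
  apply: ge0_le_integral => //.
  - by move=> t _; rewrite lee_fin sqr_ge0.
  - by apply/measurable_EFinP; exact: cmeas_cmod2.
  - by apply: measurable_funeM.
  move=> t _; have [Et|] := boolP (E t); last first.
    by rewrite /E -leNgt leye_eq => /eqP ->; rewrite mulry gtr0_sg// mul1e leey.
  have fG : G t \is a fin_num by rewrite ge0_fin_numE.
  rewrite -(fineK fG) -EFinM lee_fin.
  have [_ /(_ Et j) hl] := fP t.
  have -> : 4 * 4^-1 ^+ j * fine (G t) = (2 * Num.sqrt (fine (G t)) * 2^-1 ^+ j) ^+ 2.
    rewrite !exprMn sqr_sqrtr ?fine_ge0// -exprM mulnC exprM.
    have -> : (2^-1 ^+ 2) = 4^-1 :> R by field.
    by ring.
  rewrite ler_pXn2r// ?nnegrE ?cmod_ge0// !mulr_ge0 ?sqrtr_ge0// exprn_ge0//.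
have LfT j : L2circle (f - T j).
  apply/L2circleP; split => //; apply: mint_ge0; first exact: cmeas_cmod2.
    by move=> t _; rewrite sqr_ge0.
  by rewrite (le_lt_trans (ifT j))// ltry.
have Lf : L2circle f.
  by rewrite -(subrK (T 0%N) f); exact: L2_add.
exists f; split=> //.
have fTj j : norm2 (T j - f) <= 4 * 2^-1 ^+ j.
  rewrite -(@ler_pXn2r _ 2)// ?nnegrE ?norm2_ge0 ?mulr_ge0 ?exprn_ge0//.
  rewrite norm2E (nrm_distC HI (LT j) Lf) -norm2E norm2_sqr.
  have := ifT j; have /L2circleP[_ iD] := LfT j; rewrite mint_integral// lee_fin.
  have -> : 4 * 4^-1 ^+ j * (2 * pi * (4 / 3)) = 2 * pi * (16 / 3 * 4^-1 ^+ j) :> R.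
    by field.
  rewrite ler_pM2l ?twopi_gt0// => /le_trans; apply.
  rewrite exprMn -exprM mulnC exprM.
  have -> : (2^-1 ^+ 2) = 4^-1 :> R by field.
  by rewrite ler_wpM2r ?exprn_ge0//; lra.
(* 5 = 4 + 1: the 4 is from [fTj], the 1 from the tail beyond [N j], whose norm is at most 4^-j <=
   2^-j. *)
have geo : (fun j => 5 * 2^-1 ^+ j) @ \oo --> (0 : R).
  rewrite -[X in _ --> X](mulr0 5); apply: cvgM; first exact: cvg_cst.
  by apply: cvg_expr; rewrite ger0_norm ?invr_ge0// invf_lt1// ltr1n.
apply/cvgrPdist_lt => e e0.
move/cvgrPdist_lt : geo => /(_ _ e0)[j _ /(_ j (leqnn j))].
rewrite /= sub0r normrN => hj.
exists (N j) => // n /= Nn; rewrite sub0r normrN ger0_norm ?norm2_ge0//.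
apply: le_lt_trans hj; apply: le_trans (ler_norm _).
rewrite norm2E (le_trans (nrm_triangle HI (L2_tsum a n) (LT j) Lf))// -!norm2E.
have -> : 5 * 2^-1 ^+ j = 2^-1 ^+ j + 4 * 2^-1 ^+ j :> R by ring.
apply: lerD => //.
rewrite -(@ler_pXn2r _ 2)// ?nnegrE ?norm2_ge0 ?exprn_ge0//.
rewrite norm2_tsum_diff// (le_trans (NP _ _ Nn))// -exprM mulnC exprM.
have -> : (2^-1 ^+ 2) = 4^-1 :> R by field.
by rewrite lerXn2r ?nnegrE ?invr_ge0// lef_pV2 ?posrE// ler_nat.
Qed.

End RieszFischer.

(** * The Hardy space *)

Section Hardy.
Variable R : realType.
Local Notation mu := (@lebesgue_measure R).
Local Notation A := (@angles R : set (measurableTypeR R)).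
Local Notation HI := (L2_semi_ip R).
Implicit Types (a b : nat -> R[i]) (f g : R -> R[i]) (w : R[i]).

(** The working description of the Hardy space: [f] is the L^2 sum of the power series with
    coefficients [a]. [H2P] shows that it agrees with the definition by boundary values. *)
Definition h2coef a f := L2circle f /\ (fun n => norm2 (tsum a n - f)) @ \oo --> 0.

(** The reproducing kernel of the Hardy space; pairing with it, as in [ext], recovers the analytic
    function in the disk from its boundary values. *)
Definition szego w : R -> R[i] := fun t => (1 - conjc w * expi t)^-1.

Lemma disk_denom_gt0 w z : cmod w < 1 -> cmod z <= 1 -> 0 < cmod (1 - conjc w * z).
Proof.
move=> w1 z1; have := cmod_dist_le 1 (conjc w * z).
rewrite cmod1 cmodM cmod_conj; have := cmod_ge0 w; have := cmod_ge0 z; nra.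
Qed.

Lemma disk_denom_ge w z : cmod z <= 1 -> 1 - cmod w <= cmod (1 - conjc w * z).
Proof.
move=> z1; have := cmod_dist_le 1 (conjc w * z).
rewrite cmod1 cmodM cmod_conj; have := cmod_ge0 w; have := cmod_ge0 z; nra.
Qed.

Lemma tsum_szego w n t : cmod w < 1 ->
  szego w t - tsum (fun k => conjc w ^+ k) n t = (conjc w * expi t) ^+ n * szego w t.
Proof.
move=> w1; set x := conjc w * expi t.
have d0 : 1 - x != 0 by rewrite -cmod_gt0 disk_denom_gt0// cmod_expi.
have -> : tsum (fun k => conjc w ^+ k) n t = \sum_(k < n) x ^+ k.
  by apply: eq_bigr => k _; rewrite exprMn.
apply: (mulIf d0); rewrite mulrBl /szego -/x mulVf// -mulrA mulVf// mulr1.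
by rewrite [X in _ - X]mulrC -[1 - x]opprB mulNr -subrX1 !opprB addrC subrK.
Qed.

Lemma cmod_szego_le w t : cmod w < 1 -> cmod (szego w t) <= (1 - cmod w)^-1.
Proof.
move=> w1; rewrite cmodV lef_pV2 ?posrE ?subr_gt0//.
  by apply: disk_denom_ge; rewrite cmod_expi.
by apply: disk_denom_gt0 => //; rewrite cmod_expi.
Qed.

Lemma cmeas_tsum a n : cmeas (tsum a n).
Proof. by have /L2circleP[] := L2_tsum a n. Qed.

Lemma cvg_geo0 (x : R) : 0 <= x < 1 -> (fun n => x ^+ n) @ \oo --> 0.
Proof. by move=> /andP[x0 x1]; apply: cvg_expr; rewrite ger0_norm. Qed.

Lemma cmeas_szego w : cmod w < 1 -> cmeas (szego w).
Proof.
move=> w1; apply: (@cmeas_cvg _ (fun n => tsum (fun k => conjc w ^+ k) n)).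
  by move=> n; exact: cmeas_tsum.
move=> t _; apply/ccvgP.
have h : (fun n => cmod w ^+ n * cmod (szego w t)) @ \oo --> 0.
  rewrite -[X in _ --> X](mul0r (cmod (szego w t))); apply: cvgM; last exact: cvg_cst.
  by apply: cvg_geo0; rewrite cmod_ge0.
apply: cvg_trans h; apply: near_eq_cvg; apply: nearW => n.
by rewrite cmod_distC tsum_szego// cmodM cmodX cmodM cmod_conj cmod_expi mulr1.
Qed.

Lemma L2_szego w : cmod w < 1 -> L2circle (szego w).
Proof.
move=> w1; apply: L2_bounded => [|t _]; first exact: cmeas_szego.
exact: cmod_szego_le.
Qed.

Lemma h2coef_szego w : cmod w < 1 -> h2coef (fun k => conjc w ^+ k) (szego w).
Proof.
move=> w1; split; first exact: L2_szego.
have h : (fun n => cmod w ^+ n * (1 - cmod w)^-1) @ \oo --> 0.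
  rewrite -[X in _ --> X](mul0r (1 - cmod w)^-1); apply: cvgM; last exact: cvg_cst.
  by apply: cvg_geo0; rewrite cmod_ge0.
apply: (squeeze_cvgr _ (cvg_cst 0) h); apply: nearW => n; rewrite norm2_ge0/=.
apply: norm2_bounded.
- by rewrite mulr_ge0 ?exprn_ge0 ?cmod_ge0// invr_ge0 subr_ge0 ltW.
- by apply: cmeasB; [exact: cmeas_tsum|exact: cmeas_szego].
- move=> t _; rewrite cmod_distC tsum_szego// cmodM cmodX cmodM cmod_conj cmod_expi mulr1.
  by rewrite ler_wpM2l ?exprn_ge0 ?cmod_ge0// cmod_szego_le.
Qed.

Lemma h2coef_L2 a f : h2coef a f -> L2circle f. Proof. by case. Qed.

Lemma cvg_inner_tsum a f g : h2coef a f -> L2circle g ->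
  (fun n => inner_prod (tsum a n) g) @ \oo --> (inner_prod f g : R[i]^o).
Proof.
move=> [Lf af] Lg; apply: (cvg_ipl HI) => //; first by move=> n; exact: L2_tsum.
by under eq_fun do rewrite -norm2E.
Qed.

Lemma inner_h2coef_zpow a f k : h2coef a f -> inner_prod f (zpow k) = a k.
Proof.
move=> haf; apply: (ccvg_unique (cvg_inner_tsum haf (L2_zpow _ k))).
apply/ccvgP; apply: cvg_near_cst; exists k.+1 => // n /= kn.
by rewrite inner_tsum_zpow// subrr cmod0.
Qed.

Lemma inner_tsum_sum a n g : L2circle g ->
  inner_prod (tsum a n) g = \sum_(k < n) a k * inner_prod (zpow k) g.
Proof.
move=> Lg; rewrite tsumE (ip_suml HI)//; last first.
  by move=> i _; apply: (domZ HI); exact: L2_zpow.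
by apply: eq_bigr => i _; rewrite (ipZl HI)//; exact: L2_zpow.
Qed.

Lemma inner_tsum_szego a n w : cmod w < 1 ->
  inner_prod (tsum a n) (szego w) = \sum_(0 <= k < n) a k * w ^+ k.
Proof.
move=> w1; have Ls := L2_szego w1; rewrite inner_tsum_sum// big_mkord.
apply: eq_bigr => i _; rewrite (ipC HI Ls (L2_zpow _ i)).
by rewrite (inner_h2coef_zpow i (h2coef_szego w1)) rmorphXn /= conjcK.
Qed.

Definition ext f w := inner_prod f (szego w).

Lemma ext_series a f w : h2coef a f -> cmod w < 1 ->
  (fun n => \sum_(0 <= k < n) a k * w ^+ k) @ \oo --> (ext f w : R[i]^o).
Proof.
move=> haf w1; have := cvg_inner_tsum haf (L2_szego w1).
by under eq_fun do rewrite inner_tsum_szego//.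
Qed.

Lemma ell2_h2coef a f : h2coef a f -> ell2 a.
Proof.
move=> [Lf af].
have [M hM] : exists M, forall n, norm2 (tsum a n) <= M.
  have : cvgn (fun n => norm2 (tsum a n)).
    apply/cvg_ex; exists (norm2 f); under eq_fun do rewrite norm2E.
    rewrite norm2E; apply: (cvg_nrm HI) => // [n|]; first exact: L2_tsum.
    by under eq_fun do rewrite -norm2E.
  move=> /cvg_seq_bounded [M [_ hM]]; exists (M + 1) => n.
  by apply: le_trans (ler_norm _) _; apply: hM => //; rewrite ltrDl.
exists (M ^+ 2) => n; rewrite -norm2_tsum ler_pXn2r// ?nnegrE ?norm2_ge0//.
exact: le_trans (norm2_ge0 _) (hM 0%N).
Qed.

Lemma h2coef_exists a : ell2 a -> exists f, h2coef a f.
Proof. by move=> /riesz_fischer[f [Lf af]]; exists f. Qed.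

Lemma h2coef_null_eq a f g : h2coef a f -> L2circle g -> norm2 (f - g) = 0 -> h2coef a g.
Proof.
move=> [Lf af] Lg fg; split=> //.
apply: cvg_trans af; apply: near_eq_cvg; apply: nearW => n.
have Ln := L2_tsum a n.
apply/eqP; rewrite eq_le; apply/andP; split.
  rewrite !norm2E (le_trans (nrm_triangle HI Ln Lg Lf))// (nrm_distC HI Lg Lf).
  by rewrite -!norm2E fg addr0.
by rewrite !norm2E (le_trans (nrm_triangle HI Ln Lf Lg))// -!norm2E fg addr0.
Qed.

Lemma h2coef_unique a f g : h2coef a f -> h2coef a g -> norm2 (f - g) = 0.
Proof.
move=> [Lf af] [Lg ag].
have h : (fun n => norm2 (tsum a n - f) + norm2 (tsum a n - g)) @ \oo --> 0.
  by rewrite -(addr0 0); exact: cvgD.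
apply/eqP; rewrite eq_le norm2_ge0 andbT.
apply: (rcvg_le (cvg_cst _) h); apply: nearW => n.
have Ln := L2_tsum a n.
by rewrite !norm2E (nrm_distC HI Ln Lf) (nrm_triangle HI).
Qed.

Lemma geo_sum_le (x : R) m n : 0 <= x < 1 -> \sum_(n <= k < m) x ^+ k <= x ^+ n / (1 - x).
Proof.
move=> /andP[x0 x1]; have d0 : 0 < 1 - x by rewrite subr_gt0.
rewrite ler_pdivlMr// mulr_suml.
have [nm|mn] := leqP n m; last by rewrite (big_geq (ltnW mn)) exprn_ge0.
under eq_bigr do rewrite mulrBr mulr1 -exprSr -opprB.
rewrite sumrN (telescope_sumr (fun k => x ^+ k))// opprB lerBlDr lerDl.
exact: exprn_ge0.
Qed.

Definition dil (r : R) a : nat -> R[i] := fun k => a k * (r ^+ k)%:C%C.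

Lemma tsum_dil r a n t :
  tsum (dil r a) n t = \sum_(0 <= k < n) a k * (r%:C%C * expi t) ^+ k.
Proof.
rewrite big_mkord; apply: eq_bigr => k _.
by rewrite /dil exprMn -mulrA rmorphXn.
Qed.

(** Fix s with r < s < 1. The terms a_k s^k are bounded, being differences of convergent partial
    sums, so on the circle of radius r the series is dominated by a geometric series of ratio r / s
    and converges uniformly. *)
Lemma h2coef_dil (F : R[i] -> R[i]) a r :
  (forall w, cmod w < 1 ->
    (fun n => \sum_(0 <= k < n) a k * w ^+ k) @ \oo --> (F w : R[i]^o)) ->
  0 <= r < 1 -> h2coef (dil r a) (fun t => F (r%:C%C * expi t)).
Proof.
move=> aF /andP[r0 r1].
have [s [rs s1]] : exists s, r < s /\ s < 1.
  by exists ((r + 1) / 2); split; lra.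
have s0 : 0 < s by lra.
have [C hC] : exists C, forall k, cmod (a k) * s ^+ k <= C.
  have sc : cmod s%:C%C < 1 by rewrite cmod_real ger0_norm// ltW.
  have : cvgn (fun n => cmod (\sum_(0 <= k < n) a k * s%:C%C ^+ k)).
    by apply/cvg_ex; exists (cmod (F s%:C%C)); apply: ccvg_cmod; exact: aF.
  move=> /cvg_seq_bounded [M [_ hM]]; exists ((M + 1) + (M + 1)) => k.
  have hM1 n : cmod (\sum_(0 <= k < n) a k * s%:C%C ^+ k) <= M + 1.
    by apply: le_trans (ler_norm _) _; apply: hM => //; rewrite ltrDl.
  have -> : cmod (a k) * s ^+ k = cmod (a k * s%:C%C ^+ k).
    by rewrite cmodM cmodX cmod_real gtr0_norm.
  have -> : a k * s%:C%C ^+ k = \sum_(0 <= k < k.+1) a k * s%:C%C ^+ k -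
      \sum_(0 <= k < k) a k * s%:C%C ^+ k.
    by rewrite big_nat_recr//= addrAC subrr add0r.
  by rewrite (le_trans (cmodB _ _))// lerD.
pose x := r / s.
have x0 : 0 <= x by rewrite divr_ge0// ltW.
have x1 : x < 1 by rewrite ltr_pdivrMr// mul1r.
have C0 : 0 <= C by apply: le_trans (hC 0%N); rewrite mulr_ge0 ?cmod_ge0// exprn_ge0// ltW.
have wr t : cmod (r%:C%C * expi t) < 1.
  by rewrite cmodM cmod_expi mulr1 cmod_real ger0_norm.
have unif n t : cmod (tsum (dil r a) n t - F (r%:C%C * expi t)) <= C / (1 - x) * x ^+ n.
  have lim : (fun m => cmod (tsum (dil r a) n t - tsum (dil r a) m t)) @ \oo -->
      cmod (tsum (dil r a) n t - F (r%:C%C * expi t)).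
    apply: ccvg_cmod; apply: ccvgB; first exact: ccvg_cst.
    by under eq_fun do rewrite tsum_dil; exact: aF.
  apply: (rcvg_le lim (cvg_cst _)); exists n => // m /= nm.
  rewrite cmod_distC !tsum_dil (big_cat_nat (leq0n n) nm) /= addrAC subrr add0r.
  apply: (le_trans (cmod_sum _ _ _)).
  rewrite mulrAC -mulrA; apply: le_trans (ler_wpM2l C0 (geo_sum_le m n _)); last first.
    by rewrite x0 x1.
  rewrite mulr_sumr; apply: ler_sum => k _.
  rewrite cmodM cmodX cmodM cmod_expi mulr1 cmod_real ger0_norm//.
  rewrite /x expr_div_n mulrA ler_pdivlMr ?exprn_gt0// mulrAC ler_wpM2r//.
  by rewrite exprn_ge0.
have geo : (fun n => C / (1 - x) * x ^+ n) @ \oo --> 0.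
  rewrite -[X in _ --> X](mulr0 (C / (1 - x))); apply: cvgM; first exact: cvg_cst.
  by apply: cvg_geo0; rewrite x0.
have mF : cmeas (fun t => F (r%:C%C * expi t)).
  apply: (@cmeas_cvg _ (fun n => tsum (dil r a) n)); first by move=> n; exact: cmeas_tsum.
  move=> t _; apply/ccvgP.
  apply: (squeeze_cvgr _ (cvg_cst 0) geo); apply: nearW => n.
  by rewrite cmod_ge0 unif.
have c0 n : 0 <= C / (1 - x) * x ^+ n.
  by rewrite mulr_ge0 ?exprn_ge0// divr_ge0// subr_ge0 ltW.
split.
  apply: (@L2_bounded _ _ (C / (1 - x) * x ^+ 0)) => // t _.
  by have := unif 0%N t; rewrite {1}/tsum big_ord0 sub0r cmodN.
apply: (squeeze_cvgr _ (cvg_cst 0) geo); apply: nearW => n; rewrite norm2_ge0/=.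
apply: norm2_bounded => // [|t _]; last exact: unif.
by apply: cmeasB => //; exact: cmeas_tsum.
Qed.

Lemma h2coef_sq_le a f n : h2coef a f -> \sum_(k < n) cmod (a k) ^+ 2 <= norm2 f ^+ 2.
Proof.
move=> haf; have Lf := h2coef_L2 haf.
have := bessel HI (fun k _ => L2_zpow R k) (@ortho_zpow R) n Lf.
rewrite -norm2E; apply: le_trans; rewrite le_eqVlt; apply/orP; left; apply/eqP.
by apply: eq_bigr => k _; rewrite (inner_h2coef_zpow k haf).
Qed.

Lemma near_left1 (P : R -> Prop) : (forall r, 0 <= r < 1 -> P r) ->
  \forall r \near (1 : R)^'-, P r.
Proof.
move=> h; near=> r; apply: h; apply/andP; split.
  by near: r; apply: nbhs_left_ge; exact: ltr01.
by near: r; exact: nbhs_left_lt.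
Unshelve. all: by end_near. Qed.

Lemma cvg_left1X k : (fun r : R => r ^+ k) @ (1 : R)^'- --> (1 : R).
Proof.
apply: cvg_at_left_filter; rewrite -[X in _ --> X](expr1n _ k).
exact: exprn_continuous.
Qed.

(** Bessel's inequality for the dilate of radius r bounds the finite sums of |a_k|^2 r^(2k) by M /
    (2 pi), uniformly in r; then r tends to 1 in each finite sum. *)
Lemma hardy_ell2 (F : R[i] -> R[i]) a : hardy_disk F ->
  (forall w, cmod w < 1 ->
    (fun n => \sum_(0 <= k < n) a k * w ^+ k) @ \oo --> (F w : R[i]^o)) -> ell2 a.
Proof.
move=> [_ [M hM]] aF; exists (M / (2 * pi)) => n.
have h : (fun r : R => \sum_(k < n) cmod (a k) ^+ 2 * (r ^+ k) ^+ 2) @ 1^'- -->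
    \sum_(k < n) cmod (a k) ^+ 2.
  apply: (@cvg_finsum R R _ _ _ _ _ _ (fun (k : 'I_n) r => cmod (a k) ^+ 2 * (r ^+ k) ^+ 2)).
  move=> k _; rewrite -[X in _ --> X]mulr1; apply: cvgM; first exact: cvg_cst.
  by under eq_fun do rewrite -exprM; exact: cvg_left1X.
apply: (rcvg_le h (cvg_cst _)); apply: near_left1 => r r01.
have hd := h2coef_dil aF r01; have /andP[r0 r1] := r01.
have := h2coef_sq_le n hd; rewrite /dil.
under eq_bigr do rewrite cmodM exprMn cmod_real ger0_norm ?exprn_ge0//.
move=> /le_trans; apply.
rewrite ler_pdivlMr ?twopi_gt0// mulrC norm2_sqr -lee_fin -mint_integral ?hM//.
by have /L2circleP[] := h2coef_L2 hd.
Qed.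

Lemma h2coef_dist_le a b f g (C : R) : h2coef a f -> h2coef b g ->
  (forall n, norm2 (tsum a n - tsum b n) <= C) -> norm2 (f - g) <= C.
Proof.
move=> haf hbg hC; have Lf := h2coef_L2 haf; have Lg := h2coef_L2 hbg.
have h : (fun n => norm2 (tsum a n - f) + C + norm2 (tsum b n - g)) @ \oo --> 0 + C + 0.
  apply: cvgD; last by case: hbg.
  by apply: cvgD; [case: haf|exact: cvg_cst].
rewrite add0r addr0 in h; apply: (rcvg_le (cvg_cst _) h); apply: nearW => n.
have La := L2_tsum a n; have Lb := L2_tsum b n.
rewrite (le_trans (_ : _ <= norm2 (f - tsum a n) + norm2 (tsum a n - g)))//.
  by rewrite !norm2E (nrm_triangle HI).
rewrite !norm2E (nrm_distC HI Lf La) -addrA lerD2l -!norm2E.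
rewrite (le_trans (_ : _ <= norm2 (tsum a n - tsum b n) + norm2 (tsum b n - g)))//.
  by rewrite !norm2E (nrm_triangle HI).
by rewrite lerD2r.
Qed.

Lemma sum_ord_split (F : nat -> R) m k : (m <= k)%N ->
  \sum_(i < k) F i = \sum_(i < m) F i + \sum_(i < k - m) F (m + i)%N.
Proof. by move=> mk; rewrite -[in LHS](subnKC mk) big_split_ord. Qed.

(** The finitely many coefficients below [N] converge as r tends to 1. Beyond [N], dilation only
    shrinks coefficients, so the tails of [f] and of all its dilates are small together. *)
Lemma h2coef_dil_cvg (F : R[i] -> R[i]) a f :
  (forall w, cmod w < 1 ->
    (fun n => \sum_(0 <= k < n) a k * w ^+ k) @ \oo --> (F w : R[i]^o)) ->
  h2coef a f ->
  (fun r : R => norm2 ((fun t => F (r%:C%C * expi t)) - f)) @ 1^'- --> (0 : R).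
Proof.
move=> aF haf; have Lf := h2coef_L2 haf; have [M hM] := ell2_h2coef haf.
apply/cvgrPdist_lt => e e0.
have e20 : 0 < (e / 4) ^+ 2 by rewrite exprn_gt0// divr_gt0.
have [N hN] := bounded_monotone_tail (@sq_sums_homo _ a) hM e20.
have h : (fun r : R => \sum_(k < N) cmod (a k) ^+ 2 * (r ^+ k - 1) ^+ 2) @ 1^'- -->
    \sum_(k < N) (0 : R).
  apply: (@cvg_finsum R R _ _ _ _ _ _ (fun (k : 'I_N) r => cmod (a k) ^+ 2 * (r ^+ k - 1) ^+ 2) (fun=> 0)).
  move=> k _; rewrite -[X in _ --> X](mulr0 (cmod (a k) ^+ 2)); apply: cvgM; first exact: cvg_cst.
  have hk : (fun r : R => r ^+ k - 1) @ 1^'- --> (0 : R).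
    by rewrite -[X in _ --> X](subrr 1); apply: cvgB; [exact: cvg_left1X|exact: cvg_cst].
  by rewrite -[X in _ --> X](mulr0 0); under eq_fun do rewrite expr2; exact: cvgM.
rewrite big1// in h; move/cvgrPdist_lt : h => /(_ _ e20) h.
suff : \forall r \near (1 : R)^'-, \sum_(k < N) cmod (a k) ^+ 2 * (r ^+ k - 1) ^+ 2 < (e / 4) ^+ 2 ->
    `|0 - norm2 ((fun t => F (r%:C%C * expi t)) - f)| < e.
  move=> h2; apply: filterS2 h h2 => r h1; apply.
  by move: h1; rewrite sub0r normrN; apply: le_lt_trans; exact: ler_norm.
apply: near_left1 => r r01 hr; rewrite sub0r normrN ger0_norm ?norm2_ge0//.
have hd := h2coef_dil aF r01; have /andP[r0 r1] := r01.
have e4 : 0 <= e / 4 by rewrite divr_ge0// ltW.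
apply: (@le_lt_trans _ _ (e / 4 + e / 4 + e / 4)); last by lra.
apply: (h2coef_dist_le hd haf) => n.
have st b m k : (m <= k)%N ->
   (forall j, cmod (b j) <= cmod (a j)) -> (N <= m)%N -> norm2 (tsum b k - tsum b m) <= e / 4.
  move=> mk ba Nm; rewrite -(@ler_pXn2r _ 2)// ?nnegrE ?norm2_ge0//.
  rewrite norm2_tsum_diff// -(subnKC mk) !big_split_ord /= addrAC subrr add0r.
  have := hN k (leq_trans Nm mk); have hm : \sum_(i < N) cmod (a i) ^+ 2 <= \sum_(i < m) cmod (a i) ^+ 2.
    exact: sq_sums_homo.
  rewrite (sum_ord_split (fun i => cmod (a i) ^+ 2) mk) => h1.
  apply: (@le_trans _ _ (\sum_(i < k - m) cmod (a (m + i)%N) ^+ 2)); last by lra.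
  by apply: ler_sum => i _; rewrite ler_pXn2r// ?nnegrE ?cmod_ge0.
have dila j : cmod (dil r a j) <= cmod (a j).
  rewrite cmodM cmod_real ger0_norm ?exprn_ge0// ler_piMr ?cmod_ge0//.
  by rewrite exprn_ile1// ltW.
have mid m : (m <= N)%N -> norm2 (tsum (dil r a) m - tsum a m) <= e / 4.
  move=> mN; rewrite -(@ler_pXn2r _ 2)// ?nnegrE ?norm2_ge0//.
  rewrite tsumB norm2_tsum; apply: le_trans (ltW hr).
  rewrite (sum_ord_split (fun k => cmod (a k) ^+ 2 * (r ^+ k - 1) ^+ 2) mN).
  rewrite (eq_bigr (fun k : 'I_m => cmod (a k) ^+ 2 * (r ^+ k - 1) ^+ 2)).
    by rewrite lerDl sumr_ge0// => i _; rewrite mulr_ge0 ?sqr_ge0.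
  move=> k _; rewrite /dil -{2}(mulr1 (a k)) -mulrBr cmodM exprMn.
  have -> : (r ^+ k)%:C%C - 1 = (r ^+ k - 1)%:C%C :> R[i] by rewrite rmorphB.
  by rewrite cmod_real real_normK ?num_real.
have [nN|Nn] := leqP n N.
  by rewrite (le_trans (mid _ nN))//; lra.
have Ld k := L2_tsum (dil r a) k; have La k := L2_tsum a k.
have Nn' := ltnW Nn.
rewrite (le_trans (_ : _ <= norm2 (tsum (dil r a) n - tsum (dil r a) N) +
  norm2 (tsum (dil r a) N - tsum a n)))//; first by rewrite !norm2E (nrm_triangle HI).
rewrite -addrA; apply: lerD; first exact: (st (dil r a) N n Nn' dila (leqnn N)).
rewrite (le_trans (_ : _ <= norm2 (tsum (dil r a) N - tsum a N) +
  norm2 (tsum a N - tsum a n)))//; first by rewrite !norm2E (nrm_triangle HI).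
apply: lerD; first exact: (mid N (leqnn N)).
rewrite norm2E (nrm_distC HI (La N) (La n)) -norm2E.
by apply: (st a N n Nn' _ (leqnn N)) => j; exact: lexx.
Qed.

Lemma boundary_valuesP (F : R[i] -> R[i]) f : L2circle f ->
  (forall r, 0 <= r < 1 -> L2circle (fun t => F (r%:C%C * expi t))) ->
  boundary_values F f <->
  (fun r : R => norm2 ((fun t => F (r%:C%C * expi t)) - f)) @ 1^'- --> (0 : R).
Proof.
move=> Lf LF.
have E r : 0 <= r < 1 -> (\int[mu]_(t in A) ((cmod (F (r%:C%C * expi t) - f t)) ^+ 2)%:E
    = (2 * pi * norm2 ((fun t => F (r%:C%C * expi t)) - f) ^+ 2)%:E)%E.
  move=> r01; rewrite norm2_sqr -mint_integral//.
  by have /L2circleP[] := L2_sub (LF _ r01) Lf.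
split=> [[_ h]|h].
  have h1 : (fun r : R => (2 * pi * norm2 ((fun t => F (r%:C%C * expi t)) - f) ^+ 2)%:E)
      @ 1^'- --> 0%E.
    by apply: cvg_trans h; apply: near_eq_cvg; apply: near_left1 => r r01; rewrite E.
  move/fine_cvgP : h1 => [_ h1].
  have h2 : (fun r : R => Num.sqrt ((2 * pi)^-1 *
     (2 * pi * norm2 ((fun t => F (r%:C%C * expi t)) - f) ^+ 2))) @ 1^'- --> (0 : R).
    rewrite -[X in _ --> X]sqrtr0; apply: cvg_sqrt.
    by rewrite -[X in _ --> X](mulr0 (2 * pi)^-1); apply: cvgM => //; exact: cvg_cst.
  apply: cvg_trans h2; apply: near_eq_cvg; apply: nearW => r.
  by rewrite mulKf ?gt_eqF ?twopi_gt0// sqrtr_sqr ger0_norm ?norm2_ge0.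
split=> //.
have h1 : (fun r : R => (2 * pi * norm2 ((fun t => F (r%:C%C * expi t)) - f) ^+ 2)%:E)
      @ 1^'- --> 0%E.
  apply: cvg_EFin; first exact: nearW.
  rewrite [X in _ --> X](_ : 0 = 2 * pi * (0 * 0)); last by rewrite !mulr0.
  apply: cvgM; first exact: cvg_cst.
  by under eq_fun do rewrite expr2; exact: cvgM.
by apply: cvg_trans h1; apply: near_eq_cvg; apply: near_left1 => r r01; rewrite E.
Qed.

End Hardy.

(** * Hardy functions and multiplication by inner functions *)

Section HardyProducts.
Variable R : realType.
Local Notation mu := (@lebesgue_measure R).
Local Notation A := (@angles R : set (measurableTypeR R)).
Local Notation HI := (L2_semi_ip R).
Implicit Types (a b : nat -> R[i]) (f g : R -> R[i]) (w : R[i]) (F G u : R[i] -> R[i]).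

Definition taylor a F := forall w, cmod w < 1 ->
  (fun n => \sum_(0 <= k < n) a k * w ^+ k) @ \oo --> (F w : R[i]^o).

Lemma cmod_dil_lt1 (r t : R) : 0 <= r < 1 -> cmod (r%:C%C * expi t) < 1.
Proof.
by move=> /andP[r0 r1]; rewrite cmodM cmod_expi mulr1 cmod_real ger0_norm.
Qed.

(** The dilates of [F] converge in L^2 both to [f] and to the Riesz-Fischer sum of the Taylor
    series, so the two agree up to a null function. *)
Lemma hardy_boundary F f : hardy_disk F -> boundary_values F f ->
  exists a, taylor a F /\ h2coef a f.
Proof.
move=> hF bF; have [a aF] := hF.1; exists a; split=> //.
have ea := hardy_ell2 hF aF; have [f' haf'] := h2coef_exists ea.
have [Lf _] := bF; have Lf' := h2coef_L2 haf'.
have LF r : 0 <= r < 1 -> L2circle (fun t => F (r%:C%C * expi t)).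
  by move=> /(h2coef_dil aF)/h2coef_L2.
have h1 := h2coef_dil_cvg aF haf'.
have /(boundary_valuesP Lf LF) h2 := bF.
apply: (h2coef_null_eq haf' Lf).
have h : (fun r : R => norm2 ((fun t => F (r%:C%C * expi t)) - f') +
   norm2 ((fun t => F (r%:C%C * expi t)) - f)) @ 1^'- --> 0.
  by rewrite -[X in _ --> X](addr0 0); exact: cvgD.
apply/eqP; rewrite eq_le norm2_ge0 andbT.
apply: (rcvg_le (cvg_cst _) h); apply: near_left1 => r /LF Lr.
by rewrite !norm2E (nrm_distC HI Lr Lf') (nrm_triangle HI).
Qed.

Lemma norm2_h2coef_le a b f g : h2coef a f -> h2coef b g ->
  (forall k, cmod (b k) <= cmod (a k)) -> norm2 g <= norm2 f.
Proof.
move=> [Lf af] [Lg bg] ba.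
have lim (c : nat -> R[i]) (h : R -> R[i]) : L2circle h -> (fun n => norm2 (tsum c n - h)) @ \oo --> 0 ->
    (fun n => norm2 (tsum c n)) @ \oo --> norm2 h.
  move=> Lh ch; under eq_fun do rewrite norm2E; rewrite norm2E.
  apply: (cvg_nrm HI) => // [n|]; first exact: L2_tsum.
  by under eq_fun do rewrite -norm2E.
apply: (rcvg_le (lim _ _ Lg bg) (lim _ _ Lf af)); apply: nearW => n.
rewrite -(@ler_pXn2r _ 2)// ?nnegrE ?norm2_ge0// !norm2_tsum.
by apply: ler_sum => k _; rewrite ler_pXn2r// ?nnegrE ?cmod_ge0.
Qed.

Lemma h2coef_hardy a f F : taylor a F -> h2coef a f ->
  hardy_disk F /\ boundary_values F f.
Proof.
move=> aF haf; have Lf := h2coef_L2 haf.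
have LF r : 0 <= r < 1 -> L2circle (fun t => F (r%:C%C * expi t)).
  by move=> /(h2coef_dil aF)/h2coef_L2.
split; last by apply/(boundary_valuesP Lf LF); exact: h2coef_dil_cvg aF haf.
split; first by exists a.
exists (2 * pi * norm2 f ^+ 2) => r r01; have /andP[r0 r1] := r01.
have /L2circleP[_ iF] := LF _ r01.
rewrite mint_integral// lee_fin ler_pM2l ?twopi_gt0// -norm2_sqr.
rewrite ler_pXn2r// ?nnegrE ?norm2_ge0//.
apply: (norm2_h2coef_le haf (h2coef_dil aF r01)) => k.
rewrite cmodM cmod_real ger0_norm ?exprn_ge0// ler_piMr ?cmod_ge0//.
by rewrite exprn_ile1// ltW.
Qed.

Lemma H2P f : H2 f <-> exists a, h2coef a f.
Proof.
split=> [[F hF bF]|[a haf]].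
  by have [a [_ haf]] := hardy_boundary hF bF; exists a.
have [hF bF] := h2coef_hardy (fun w => ext_series haf) haf.
by exists (ext f).
Qed.

Lemma H2_ext f : H2 f -> hardy_disk (ext f) /\ boundary_values (ext f) f.
Proof. by move=> /H2P[a haf]; exact: h2coef_hardy (fun w => ext_series haf) haf. Qed.

Lemma H2_L2 f : H2 f -> L2circle f.
Proof. by move=> /H2P[a /h2coef_L2]. Qed.

Lemma ext_unique F f w : hardy_disk F -> boundary_values F f -> cmod w < 1 ->
  F w = ext f w.
Proof.
move=> hF bF w1; have [a [aF haf]] := hardy_boundary hF bF.
exact: (ccvg_unique (aF _ w1) (ext_series haf w1)).
Qed.

Lemma taylor_bound a F (s : R) : taylor a F -> 0 <= s < 1 ->
  exists C, 0 <= C /\ forall k, cmod (a k) * s ^+ k <= C.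
Proof.
move=> aF s01; have [M hM] := ell2_h2coef (h2coef_dil aF s01).
have /andP[s0 s1] := s01.
have M0 : 0 <= M by have := hM 0%N; rewrite big_ord0.
exists (Num.sqrt M); split=> [|k]; first exact: sqrtr_ge0.
rewrite -(@ler_pXn2r _ 2)// ?nnegrE ?sqrtr_ge0 ?mulr_ge0 ?cmod_ge0 ?exprn_ge0//.
rewrite sqr_sqrtr//; apply: le_trans (hM k.+1); rewrite big_ord_recr /= /dil.
rewrite cmodM cmod_real ger0_norm ?exprn_ge0// lerDr sumr_ge0// => i _.
exact: sqr_ge0.
Qed.

Lemma triangle_sum (V : zmodType) (F : nat -> nat -> V) n :
  \sum_(0 <= k < n) \sum_(0 <= i < k.+1) F i (k - i)%N =
  \sum_(0 <= i < n) \sum_(0 <= j < n - i) F i j.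
Proof.
elim: n => [|n IH]; first by rewrite !big_geq.
rewrite big_nat_recr//= IH; apply/esym.
rewrite (eq_big_nat _ _ (F2 := fun i =>
    \sum_(0 <= j < n - i) F i j + F i (n - i)%N)); last first.
  by move=> i /andP[_ iln]; rewrite subSn// big_nat_recr.
by rewrite big_split /= [X in X + _]big_nat_recr//= subnn [X in _ + X + _]big_geq// addr0.
Qed.

(** The product of partial sums differs from the partial sum of the Cauchy product by terms with i +
    j >= n. With s midway between |w| and 1 and y^2 = |w| / s, such a term is at most C D y^(i+j)
    y^(i+j): one factor is at most y^n, which gives smallness, and the other makes the double sum
    converge. *)
Lemma taylorM a b F G : taylor a F -> taylor b G ->
  taylor (fun k => \sum_(0 <= i < k.+1) a i * b (k - i)%N) (fun w => F w * G w).
Proof.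
move=> aF bG w w1.
pose s := (cmod w + 1) / 2.
have w0 := cmod_ge0 w.
have s01 : 0 <= s < 1 by apply/andP; split; rewrite /s; lra.
have /andP[s0 s1] := s01.
have sp : 0 < s by rewrite /s; lra.
have [C [C0 hC]] := taylor_bound aF s01; have [D [D0 hD]] := taylor_bound bG s01.
pose y := Num.sqrt (cmod w / s).
have x0 : 0 <= cmod w / s by rewrite divr_ge0.
have x1 : cmod w / s < 1 by rewrite ltr_pdivrMr// mul1r /s; lra.
have y0 : 0 <= y := sqrtr_ge0 _.
have yy : y ^+ 2 = cmod w / s by rewrite sqr_sqrtr.
have y1 : y < 1 by rewrite -(@ltr_pXn2r _ 2)// ?nnegrE// expr1n yy.
have d0 : 0 < 1 - y by rewrite subr_gt0.
pose P n := \sum_(0 <= k < n) a k * w ^+ k; pose Q n := \sum_(0 <= k < n) b k * w ^+ k.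
have hPQ : (fun n => P n * Q n) @ \oo --> (F w * G w : R[i]^o).
  by apply: ccvgM; [exact: aF|exact: bG].
pose T n := \sum_(0 <= k < n) (\sum_(0 <= i < k.+1) a i * b (k - i)%N) * w ^+ k.
pose H i j := a i * b j * w ^+ (i + j).
have TE n : T n = \sum_(0 <= i < n) \sum_(0 <= j < n - i) H i j.
  rewrite -triangle_sum; apply: eq_bigr => k _.
  rewrite big_distrl /=; apply: eq_big_nat => i /andP[_ ik].
  by rewrite /H subnKC.
have PQE n : P n * Q n = \sum_(0 <= i < n) \sum_(0 <= j < n) H i j.
  rewrite /P /Q big_distrl /=; apply: eq_bigr => i _.
  rewrite big_distrr /=; apply: eq_bigr => j _.
  by rewrite /H exprD; ring.
have bnd n : cmod (P n * Q n - T n) <= C * D / (1 - y) ^+ 2 * y ^+ n.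
  rewrite PQE TE -sumrB.
  apply: (le_trans (cmod_sum _ _ _)).
  apply: (@le_trans _ _ (\sum_(0 <= i < n) (C * D * y ^+ n / (1 - y)) * y ^+ i)).
    rewrite !big_mkord; apply: ler_sum => i _.
    rewrite (big_cat_nat (leq0n (n - i)%N) (leq_subr i n)) /= addrAC subrr add0r.
    apply: (le_trans (cmod_sum _ _ _)).
    apply: (@le_trans _ _ (\sum_(n - i <= j < n) (C * D * y ^+ n * y ^+ i) * y ^+ j)).
      rewrite big_nat_cond [X in _ <= X]big_nat_cond; apply: ler_sum => j /andP[/andP[jn _] _].
      rewrite /H !cmodM cmodX.
      have -> : cmod w ^+ (i + j) = s ^+ i * s ^+ j * (y ^+ (i + j) * y ^+ (i + j)).
        rewrite -exprD -exprMn -expr2 yy -exprMn; congr (_ ^+ _).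
        by rewrite mulrC divfK ?gt_eqF.
      have nij : (n <= i + j)%N by rewrite -leq_subLR.
      have h1 : y ^+ (i + j) <= y ^+ n by rewrite ler_wiXn2l// ltW.
      have := hC i; have := hD j => hDj hCi.
      have q1 : 0 <= cmod (a i) * s ^+ i by rewrite mulr_ge0 ?cmod_ge0 ?exprn_ge0.
      have q2 : 0 <= cmod (b j) * s ^+ j by rewrite mulr_ge0 ?cmod_ge0 ?exprn_ge0.
      have -> : cmod (a i) * cmod (b j) * (s ^+ i * s ^+ j * (y ^+ (i + j) * y ^+ (i + j))) =
         ((cmod (a i) * s ^+ i) * (cmod (b j) * s ^+ j)) * (y ^+ (i + j) * y ^+ (i + j)) by ring.
      have -> : C * D * y ^+ n * y ^+ i * y ^+ j = (C * D) * (y ^+ n * y ^+ (i + j)).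
        by rewrite exprD; ring.
      apply: ler_pM; [exact: mulr_ge0|by rewrite mulr_ge0 ?exprn_ge0|exact: ler_pM|].
      by rewrite ler_wpM2r// exprn_ge0.
    rewrite -mulr_sumr [X in _ <= X](_ : _ = C * D * y ^+ n * y ^+ i * (1 - y)^-1); last first.
      by rewrite mulrAC.
    rewrite ler_wpM2l ?mulr_ge0 ?exprn_ge0//.
    apply: (le_trans (geo_sum_le _ _ _)); first by rewrite y0.
    by rewrite ler_pdivrMr// mulVf ?gt_eqF// exprn_ile1// ltW.
  rewrite -mulr_sumr.
  have -> : C * D / (1 - y) ^+ 2 * y ^+ n = C * D * y ^+ n / (1 - y) * (y ^+ 0 / (1 - y)).
    by field; rewrite gt_eqF.
  rewrite ler_wpM2l//; first by rewrite !mulr_ge0 ?exprn_ge0// invr_ge0 ltW.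
  by apply: geo_sum_le; rewrite y0.
have geo : (fun n => C * D / (1 - y) ^+ 2 * y ^+ n) @ \oo --> 0.
  rewrite -[X in _ --> X](mulr0 (C * D / (1 - y) ^+ 2)); apply: cvgM; first exact: cvg_cst.
  by apply: cvg_geo0; rewrite y0.
have diff : (fun n => P n * Q n - T n) @ \oo --> (0 : R[i]^o).
  apply/ccvgP; apply: (squeeze_cvgr _ (cvg_cst 0) geo); apply: nearW => n.
  by rewrite cmod_ge0/= subr0.
have hT := ccvgB hPQ diff; rewrite subr0 in hT.
have TT : (fun n => P n * Q n - (P n * Q n - T n)) = T.
  by apply/funext => n; rewrite opprB addrC subrK.
by rewrite TT in hT; exact: hT.
Qed.

(** [v] represents the boundary function and is unimodular at every angle rather than almost
    everywhere; [inner_functionP] obtains it by putting the value 1 on the exceptional set. *)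
Record is_inner u (v : R -> R[i]) : Prop := IsInner {
  inner_analytic : analytic_disk u;
  inner_le1 : forall w, cmod w < 1 -> cmod (u w) <= 1;
  inner_bv : boundary_values u v;
  inner_meas : cmeas v;
  inner_unimod : forall t, cmod (v t) = 1 }.

Lemma inner_functionP u : inner_function u -> exists v, is_inner u v.
Proof.
move=> [au u1 [ub [Lub bu] h1]].
have {}h1 : {ae mu, forall t, A t -> cmod (ub t) = 1} := h1.
have /L2circleP[mub _] := Lub.
pose p (t : R) := cmod (ub t) == 1.
pose v t := if p t then ub t else 1.
have mp : measurable_fun A p.
  by apply: measurable_fun_eqr; [exact: cmeas_cmod|exact: measurable_cst].
have mv : cmeas v by apply: cmeas_if => //; exact: cmeas_cst.
have v1 t : cmod (v t) = 1 by rewrite /v /p; case: eqP => // _; exact: cmod1.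
exists v; split=> //; split; first by apply: (L2_bounded (M := 1)) => // t _; rewrite v1.
apply: cvg_trans bu; apply: near_eq_cvg; apply: near_left1 => r r01.
have [a ta] := au; have /h2coef_L2/L2circleP[mr _] := h2coef_dil ta r01.
apply: ae_eq_integral => //.
- by apply/measurable_EFinP; apply: cmeas_cmod2; exact: cmeasB.
- by apply/measurable_EFinP; apply: cmeas_cmod2; exact: cmeasB.
by apply: filterS h1 => t ht At; rewrite /v /p ht ?eqxx.
Qed.

Lemma L2_mul_unimod v f : cmeas v -> (forall t, cmod (v t) = 1) -> L2circle f ->
  L2circle (fun t => v t * f t).
Proof. by move=> mv v1 Lf; apply: (L2_mulb (M := 1)) => // t _; rewrite v1. Qed.

Lemma inner_mul_unimod v f g : (forall t, cmod (v t) = 1) ->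
  inner_prod (fun t => v t * f t) (fun t => v t * g t) = inner_prod f g.
Proof.
move=> v1.
have E t : v t * f t * conjc (v t * g t) = f t * conjc (g t).
  rewrite rmorphM /= (mulrC (v t)) -mulrA (mulrA (v t)) mul_conjc v1 expr1n.
  by rewrite mul1r.
by rewrite !inner_prodE; apply: complexP => /=; apply: mean_eq => t _; rewrite E.
Qed.

Lemma inner_conj_mul v f g :
  inner_prod (fun t => v t * f t) g = inner_prod f (fun t => conjc (v t) * g t).
Proof.
have E t : v t * f t * conjc (g t) = f t * conjc (conjc (v t) * g t).
  by rewrite rmorphM /= conjcK; ring.
by rewrite !inner_prodE; apply: complexP => /=; apply: mean_eq => t _; rewrite E.
Qed.

Lemma inner_mul_hardy u v F f : is_inner u v -> hardy_disk F -> boundary_values F f ->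
  hardy_disk (fun w => u w * F w) /\
  boundary_values (fun w => u w * F w) (fun t => v t * f t).
Proof.
move=> [au u1 bu mv v1] hF bF.
have [a [aF haf]] := hardy_boundary hF bF; have Lf := h2coef_L2 haf.
have [b bu'] := au.
have Lu r : 0 <= r < 1 -> L2circle (fun t => u (r%:C%C * expi t)).
  by move=> /(h2coef_dil bu')/h2coef_L2.
have LF r : 0 <= r < 1 -> L2circle (fun t => F (r%:C%C * expi t)).
  by move=> /(h2coef_dil aF)/h2coef_L2.
have tuF := taylorM bu' aF.
have LuF r : 0 <= r < 1 -> L2circle (fun t => u (r%:C%C * expi t) * F (r%:C%C * expi t)).
  by move=> /(h2coef_dil tuF)/h2coef_L2.
split.
  split; first by eexists; exact: tuF.
  have [_ [M hM]] := hF; exists M => r r01; apply: le_trans (hM r r01).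
  have /L2circleP[_ i1] := LF _ r01; have /L2circleP[_ i2] := LuF _ r01.
  rewrite !mint_integral// lee_fin ler_pM2l ?twopi_gt0// mean_le// => t _.
  rewrite ler_pXn2r// ?nnegrE ?cmod_ge0// cmodM ler_piMl ?cmod_ge0// u1//.
  exact: cmod_dil_lt1.
have Lv : L2circle v by apply: (L2_bounded (M := 1)) => // t _; rewrite v1.
have Lvf : L2circle (fun t => v t * f t) by exact: L2_mul_unimod.
apply/(boundary_valuesP Lvf LuF).
have /(boundary_valuesP Lv Lu) cu := bu.
have /(boundary_valuesP Lf LF) cF := bF.
have [_ ca] := haf.
apply/cvgrPdist_lt => e e0.
have e4 : 0 < e / 8 by rewrite divr_gt0.
move/cvgrPdist_lt : ca => /(_ _ e4)[N _ /(_ N (leqnn N))].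
rewrite /= sub0r normrN ger0_norm ?norm2_ge0// => hN.
pose p := tsum a N; have Lp : L2circle p by exact: L2_tsum.
pose C := \sum_(k < N) cmod (a k).
have C0 : 0 <= C by rewrite sumr_ge0// => k _; exact: cmod_ge0.
have pC t : cmod (p t) <= C.
  apply: (le_trans (cmod_sum _ _ _)); apply: ler_sum => k _.
  by rewrite cmodM cmodX cmod_expi expr1n mulr1.
have cu' : (fun r : R => C * norm2 ((fun t => u (r%:C%C * expi t)) - v)) @ 1^'- --> 0.
  by rewrite -[X in _ --> X](mulr0 C); apply: cvgM => //; exact: cvg_cst.
move/cvgrPdist_lt : cu' => /(_ _ e4) hu; move/cvgrPdist_lt : cF => /(_ _ e4) hF4.
suff : \forall r \near (1 : R)^'-,
    `|0 - C * norm2 ((fun t => u (r%:C%C * expi t)) - v)| < e / 8 ->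
    `|0 - norm2 ((fun t => F (r%:C%C * expi t)) - f)| < e / 8 ->
    `|0 - norm2 ((fun t => u (r%:C%C * expi t) * F (r%:C%C * expi t)) -
        (fun t => v t * f t))| < e.
  by move=> h; near=> r; apply: (near h r) => //; near: r.
apply: near_left1 => r r01; rewrite !sub0r !normrN !ger0_norm ?norm2_ge0 ?mulr_ge0 ?norm2_ge0//.
move=> h1 h2.
have Lur := Lu _ r01; have LFr := LF _ r01.
have mur : cmeas (fun t => u (r%:C%C * expi t)) by have /L2circleP[] := Lur.
have ub t : cmod (u (r%:C%C * expi t)) <= 1 by apply: u1; exact: cmod_dil_lt1.
have Lfp := L2_sub Lf Lp.
have muv : cmeas (fun t => u (r%:C%C * expi t) - v t) by exact: cmeasB.
have uv2 t : cmod (u (r%:C%C * expi t) - v t) <= 2.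
  by rewrite (le_trans (cmodB _ _))// v1; have := ub t; lra.
pose g1 : R -> R[i] := fun t => u (r%:C%C * expi t) * (F (r%:C%C * expi t) - f t).
pose g2 : R -> R[i] := fun t => (u (r%:C%C * expi t) - v t) * (f t - p t).
pose g3 : R -> R[i] := fun t => p t * (u (r%:C%C * expi t) - v t).
have Lg1 : L2circle g1.
  by apply: (L2_mulb (M := 1)) => //; exact: L2_sub.
have Lg2 : L2circle g2 by apply: (L2_mulb (M := 2)) => //.
have mp : cmeas p by exact: cmeas_tsum.
have Lg3 : L2circle g3 by apply: (L2_mulb (M := C)) => //; exact: L2_sub.
rewrite (_ : _ - _ = g1 + (g2 + g3)); last first.
  by apply/funext => t; rewrite !fctE /g1 /g2 /g3; ring.
have Lg23 : L2circle (g2 + g3) by exact: L2_add.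
rewrite norm2E (le_lt_trans (nrmD HI Lg1 Lg23))//.
apply: (@le_lt_trans _ _ (norm2 g1 + (norm2 g2 + norm2 g3))).
  by rewrite !norm2E lerD2l (nrmD HI).
have n1 : norm2 g1 <= 1 * norm2 ((fun t => F (r%:C%C * expi t)) - f).
  by apply: norm2_mulb => //; exact: L2_sub.
have n2 : norm2 g2 <= 2 * norm2 (f - p) by apply: norm2_mulb.
have n3 : norm2 g3 <= C * norm2 ((fun t => u (r%:C%C * expi t)) - v).
  by apply: norm2_mulb => //; exact: L2_sub.
have n4 : norm2 (f - p) < e / 8 by rewrite norm2E (nrm_distC HI Lf Lp) -norm2E.
lra.
Unshelve. all: by end_near. Qed.

Lemma inner_mul_H2 u v f : is_inner u v -> H2 f -> H2 (fun t => v t * f t) /\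
  forall w, cmod w < 1 -> ext (fun t => v t * f t) w = u w * ext f w.
Proof.
move=> uv /H2_ext[hF bF]; have [h1 h2] := inner_mul_hardy uv hF bF.
split; first by exists (fun w => u w * ext f w).
by move=> w w1; rewrite -(ext_unique h1 h2).
Qed.

End HardyProducts.

(** * Model spaces and truncated Toeplitz operators *)

Section ModelSpace.
Variable R : realType.
Local Notation HI := (L2_semi_ip R).
Implicit Types (a b : nat -> R[i]) (f g h : R -> R[i]) (w : R[i]) (F G u : R[i] -> R[i]).

Lemma ultra_cvg_bounded (T : Type) (U : set_system T) (x : T -> R) (M : R) :
  UltraFilter U -> (forall n, `|x n| <= M) -> exists l : R, x @ U --> l.
Proof.
move=> UU xM.
have c : compact `[- M, M]%classic by exact: segment_compact.
have [l [_ cl]] : (`[- M, M]%classic `&` cluster (x @ U)) !=set0.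
  apply: c; apply: (@filterS _ U _ setT) => [n _|]; last exact: filterT.
  by rewrite /= in_itv/= -ler_norml xM.
exists l => B Bl; rewrite /fmap /=.
have [//|nB] := in_ultra_setVsetC (x @^-1` B) UU.
by have [y [/= nBy By]] := cl (~` B) B nB Bl.
Qed.

Lemma ultra_ccvg_bounded (T : Type) (U : set_system T) (x : T -> R[i]) (M : R) :
  UltraFilter U -> (forall n, cmod (x n) <= M) -> exists l, x @ U --> (l : R[i]^o).
Proof.
move=> UU xM.
have [r hr] : exists l : R, (fun n => complex.Re (x n)) @ U --> l.
  by apply: (ultra_cvg_bounded (M := M)) => n; exact: le_trans (Re_le_cmod _) _.
have [i hi] : exists l : R, (fun n => complex.Im (x n)) @ U --> l.
  by apply: (ultra_cvg_bounded (M := M)) => n; exact: le_trans (Im_le_cmod _) _.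
by exists (Complex r i); apply: ccvg_ReIm.
Qed.

Lemma tsumD a b n : tsum a n + tsum b n = tsum (fun k => a k + b k) n.
Proof.
apply/funext => t; rewrite /tsum/= fctE -big_split.
by apply: eq_bigr => k _; rewrite mulrDl.
Qed.

Lemma tsumZ (c : R[i]) a n : (fun t => c * tsum a n t) = tsum (fun k => c * a k) n.
Proof.
by apply/funext => t; rewrite /tsum/= mulr_sumr; apply: eq_bigr => k _; rewrite mulrA.
Qed.

Lemma h2coefD a b f g : h2coef a f -> h2coef b g -> h2coef (fun k => a k + b k) (f + g).
Proof.
move=> [Lf af] [Lg bg]; split; first exact: L2_add.
have hs : (fun n => norm2 (tsum a n - f) + norm2 (tsum b n - g)) @ \oo --> 0.
  by rewrite -[X in _ --> X](addr0 0); exact: cvgD.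
apply: (squeeze_cvgr _ (cvg_cst (0 : R)) hs); apply: nearW => n; rewrite norm2_ge0/=.
rewrite -tsumD opprD addrACA !norm2E (nrmD HI)//.
  by apply: L2_sub => //; exact: L2_tsum.
by apply: L2_sub => //; exact: L2_tsum.
Qed.

Lemma h2coefZ (c : R[i]) a f : h2coef a f -> h2coef (fun k => c * a k) (fun t => c * f t).
Proof.
move=> [Lf af]; split; first exact: L2_scale.
have hs : (fun n => cmod c * norm2 (tsum a n - f)) @ \oo --> 0.
  by rewrite -[X in _ --> X](mulr0 (cmod c)); apply: cvgM => //; exact: cvg_cst.
apply: (squeeze_cvgr _ (cvg_cst (0 : R)) hs); apply: nearW => n; rewrite norm2_ge0/=.
rewrite -tsumZ (_ : _ - _ = (fun t => c * (tsum a n - f) t)); last first.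
  by apply/funext => t; rewrite /= fctE mulrBr.
apply: (@norm2_mulb R (fun=> c) _ (cmod c) (cmod_ge0 c) (cmeas_cst c) (fun _ _ => lexx _)).
by apply: L2_sub => //; exact: L2_tsum.
Qed.

Lemma H2_subspace : @subspace_of R (R -> R[i]^o) (@L2circle R) (@H2 R).
Proof.
split.
- exact: H2_L2.
- apply/H2P; exists (fun=> 0); split; first exact: L2_zero.
  apply/cvgrPdist_lt => e e0; apply: nearW => n.
  rewrite (_ : tsum _ n - 0 = 0); last first.
    by apply/funext => t; rewrite fctE subr0 /tsum big1// => k _; rewrite mul0r.
  by rewrite norm2E (nrm0 HI) subr0 normr0.
- move=> f g /H2P[a af] /H2P[b bg]; apply/H2P; eexists; exact: h2coefD af bg.
- move=> c f /H2P[a af]; apply/H2P; exists (fun k => c * a k).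
  exact: (h2coefZ c af).
Qed.

Lemma cmod_inner_le f g : L2circle f -> L2circle g ->
  cmod (inner_prod f g) <= norm2 f * norm2 g.
Proof. by move=> Lf Lg; rewrite !norm2E (ip_CS HI). Qed.

(** The limits along [U] of the Fourier coefficients are square summable by Bessel's inequality, so
    Riesz-Fischer supplies [l]. Convergence against trigonometric polynomials is then immediate, and
    the norm bound extends it to all of [H2]. *)
Lemma H2_weakly_compact (f : nat -> R -> R[i]) (U : set_system nat) (M : R) :
  UltraFilter U -> (forall n, H2 (f n)) -> (forall n, norm2 (f n) <= M) ->
  exists l, H2 l /\ forall g, H2 g ->
    (fun n => inner_prod (f n) g) @ U --> (inner_prod l g : R[i]^o).
Proof.
move=> UU Hf fM.
have Lf n := H2_L2 (Hf n).
have M0 : 0 <= M := le_trans (norm2_ge0 _) (fM 0%N).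
have nz k : norm2 (zpow k) = 1 :> R.
  rewrite norm2_mean (@mean_eq _ _ (fun=> 1)) ?mean_cst ?sqrtr1// => t _.
  by rewrite cmod_zpow expr1n.
have /choice[a aP] : forall k, exists l, (fun n => inner_prod (f n) (zpow k)) @ U --> (l : R[i]^o).
  move=> k; apply: (ultra_ccvg_bounded (M := M)) => n.
  by rewrite (le_trans (cmod_inner_le (Lf n) (L2_zpow _ k)))// nz mulr1.
have ea : ell2 a.
  exists (M ^+ 2) => n.
  have hl : (fun m => \sum_(k < n) cmod (inner_prod (f m) (zpow k)) ^+ 2) @ U -->
      \sum_(k < n) cmod (a k) ^+ 2.
    apply: (@cvg_finsum R R _ _ _ _ _ _ (fun (k : 'I_n) m => cmod (inner_prod (f m) (zpow k)) ^+ 2)).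
    move=> k _; rewrite expr2; under eq_fun do rewrite expr2.
    by apply: cvgM; apply: ccvg_cmod; exact: aP.
  apply: (rcvg_le hl (cvg_cst _)); apply: nearW => m.
  have := bessel HI (fun k _ => L2_zpow R k) (@ortho_zpow R) n (Lf m).
  move=> /le_trans; apply; rewrite -norm2E ler_pXn2r// ?nnegrE ?norm2_ge0//.
have [l hl] := h2coef_exists ea.
have Ll := h2coef_L2 hl.
exists l; split; first by apply/H2P; exists a.
move=> g /H2P[b [Lg bg]].
have hk N : (fun n => inner_prod (f n) (tsum b N)) @ U --> (inner_prod l (tsum b N) : R[i]^o).
  have E h : L2circle h -> inner_prod h (tsum b N) = \sum_(k < N) inner_prod h (zpow k) * conjc (b k).
    move=> Lh; rewrite (ipC HI (L2_tsum b N) Lh) inner_tsum_sum// rmorph_sum /=.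
    apply: eq_bigr => k _; rewrite rmorphM /= mulrC; congr (_ * _).
    by rewrite (ipC HI (L2_zpow R k) Lh).
  rewrite E//; under eq_fun do rewrite E//.
  apply: (@cvg_finsum R[i] R[i]^o _ _ _ _ _ _ (fun (k : 'I_N) m => inner_prod (f m) (zpow k) * conjc (b k))).
  move=> k _; apply: ccvgM; last exact: ccvg_cst.
  by rewrite (inner_h2coef_zpow k hl); exact: aP.
apply/ccvg_ltP => e e0.
have c0 : 0 < M + norm2 l + 1 by rewrite ltr_wpDl// addr_ge0// norm2_ge0.
have e1 : 0 < e / 2 / (M + norm2 l + 1) by rewrite !divr_gt0.
move/cvgrPdist_lt : bg => /(_ _ e1)[N _ /(_ N (leqnn N))].
rewrite /= sub0r normrN ger0_norm ?norm2_ge0// => hN.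
have Lb := L2_tsum b N.
have e2 : 0 < e / 2 by rewrite divr_gt0.
have Lgb : L2circle (g - tsum b N) by exact: L2_sub.
suff key n : cmod (inner_prod (f n) (tsum b N) - inner_prod l (tsum b N)) < e / 2 ->
    cmod (inner_prod (f n) g - inner_prod l g) < e.
  by move/ccvg_ltP : (hk N) => /(_ _ e2); apply: filterS; exact: key.
move=> h1.
have -> : inner_prod (f n) g - inner_prod l g =
   inner_prod (f n) (tsum b N) - inner_prod l (tsum b N) +
   (inner_prod (f n) (g - tsum b N) - inner_prod l (g - tsum b N)).
  by rewrite !(ipBr HI)//; ring.
rewrite (le_lt_trans (cmodD _ _))// [e]splitr ltr_leD//.
rewrite (le_trans (cmodB _ _))//.
apply: (@le_trans _ _ (M * norm2 (g - tsum b N) + norm2 l * norm2 (g - tsum b N))).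
  apply: lerD; last exact: cmod_inner_le.
  by apply: (le_trans (cmod_inner_le (Lf n) Lgb)); rewrite ler_wpM2r ?norm2_ge0.
have -> : norm2 (g - tsum b N) = norm2 (tsum b N - g).
  by rewrite norm2E (nrm_distC HI Lg Lb) -norm2E.
rewrite -mulrDl.
have n0 := norm2_ge0 l; have n1 := norm2_ge0 (tsum b N - g).
have := hN; rewrite ltr_pdivlMr// => hN2; nra.
Qed.

(** The projection keeps the Fourier coefficients of nonnegative index. *)
Lemma H2_projection h : L2circle h ->
  exists p, H2 p /\ forall g, H2 g -> inner_prod (h - p) g = 0.
Proof.
move=> Lh.
have eh : ell2 (fun k => inner_prod h (zpow k)).
  by exists (norm2 h ^+ 2) => n; rewrite norm2E;
     exact: (bessel HI (fun k _ => L2_zpow R k) (@ortho_zpow R) n Lh).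
have [p hp] := h2coef_exists eh; have Lp := h2coef_L2 hp.
exists p; split; first by apply/H2P; eexists; exact: hp.
move=> g /H2P[b hb]; have Lg := h2coef_L2 hb; have Lhp := L2_sub Lh Lp.
have z k : inner_prod (h - p) (zpow k) = 0.
  rewrite (ipBl HI Lh Lp (L2_zpow R k)) (inner_h2coef_zpow k hp).
  exact: subrr.
rewrite (ipC HI Lg Lhp); apply/eqP; rewrite conjc_eq0; apply/eqP.
apply: (ccvg_unique (cvg_inner_tsum hb Lhp)).
apply/ccvgP; apply: cvg_near_cst; apply: nearW => n.
rewrite subr0 inner_tsum_sum// big1 ?cmod0// => k _.
by rewrite (ipC HI Lhp (L2_zpow R k)) z conjc0 mulr0.
Qed.

Lemma ext_szego w z : cmod w < 1 -> cmod z < 1 ->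
  ext (szego w) z = (1 - conjc w * z)^-1.
Proof.
move=> w1 z1; apply: (ccvg_unique (ext_series (h2coef_szego w1) z1)).
set x := conjc w * z.
have x1 : cmod x < 1.
  rewrite cmodM cmod_conj; have := cmod_ge0 w; have := cmod_ge0 z; nra.
have d0 : 1 - x != 0 by rewrite -cmod_gt0 disk_denom_gt0// ltW.
have E n : \sum_(0 <= k < n) conjc w ^+ k * z ^+ k - (1 - x)^-1 = - (x ^+ n * (1 - x)^-1).
  apply: (mulIf d0); rewrite mulrBl mulVf// mulNr -mulrA mulVf// mulr1 big_mkord.
  have -> : \sum_(k < n) conjc w ^+ k * z ^+ k = \sum_(k < n) x ^+ k.
    by apply: eq_bigr => k _; rewrite exprMn.
  by rewrite [X in X - _]mulrC -[1 - x]opprB mulNr -subrX1 opprB addrAC subrr sub0r.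
apply/ccvgP.
have hs : (fun n => cmod x ^+ n * cmod (1 - x)^-1) @ \oo --> 0.
  rewrite -[X in _ --> X](mul0r (cmod (1 - x)^-1)); apply: cvgM; last exact: cvg_cst.
  by apply: cvg_geo0; rewrite cmod_ge0.
apply: cvg_trans hs; apply: near_eq_cvg; apply: nearW => n.
by rewrite E cmodN cmodM cmodX.
Qed.

Variables (u : R[i] -> R[i]) (v : R -> R[i]).
Hypothesis uv : is_inner u v.
Let mv := inner_meas uv.
Let v1 := inner_unimod uv.
Let K := model_space u.

Lemma L2_vmul f : L2circle f -> L2circle (fun t => v t * f t).
Proof. exact: (L2_mul_unimod mv v1). Qed.

Lemma L2_vcmul f : L2circle f -> L2circle (fun t => conjc (v t) * f t).
Proof.
apply: L2_mul_unimod; first exact: cmeas_conj.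
by move=> t; rewrite cmod_conj.
Qed.

(** [mulH2] speaks of arbitrary boundary functions of u F. They are determined up to null functions,
    so each may be replaced by the pointwise product of [v] with a boundary function of F. *)
Lemma model_spaceP f : K f <-> H2 f /\
  forall h, H2 h -> inner_prod f (fun t => v t * h t) = 0.
Proof.
split=> [[Hf fu]|[Hf fu]]; split=> //.
  move=> h Hh; apply: fu; have [hF bF] := H2_ext Hh.
  exists (ext h) => //.
  by have [] := inner_mul_hardy uv hF bF.
move=> g [F hF bg]; have [a aF] := hF.1.
have [h hah] := h2coef_exists (hardy_ell2 hF aF).
have [_ bF] := h2coef_hardy aF hah.
have [huF buF] := inner_mul_hardy uv hF bF.
have [b [_ bvh]] := hardy_boundary huF buF.
have [b' [tb' bg']] := hardy_boundary huF bg.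
have Lg := h2coef_L2 bg'; have Lvh := h2coef_L2 bvh.
have Hh : H2 h by apply/H2P; exists a.
have Hvh : H2 (fun t => v t * h t) by apply/H2P; exists b.
have Lf := H2_L2 Hf.
have hbb : b = b'.
  apply/funext => k; rewrite -(inner_h2coef_zpow k bvh) -(inner_h2coef_zpow k bg').
  apply: (ip_null_eq HI Lvh Lg (L2_zpow R k)).
  rewrite -norm2E.
  have Lr r : 0 <= r < 1 -> L2circle (fun t => u (r%:C%C * expi t) * F (r%:C%C * expi t)).
    by move=> /(h2coef_dil tb')/h2coef_L2.
  have /(boundary_valuesP Lvh Lr) c1 := buF.
  have /(boundary_valuesP Lg Lr) c2 := bg.
  have hs : (fun r : R => norm2 ((fun t => u (r%:C%C * expi t) * F (r%:C%C * expi t)) -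
      (fun t => v t * h t)) +
      norm2 ((fun t => u (r%:C%C * expi t) * F (r%:C%C * expi t)) - g)) @ 1^'- --> (0 : R).
    by rewrite -[X in _ --> X](addr0 0); exact: cvgD.
  apply/eqP; rewrite eq_le norm2_ge0 andbT.
  apply: (rcvg_le (cvg_cst _) hs); apply: near_left1 => r /Lr Lrr.
  by rewrite !norm2E (nrm_distC HI Lrr Lvh) (nrm_triangle HI).
have gv : norm2 ((fun t => v t * h t) - g) = 0.
  by apply: (h2coef_unique bvh); rewrite hbb.
rewrite (ipC HI Lg Lf) -(ip_null_eq HI Lvh Lg Lf) -?norm2E// (ipC HI Lf Lvh) conjcK.
exact: fu.
Qed.

Lemma model_H2 f : K f -> H2 f. Proof. by case. Qed.
Lemma model_L2 f : K f -> L2circle f. Proof. by move=> /model_H2/H2_L2. Qed.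

Lemma model_subspace : @subspace_of R (R -> R[i]^o) (@L2circle R) K.
Proof.
have HS := H2_subspace.
split; first exact: model_L2.
- apply/model_spaceP; split; first exact: (sub0 HS).
  by move=> h Hh; rewrite (ip0l HI)//; apply: L2_vmul; exact: H2_L2.
- move=> f g /model_spaceP[Hf hf] /model_spaceP[Hg hg]; apply/model_spaceP.
  split; first exact: (subD HS).
  move=> h Hh; have Lvh := L2_vmul (H2_L2 Hh).
  by rewrite (ipDl HI (H2_L2 Hf) (H2_L2 Hg) Lvh) hf// hg// addr0.
- move=> c f /model_spaceP[Hf hf]; apply/model_spaceP.
  split; first exact: (subZ HS).
  move=> h Hh; have Lvh := L2_vmul (H2_L2 Hh).
  by rewrite (ipZl HI c (H2_L2 Hf) Lvh) hf// mulr0.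
Qed.

Lemma model_weakly_compact :
  @weakly_compact R (R -> R[i]^o) (@inner_prod R) K.
Proof.
move=> f U UU Kf [M fM].
have fM' n : norm2 (f n) <= M by rewrite norm2E.
have [l [Hl hl]] := @H2_weakly_compact f U M UU (fun n => model_H2 (Kf n)) fM'.
exists l; split; last by move=> g /model_H2; exact: hl.
apply/model_spaceP; split=> // h Hh.
have [Hvh _] := inner_mul_H2 uv Hh.
apply: (ccvg_unique (hl _ Hvh)).
apply/ccvgP; apply: cvg_near_cst; apply: nearW => n.
by have /model_spaceP[_ ->] := Kf n; rewrite ?subr0 ?cmod0.
Qed.

(** With P the projection on the Hardy space, the projection on the model space is P h - v P
    (conj(v) h). *)
Lemma model_projection h : L2circle h ->
  exists g, K g /\ forall k, K k -> inner_prod (h - g) k = 0.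
Proof.
move=> Lh; have HS := H2_subspace.
have [p1 [Hp1 hp1]] := H2_projection Lh.
have Lvh := L2_vcmul Lh.
have [p2 [Hp2 hp2]] := H2_projection Lvh.
have [Hvp2 _] := inner_mul_H2 uv Hp2.
have Lp1 := H2_L2 Hp1; have Lp2 := H2_L2 Hp2; have Lvp2 := H2_L2 Hvp2.
have Lhp1 := L2_sub Lh Lp1; have Lhp2 := L2_sub Lvh Lp2.
exists (p1 - (fun t => v t * p2 t)); split.
  apply/model_spaceP; split; first exact: (subB HS).
  move=> g Hg; have [Hvg _] := inner_mul_H2 uv Hg.
  have Lg := H2_L2 Hg; have Lvg := H2_L2 Hvg.
  rewrite (ipBl HI Lp1 Lvp2 Lvg) inner_mul_unimod//.
  have := hp1 _ Hvg; rewrite (ipBl HI Lh Lp1 Lvg) => /eqP; rewrite subr_eq0 => /eqP <-.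
  have := hp2 _ Hg; rewrite (ipBl HI Lvh Lp2 Lg) => /eqP; rewrite subr_eq0 => /eqP <-.
  rewrite (inner_conj_mul (fun t => conjc (v t))).
  have -> : (fun t => conjc (conjc (v t)) * g t) = (fun t => v t * g t).
    by apply/funext => t; rewrite conjcK.
  exact: subrr.
move=> k Kk; have [Hk hk] := (model_spaceP k).1 Kk; have Lk := H2_L2 Hk.
have -> : h - (p1 - (fun t => v t * p2 t)) = (h - p1) + (fun t => v t * p2 t).
  by rewrite opprB addrCA addrC.
rewrite (ipDl HI Lhp1 Lvp2 Lk) hp1// add0r (ipC HI Lk Lvp2) hk// conjc0//.
Qed.

Lemma orth_projP h : L2circle h -> K (orth_proj K h) /\
  forall k, K k -> inner_prod (h - orth_proj K h) k = 0.
Proof.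
move=> Lh; rewrite /orth_proj; case: xgetP => [g _ //|none].
by have [g hg] := model_projection Lh; case: (none g).
Qed.

(** The reproducing kernel of the model space, (1 - conj(u(w)) v) / (1 - conj(w) z) on the
    circle. *)
Definition ker w : R -> R[i] := szego w - (fun t => conjc (u w) * (v t * szego w t)).

Lemma H2_szego w : cmod w < 1 -> H2 (szego w).
Proof. by move=> w1; apply/H2P; eexists; exact: h2coef_szego. Qed.

Lemma ker_model w : cmod w < 1 -> K (ker w).
Proof.
move=> w1; have HS := H2_subspace; have Hs := H2_szego w1.
have [Hvs _] := inner_mul_H2 uv Hs.
have Hcvs : H2 (fun t => conjc (u w) * (v t * szego w t)) by exact: (subZ HS _ Hvs).
apply/model_spaceP; split; first exact: (subB HS).
move=> h Hh; have [Hvh evh] := inner_mul_H2 uv Hh.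
have Ls := H2_L2 Hs; have Lvs := H2_L2 Hvs; have Lcvs := H2_L2 Hcvs.
have Lvh := H2_L2 Hvh; have Lh := H2_L2 Hh.
rewrite (ipBl HI Ls Lcvs Lvh) (ipZl HI _ Lvs Lvh) inner_mul_unimod//.
rewrite (ipC HI Lvh Ls) -/(ext _ w) evh// (ipC HI Lh Ls) -/(ext _ w) rmorphM.
exact: subrr.
Qed.

Lemma ker_repr f w : cmod w < 1 -> K f -> inner_prod f (ker w) = ext f w.
Proof.
move=> w1 /model_spaceP[Hf hf]; have Hs := H2_szego w1.
have [Hvs _] := inner_mul_H2 uv Hs.
have Lcvs : L2circle (fun t => conjc (u w) * (v t * szego w t)).
  exact: L2_scale (H2_L2 Hvs).
have Lf := H2_L2 Hf.
rewrite (ipBr HI Lf (H2_L2 Hs) Lcvs) (ipZr HI _ Lf (H2_L2 Hvs)) hf// mulr0 subr0//.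
Qed.

Lemma norm2_ker w : cmod w < 1 ->
  norm2 (ker w) ^+ 2 = (1 - cmod (u w) ^+ 2) / (1 - cmod w ^+ 2).
Proof.
move=> w1; have Kk := ker_model w1; have Hs := H2_szego w1.
have Ls := H2_L2 Hs; have [Hvs evs] := inner_mul_H2 uv Hs; have Lvs := H2_L2 Hvs.
have Lcvs := L2_scale (conjc (u w)) Lvs.
rewrite norm2E (nrm_sqr HI)//; last exact: model_L2.
rewrite ker_repr// /ext (ipBl HI Ls Lcvs Ls) (ipZl HI _ Lvs Ls) -!/(ext _ w).
rewrite evs// ext_szego// mulrA (mulrC (conjc (u w))) mul_conjc.
rewrite (mulrC (conjc w)) mul_conjc.
have -> : 1 - (cmod w ^+ 2)%:C%C = (1 - cmod w ^+ 2)%:C%C :> R[i] by rewrite rmorphB.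
rewrite -fmorphV -rmorphM -rmorphB /=.
by rewrite mulrBl mul1r.
Qed.

(** Bessel's inequality for [ker w], whose coefficients are the conjugates of the values
    [ext (e k) w]. *)
Lemma sum_ext_le n (e : nat -> R -> R[i]) w : cmod w < 1 ->
  @finite_family R (R -> R[i]^o) (@inner_prod R) K n e ->
  \sum_(k < n) cmod (ext (e k) w) ^+ 2 <= (1 - cmod (u w) ^+ 2) / (1 - cmod w ^+ 2).
Proof.
move=> w1 [Ke oe]; rewrite -norm2_ker//.
have Kk := ker_model w1; have Lk := model_L2 Kk.
have Le k : (k < n)%N -> L2circle (e k) by move=> /Ke/model_L2.
have := bessel HI Le oe n Lk; rewrite -norm2E; apply: le_trans.
rewrite [X in _ <= X](eq_bigl xpredT); last by move=> i; rewrite ltn_ord.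
apply: ler_sum => k _; rewrite (ipC HI (Le k (ltn_ord k)) Lk) cmod_conj.
by rewrite ker_repr//; exact: Ke.
Qed.

End ModelSpace.

(** * Polynomials in z and its conjugate *)

Section Polyval.
Variable R : realType.
Implicit Types (q : {poly {poly R[i]}}) (z w : R[i]).

Lemma polyval_ind (P : (R[i] -> R[i]) -> Prop) :
  (forall c, P (fun=> c)) ->
  (forall f g, P f -> P g -> P (fun z => f z + g z)) ->
  (forall f g, P f -> P g -> P (fun z => f z * g z)) ->
  P id -> P (@conjc R) -> forall q, P (polyval q).
Proof.
move=> Pc PD PM PX PJ q.
have P1 (p : {poly R[i]}) : P (fun z => p.[conjc z]).
  elim/poly_ind: p => [|p c IH].
    rewrite (_ : (fun z => _) = (fun=> 0)); first exact: Pc.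
    by apply/funext => z; rewrite horner0.
  rewrite (_ : (fun z => _) = (fun z => p.[conjc z] * conjc z + c)).
    by apply: PD => //; exact: PM.
  by apply/funext => z; rewrite hornerMXaddC.
elim/poly_ind: q => [|q c IH].
  rewrite (_ : polyval _ = (fun=> 0)); first exact: Pc.
  by apply/funext => z; rewrite /polyval !horner0.
rewrite (_ : polyval _ = (fun z => polyval q z * z + c.[conjc z])).
  by apply: PD => //; exact: PM.
by apply/funext => z; rewrite /polyval hornerMXaddC hornerD hornerM hornerC.
Qed.

Lemma polyval_lipschitz q : exists L M : R, [/\ 0 <= L, 0 <= M,
  (forall z, cmod z <= 1 -> cmod (polyval q z) <= M) &
  forall z w, cmod z <= 1 -> cmod w <= 1 ->
    cmod (polyval q z - polyval q w) <= L * cmod (z - w)].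
Proof.
move: q; apply: (polyval_ind (P := fun g => exists L M : R, [/\ 0 <= L, 0 <= M,
  (forall z, cmod z <= 1 -> cmod (g z) <= M) &
  forall z w, cmod z <= 1 -> cmod w <= 1 -> cmod (g z - g w) <= L * cmod (z - w)])).
- move=> c; exists 0, (cmod c); split=> //; first exact: cmod_ge0.
  by move=> z w _ _; rewrite subrr cmod0 mul0r.
- move=> f g [L [M [L0 M0 hM hL]]] [L' [M' [L'0 M'0 hM' hL']]].
  exists (L + L'), (M + M'); split; rewrite ?addr_ge0//.
    by move=> z z1; rewrite (le_trans (cmodD _ _))// lerD ?hM ?hM'.
  move=> z w z1 w1; rewrite opprD addrACA (le_trans (cmodD _ _))// mulrDl.
  by rewrite lerD ?hL ?hL'.
- move=> f g [L [M [L0 M0 hM hL]]] [L' [M' [L'0 M'0 hM' hL']]].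
  exists (L * M' + M * L'), (M * M'); split; rewrite ?addr_ge0 ?mulr_ge0//.
    by move=> z z1; rewrite cmodM ler_pM ?cmod_ge0 ?hM ?hM'.
  move=> z w z1 w1.
  have -> : f z * g z - f w * g w = (f z - f w) * g z + f w * (g z - g w) by ring.
  rewrite (le_trans (cmodD _ _))// !cmodM mulrDl lerD//.
    by rewrite mulrAC ler_pM ?cmod_ge0 ?hL ?hM'.
  by rewrite -mulrA ler_pM ?cmod_ge0 ?hL' ?hM.
- exists 1, 1; split=> // z w _ _; rewrite mul1r//.
- exists 1, 1; split=> // [z z1|z w _ _]; first by rewrite cmod_conj.
  by rewrite -rmorphB cmod_conj mul1r.
Qed.

Lemma cmeas_symbol q : cmeas (symbol q).
Proof.
apply: (polyval_ind (P := fun g => cmeas (fun t => g (expi t)))).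
- by move=> c; exact: cmeas_cst.
- by move=> f g; exact: cmeasD.
- by move=> f g; exact: cmeasM.
- exact: cmeas_expi.
- by apply: cmeas_conj; exact: cmeas_expi.
Qed.

(** On the circle [conjc z] is the inverse of [z], so a power of [z] clears it. *)
Lemma polyval_circle q : exists N (p : {poly R[i]}),
  forall z, cmod z = 1 -> z ^+ N * polyval q z = p.[z].
Proof.
move: q; apply: (polyval_ind (P := fun g => exists N (p : {poly R[i]}),
  forall z, cmod z = 1 -> z ^+ N * g z = p.[z])).
- by move=> c; exists 0%N, c%:P => z _; rewrite mul1r hornerC.
- move=> f g [n [p hp]] [m [p' hp']]; exists (n + m)%N, (p * 'X^m + p' * 'X^n) => z z1.
  by rewrite hornerD !hornerM !hornerXn -hp// -hp'// exprD; ring.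
- move=> f g [n [p hp]] [m [p' hp']]; exists (n + m)%N, (p * p') => z z1.
  by rewrite hornerM -hp// -hp'// exprD; ring.
- by exists 0%N, 'X => z _; rewrite mul1r hornerX.
- by exists 1%N, 1 => z z1; rewrite mul_conjc z1 expr1n hornerC.
Qed.

Lemma polyval_circle_eq0 q (Z : set R[i]) : infinite_set Z ->
  (forall z, Z z -> cmod z = 1 /\ polyval q z = 0) ->
  forall z, cmod z = 1 -> polyval q z = 0.
Proof.
move=> iZ hZ z z1; have [n [p hp]] := polyval_circle q.
suff p0 : p = 0.
  have := hp z z1; rewrite p0 horner0 => /eqP; rewrite mulf_eq0 expf_eq0.
  case/orP => [/andP[_ /eqP z0]|/eqP//].
  by move: z1; rewrite z0 cmod0 => /eqP; rewrite eq_sym oner_eq0.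
apply/eqP/negPn/negP => pn0; apply: iZ.
have [s hs] : exists s : seq R[i], forall z, root p z -> z \in s.
  have [s hs] := closed_field_poly_normal p.
  exists s => x; rewrite hs rootZ ?lead_coef_eq0//.
  by rewrite root_prod_XsubC.
apply: (@sub_finite_set _ _ [set` s]); last exact: finite_seq.
move=> x Zx /=; apply: hs; have [x1 qx] := hZ x Zx.
by rewrite /root -hp// qx mulr0.
Qed.

End Polyval.

(** * Truncated Toeplitz operators with bounded symbol *)

Section Toeplitz.
Variable R : realType.
Local Notation mu := (@lebesgue_measure R).
Local Notation A := (@angles R : set (measurableTypeR R)).
Local Notation HI := (L2_semi_ip R).
Implicit Types (f g h : R -> R[i]) (w : R[i]).
Variables (u : R[i] -> R[i]) (v : R -> R[i]).
Hypothesis uv : is_inner u v.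
Let K := model_space u.

Section Symbol.
Variables (phi : R -> R[i]) (C : R).
Hypotheses (C0 : 0 <= C) (mphi : cmeas phi) (phiC : forall t, cmod (phi t) <= C).
Let T := toeplitz u phi.

Lemma L2_symbol f : L2circle f -> L2circle (fun t => phi t * f t).
Proof. by apply: L2_mulb => // t _. Qed.

Lemma toeplitz_model f : K f -> K (T f).
Proof. by move=> Kf; have [] := orth_projP uv (L2_symbol (model_L2 Kf)). Qed.

Lemma toeplitz_inner f k : K f -> K k ->
  inner_prod (T f) k = inner_prod (fun t => phi t * f t) k.
Proof.
move=> Kf Kk; have Lpf := L2_symbol (model_L2 Kf).
have [KT /(_ k Kk)] := orth_projP uv Lpf.
rewrite (ipBl HI Lpf (model_L2 KT) (model_L2 Kk)) => /eqP.
by rewrite subr_eq0 => /eqP.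
Qed.

Lemma norm2_toeplitz_le f : K f -> norm2 (T f) <= norm2 (fun t => phi t * f t).
Proof.
move=> Kf; have Lpf := L2_symbol (model_L2 Kf); have KT := toeplitz_model Kf.
have [->|n0] := eqVneq (norm2 (T f)) 0; first exact: norm2_ge0.
have np : 0 < norm2 (T f) by rewrite lt_neqAle eq_sym n0 norm2_ge0.
rewrite -(ler_pM2r np) -expr2 [in X in X <= _]norm2E (nrm_sqr HI (model_L2 KT)).
rewrite toeplitz_inner// (le_trans (ler_norm _))// (le_trans (Re_le_cmod _))//.
exact: cmod_inner_le (model_L2 KT).
Qed.

Lemma norm2_toeplitz_bound f : K f -> norm2 (T f) <= C * norm2 f.
Proof.
move=> Kf; apply: (le_trans (norm2_toeplitz_le Kf)).
by apply: norm2_mulb => //; exact: model_L2 Kf.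
Qed.

Lemma zero_op_toeplitz : (forall t, A t -> phi t = 0) -> zero_op K T.
Proof.
move=> phi0 f Kf; apply/(norm2_eq0 (model_L2 (toeplitz_model Kf))).
apply/eqP; rewrite eq_le norm2_ge0 andbT.
apply: (le_trans (norm2_toeplitz_le Kf)).
rewrite norm2_mean (@mean_eq _ _ (fun=> 0)) ?mean_cst ?sqrtr0// => t At.
by rewrite phi0// mul0r cmod0 expr0n.
Qed.

Lemma zero_op_compact : zero_op K T -> compact_op K T.
Proof.
move=> zT f Kf _; exists id, (fun=> 0); split=> //.
  exact: (sub0 (model_subspace uv)).
rewrite (_ : (fun n => _) = cst 0); first exact: cvg_cst.
apply/funext => n /=; have KT := toeplitz_model (Kf n).
have -> : T (f n) - (fun=> 0) = T (f n) by apply/funext => t; rewrite fctE subr0.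
by apply/(norm2_eq0 (model_L2 KT)); exact: zT.
Qed.

End Symbol.

Lemma toeplitz_adjoint (phi : R -> R[i]) (C : R) f g : cmeas phi ->
  (forall t, cmod (phi t) <= C) -> K f -> K g ->
  inner_prod (toeplitz u phi f) g =
  inner_prod f (toeplitz u (fun t => conjc (phi t)) g).
Proof.
move=> mphi phiC Kf Kg.
have mphi' : cmeas (fun t => conjc (phi t)) by exact: cmeas_conj.
have phi'C t : cmod (conjc (phi t)) <= C by rewrite cmod_conj.
have KSg := toeplitz_model mphi' phi'C Kg.
rewrite (toeplitz_inner mphi phiC)// inner_conj_mul.
have Lpg := L2_symbol mphi' phi'C (model_L2 Kg).
rewrite (ipC HI Lpg (model_L2 Kf)) -(toeplitz_inner mphi' phi'C)//.
by rewrite -(ipC HI (model_L2 KSg) (model_L2 Kf)).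
Qed.

Lemma compact_opE T :
  compact_op K T <-> @compact_on R (R -> R[i]^o) (@inner_prod R) K T.
Proof.
have E : @norm2 R = @nrm R (R -> R[i]^o) (@inner_prod R).
  by apply/funext => f; exact: norm2E.
by rewrite /compact_op /compact_on E.
Qed.

End Toeplitz.

(** * Consequences of compactness for the symbol *)

Section Necessity.
Variable R : realType.
Local Notation HI := (L2_semi_ip R).
Implicit Types (f g h : R -> R[i]) (w : R[i]).

Lemma conj_denom w z : conjc (1 - conjc w * z) = 1 - w * conjc z.
Proof. by case: w z => a b [c d]; apply: complexP => /=; ring. Qed.

Lemma dist_expi w (t : R) : cmod (expi t - w) = cmod (1 - conjc w * expi t).
Proof.
have -> : expi t - w = expi t * conjc (1 - conjc w * expi t).
  rewrite conj_denom mulrBr mulr1 mulrCA.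
  by rewrite expi_conjK mulr1.
by rewrite cmodM cmod_expi mul1r cmod_conj.
Qed.

Lemma norm2_szego w : cmod w < 1 -> norm2 (szego w) ^+ 2 = (1 - cmod w ^+ 2)^-1.
Proof.
move=> w1; rewrite norm2E (nrm_sqr HI)//; last exact: L2_szego.
rewrite -/(ext (szego w) w) ext_szego// mulrC mul_conjc.
have -> : 1 - (cmod w ^+ 2)%:C%C = (1 - cmod w ^+ 2)%:C%C :> R[i] by rewrite rmorphB.
by rewrite -fmorphV.
Qed.

Lemma sq_lt1 w : cmod w < 1 -> 0 < 1 - cmod w ^+ 2.
Proof. by move=> w1; rewrite subr_gt0 exprn_ilt1// cmod_ge0. Qed.

Lemma norm2_szego_sqrt w : cmod w < 1 ->
  norm2 (szego w) * Num.sqrt (1 - cmod w ^+ 2) = 1.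
Proof.
move=> w1; have d0 := sq_lt1 w1.
apply/eqP; rewrite -(@eqrXn2 _ 2)// ?mulr_ge0 ?norm2_ge0 ?sqrtr_ge0//.
rewrite exprMn norm2_szego// sqr_sqrtr ?(ltW d0)//. 
by rewrite mulVf ?(gt_eqF d0)// expr1n.
Qed.

(** This is the weak convergence to 0 of the normalized Szego kernels: values of a polynomial stay
    bounded, and polynomials are dense in the Hardy space. *)
Lemma ext_little_o g (z : nat -> R[i]) : H2 g -> (forall n, cmod (z n) < 1) ->
  (fun n => Num.sqrt (1 - cmod (z n) ^+ 2)) @ \oo --> (0 : R) ->
  (fun n => cmod (ext g (z n)) * Num.sqrt (1 - cmod (z n) ^+ 2)) @ \oo --> (0 : R).
Proof.
move=> /H2P[a [Lg ag]] z1 z0; apply/cvgrPdist_lt => e e0.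
have e2 : 0 < e / 2 by rewrite divr_gt0.
move/cvgrPdist_lt : ag => /(_ _ e2)[N _ /(_ N (leqnn N))].
rewrite /= sub0r normrN ger0_norm ?norm2_ge0// => hN.
pose C := \sum_(k < N) cmod (a k).
have C0 : 0 <= C by rewrite sumr_ge0// => k _; exact: cmod_ge0.
have cz : (fun n => C * Num.sqrt (1 - cmod (z n) ^+ 2)) @ \oo --> (0 : R).
  by rewrite -[X in _ --> X](mulr0 C); apply: cvgM => //; exact: cvg_cst.
have La := L2_tsum a N.
suff key n : C * Num.sqrt (1 - cmod (z n) ^+ 2) < e / 2 ->
    cmod (ext g (z n)) * Num.sqrt (1 - cmod (z n) ^+ 2) < e.
  move/cvgrPdist_lt : cz => /(_ _ e2); apply: filterS => n.
  rewrite sub0r normrN ger0_norm ?mulr_ge0 ?sqrtr_ge0// => /key.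
  by rewrite sub0r normrN ger0_norm ?mulr_ge0 ?sqrtr_ge0 ?cmod_ge0.
move=> hC; have Ls := L2_szego (z1 n).
set D := Num.sqrt _ in hC *; have D0 : 0 <= D := sqrtr_ge0 _.
have Lga : L2circle (g - tsum a N) by exact: L2_sub.
have -> : ext g (z n) = inner_prod (g - tsum a N) (szego (z n)) +
    inner_prod (tsum a N) (szego (z n)).
  by rewrite (ipBl HI)// subrK.
apply: (@le_lt_trans _ _ ((norm2 (g - tsum a N) * norm2 (szego (z n)) + C) * D)).
  rewrite ler_wpM2r// (le_trans (cmodD _ _))// lerD ?cmod_inner_le//.
  rewrite inner_tsum_szego// big_mkord (le_trans (cmod_sum _ _ _))//.
  apply: ler_sum => k _; rewrite cmodM cmodX ler_piMr ?cmod_ge0//.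
  by rewrite exprn_ile1 ?cmod_ge0// ltW.
have hD : norm2 (szego (z n)) * D = 1 := norm2_szego_sqrt (z1 n).
rewrite mulrDl -mulrA hD mulr1 [e]splitr.
apply: ltrD; last exact: hC.
by rewrite norm2E (nrm_distC HI Lg La) -norm2E.
Qed.

Variables (u : R[i] -> R[i]) (v : R -> R[i]).
Hypothesis uv : is_inner u v.
Let K := model_space u.
Variable q : {poly {poly R[i]}}.
Let T := toeplitz u (symbol q).

(** For a unit vector the difference is the pairing of (q - q(w)) e with e, and q is Lipschitz. The
    estimate serves both the normalized kernels and the Malmquist-Takenaka functions, for which the
    right-hand side is small. *)
Lemma toeplitz_form_dist (L : R) e w : 0 <= L ->
  (forall z w, cmod z <= 1 -> cmod w <= 1 ->
    cmod (polyval q z - polyval q w) <= L * cmod (z - w)) ->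
  K e -> norm2 e = 1 -> cmod w < 1 ->
  cmod (inner_prod (T e) e - polyval q w) <= L * norm2 (fun t => (expi t - w) * e t).
Proof.
move=> L0 hL Ke e1 w1.
have [_ [M [_ M0 hM _]]] := polyval_lipschitz q.
have sM t : cmod (symbol q t) <= M by apply: hM; rewrite cmod_expi.
have ms := cmeas_symbol q; have Le := model_L2 Ke.
have Lse := L2_symbol ms sM Le.
have Lwe := L2_scale (polyval q w) Le.
have mw : cmeas (fun t => expi t - w).
  by apply: cmeasB; [exact: cmeas_expi|exact: cmeas_cst].
have Lz : L2circle (fun t => (expi t - w) * e t).
  apply: (L2_mulb (M := 2)) => // t _; rewrite (le_trans (cmodB _ _))// cmod_expi.
  by have := ltW w1; lra.
rewrite (toeplitz_inner uv ms sM)//.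
have -> : polyval q w = inner_prod (fun t => polyval q w * e t) e.
  by rewrite (ipZl HI)// (ipff HI)// -norm2E e1 expr1n mulr1.
rewrite -(ipBl HI Lse Lwe Le).
have Lsw : L2circle ((fun t => symbol q t * e t) - (fun t => polyval q w * e t)).
  exact: L2_sub.
apply: (le_trans (cmod_inner_le Lsw Le)); rewrite e1 mulr1.
rewrite -[L in leRHS]ger0_norm// -(cmod_real L).
have -> : cmod L%:C%C * norm2 (fun t => (expi t - w) * e t) =
    norm2 (fun t => L%:C%C * ((expi t - w) * e t)).
  by rewrite !norm2E (nrmZ HI).
apply: norm2_le_cmod => //; first exact: L2_scale.
move=> t _; rewrite fctE -mulrBl !cmodM cmod_real ger0_norm// mulrA.
by rewrite ler_wpM2r ?cmod_ge0// hL ?cmod_expi// ltW.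
Qed.

(** On the circle the denominator of the kernel has modulus |expi t - w|, so only the numerator 1 -
    conj(u(w)) v remains. *)
Lemma cmod_ker_le w t : cmod w < 1 -> cmod ((expi t - w) * ker u v w t) <= 2.
Proof.
move=> w1.
have E : ker u v w t = (1 - conjc (u w) * v t) * szego w t.
  by rewrite mulrBl mul1r -mulrA.
have d0 : 0 < cmod (1 - conjc w * expi t) by rewrite disk_denom_gt0// cmod_expi.
rewrite cmodM dist_expi E cmodM cmodV mulrCA mulfV ?(gt_eqF d0)// mulr1.
rewrite (le_trans (cmodB _ _))// cmod1 cmodM cmod_conj (inner_unimod uv) mulr1.
by have := inner_le1 uv w1; lra.
Qed.

(* Normalized reproducing kernels at points tending to the circle tend weakly
   to 0 as long as [|u|] stays bounded away from 1 there. *)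
Lemma compact_symbol_small (c e : R) : compact_op K T -> c < 1 -> 0 < e ->
  exists2 d : R, 0 < d & forall w, 1 - d < cmod w < 1 -> cmod (u w) <= c ->
    cmod (polyval q w) < e.
Proof.
move=> cT c1 e0; apply: contrapT => hd.
have [L [M [L0 M0 hM hL]]] := polyval_lipschitz q.
have /choice[z zP] : forall n : nat, exists w,
    [/\ 1 - n.+1%:R^-1 < cmod w, cmod w < 1, cmod (u w) <= c & e <= cmod (polyval q w)].
  move=> n; apply: contrapT => hw; apply: hd; exists n.+1%:R^-1; first by rewrite invr_gt0.
  move=> w /andP[w0 w1] uw; rewrite ltNge; apply/negP => qw.
  by apply: hw; exists w.
have z1 n : cmod (z n) < 1 by have [] := zP n.
have c0 : 0 <= c by have [_ _ h _] := zP 0%N; exact: le_trans (cmod_ge0 _) h.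
have k0 : 0 < 1 - c ^+ 2 by rewrite subr_gt0 exprn_ilt1.
(* As |u| <= c at [z n], the kernel there has norm at least kap / D n, so normalizing it multiplies
   by at most D n / kap, which tends to 0. *)
pose kap := Num.sqrt (1 - c ^+ 2).
have kp : 0 < kap by rewrite sqrtr_gt0.
pose D n := Num.sqrt (1 - cmod (z n) ^+ 2).
have Dp n : 0 < D n by rewrite sqrtr_gt0 sq_lt1.
have Kk n := ker_model uv (z1 n).
have nk n : kap <= norm2 (ker u v (z n)) * D n.
  rewrite -(@ler_pXn2r _ 2)// ?nnegrE ?mulr_ge0 ?norm2_ge0 ?sqrtr_ge0//.
  rewrite exprMn (norm2_ker uv)// !sqr_sqrtr; [|exact/ltW/sq_lt1|exact: ltW].
  rewrite divfK ?gt_eqF ?sq_lt1// lerB// ler_pXn2r// ?nnegrE ?cmod_ge0//.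
  by have [] := zP n.
have nkp n : 0 < norm2 (ker u v (z n)).
  by have := nk n; have := Dp n; have := norm2_ge0 (ker u v (z n)); nra.
pose r n : R := (norm2 (ker u v (z n)))^-1.
have rD n : r n <= D n / kap.
  by rewrite ler_pdivlMr// mulrC ler_pdivrMr// mulrC; exact: nk.
have r0 n : 0 < r n by rewrite invr_gt0.
pose en n : R -> R[i] := fun t => (r n)%:C%C * ker u v (z n) t.
have Ke n : K (en n) := subZ (model_subspace uv) (r n)%:C%C (Kk n).
have e1 n : norm2 (en n) = 1.
  have := nrmZ HI (r n)%:C%C (model_L2 (Kk n)).
  by rewrite -norm2E cmod_real gtr0_norm// => ->; rewrite -norm2E mulVf// gt_eqF.
have [phi [g [hphi Kg cg]]] : exists (phi : nat -> nat) g, [/\ {homo phi : m n / (m < n)%N},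
    K g & (fun n => norm2 (T (en (phi n)) - g)) @ \oo --> 0].
  by apply: cT => //; exists 1 => n; rewrite e1.
have phi_ge n : (n <= phi n)%N.
  by elim: n => // n IH; apply: (leq_ltn_trans IH); exact: hphi.
have D0 : (fun n => D (phi n)) @ \oo --> (0 : R).
  (* The 2 comes from 1 - x^2 <= 2 (1 - x). *)
  have h : (fun n : nat => Num.sqrt (2 * n.+1%:R^-1)) @ \oo --> (0 : R).
    rewrite -[X in _ --> X]sqrtr0; apply: cvg_sqrt.
    rewrite -[X in _ --> X](mulr0 2); apply: cvgM; first exact: cvg_cst.
    exact: cvg_harmonic.
  apply: (squeeze_cvgr _ (cvg_cst (0 : R)) h); apply: nearW => n.
  rewrite ltW ?Dp//= ler_wsqrtr//.
  have [h1 h2 _ _] := zP (phi n); have h3 := cmod_ge0 (z (phi n)).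
  have : (phi n).+1%:R^-1 <= n.+1%:R^-1 :> R by rewrite lef_pV2 ?posrE// ler_nat ltnS.
  move=> h4; have h5 := sqr_ge0 (1 - cmod (z (phi n))).
  apply: (@le_trans _ _ (2 * (1 - cmod (z (phi n))))); last first.
    rewrite ler_pM2l//; apply: le_trans h4; rewrite lerBlDr -lerBlDl.
    by rewrite ltW.
  by rewrite -subr_ge0; apply: le_trans h5 _; rewrite le_eqVlt; apply/orP; left; apply/eqP; ring.
have G0 := ext_little_o (model_H2 Kg) (fun n => z1 (phi n)) D0.
(* The three summands bound the pairing of T e - g with e, the pairing of g with e, and the distance
   from the quadratic form of [T] at e to q(z). All tend to 0, while |q(z)| >= e by the choice of
   [z]. *)
have lim : (fun n => norm2 (T (en (phi n)) - g) +
    kap^-1 * (cmod (ext g (z (phi n))) * D (phi n)) + 2 * L / kap * D (phi n))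
    @ \oo --> (0 + kap^-1 * 0 + 2 * L / kap * 0 : R).
  apply: cvgD; last by apply: cvgM => //; exact: cvg_cst.
  by apply: cvgD => //; apply: cvgM => //; exact: cvg_cst.
rewrite !mulr0 !addr0 in lim.
suff : e <= 0 by rewrite leNgt e0.
apply: (rcvg_le (cvg_cst e) lim); apply: nearW => n.
set m := phi n; have [_ _ _ qz] := zP m; apply: (le_trans qz).
have Lg := model_L2 Kg; have Len := model_L2 (Ke m).
have [_ [M' [_ _ hM' _]]] := polyval_lipschitz q.
have sM t : cmod (symbol q t) <= M' by apply: hM'; rewrite cmod_expi.
have KT := toeplitz_model uv (cmeas_symbol q) sM (Ke m).
have LT := model_L2 KT; have LTg := L2_sub LT Lg.
have -> : polyval q (z m) = (inner_prod (T (en m) - g) (en m) + inner_prod g (en m))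
   - (inner_prod (T (en m)) (en m) - polyval q (z m)).
  by rewrite (ipBl HI)//; ring.
rewrite (le_trans (cmodB _ _))// lerD//.
  rewrite (le_trans (cmodD _ _))// lerD//.
    by have := cmod_inner_le LTg Len; rewrite e1 mulr1.
  rewrite /en (ipZr HI _ Lg (model_L2 (Kk m))) (ker_repr uv)// cmodM cmod_conj.
  rewrite cmod_real gtr0_norm//.
  rewrite [leRHS](_ : _ = D m / kap * cmod (ext g (z m))); last by ring.
  by rewrite ler_wpM2r ?cmod_ge0.
apply: (le_trans (toeplitz_form_dist L0 hL (Ke m) (e1 m) (z1 m))).
have -> : 2 * L / kap * D m = L * (2 * (D m / kap)) by field; rewrite gt_eqF.
rewrite ler_wpM2l//.
apply: (@le_trans _ _ (2 * r m)); last by rewrite ler_wpM2l.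
have mk : cmeas (ker u v (z m)) by have /L2circleP[] := model_L2 (Kk m).
apply: norm2_bounded; first by rewrite mulr_ge0// ltW.
  apply: cmeasM; last by apply: cmeasM => //; exact: cmeas_cst.
  by apply: cmeasB; [exact: cmeas_expi|exact: cmeas_cst].
move=> t _; rewrite /en mulrCA cmodM cmod_real gtr0_norm// [leLHS]mulrC ler_wpM2r ?(ltW (r0 m))//.
exact: cmod_ker_le.
Qed.

End Necessity.

(** * Weighted trace bounds and a compactness criterion *)

Section HilbertSchmidt.
Variable R : realType.
Local Notation mu := (@lebesgue_measure R).
Local Notation A := (@angles R : set (measurableTypeR R)).
Local Notation HI := (L2_semi_ip R).
Implicit Types (f g h : R -> R[i]) (w : R[i]).

(** The quadratic form of multiplication by [W]; summed over an orthonormal family of the model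
    space it is a partial trace of the operator with symbol [W]. *)
Definition wmean (W : R -> R) f : R := mean (fun t => W t * cmod (f t) ^+ 2).

Section Weight.
Variables (W : R -> R) (M : R).
Hypotheses (mW : measurable_fun A W) (W0 : forall t, 0 <= W t) (WM : forall t, W t <= M).

Lemma weight_M_ge0 : 0 <= M. Proof. exact: le_trans (W0 0) (WM 0). Qed.
Let M0 := weight_M_ge0.

Lemma mint_weight f : L2circle f -> mint (fun t => W t * cmod (f t) ^+ 2).
Proof.
move=> /L2circleP[mf if2]; apply: (mint_le _ _ (mintZ M if2)).
  by apply: measurable_funM => //; exact: cmeas_cmod2.
by move=> t _ /=; rewrite ger0_norm ?mulr_ge0 ?cmod_ge0// ler_wpM2r ?sqr_ge0.
Qed.

Lemma wmean_ge0 f : 0 <= wmean W f.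
Proof. by apply: mean_ge0 => t _; rewrite mulr_ge0// sqr_ge0. Qed.

Lemma wmean_le f : L2circle f -> wmean W f <= M * norm2 f ^+ 2.
Proof.
move=> Lf; have /L2circleP[_ if2] := Lf; rewrite norm2_sqr -meanZ//.
apply: mean_le; [exact: mint_weight|exact: mintZ|].
by move=> t _; rewrite ler_wpM2r ?sqr_ge0.
Qed.

Lemma wmeanZ (c : R[i]) f : L2circle f ->
  wmean W (fun t => c * f t) = cmod c ^+ 2 * wmean W f.
Proof.
move=> Lf; rewrite /wmean -meanZ; last exact: mint_weight.
by apply: mean_eq => t _; rewrite cmodM exprMn mulrCA.
Qed.

Let s t : R[i] := (Num.sqrt (W t))%:C%C.

Lemma cmeas_sqrt_weight : cmeas s.
Proof.
split; last exact: measurable_cst.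
apply: (@measurableT_comp _ _ _ _ _ _ (@Num.sqrt R)) => //.
by apply: continuous_measurable_fun; exact: sqrt_continuous.
Qed.

Lemma wmeanE f : wmean W f = norm2 (fun t => s t * f t) ^+ 2.
Proof.
rewrite norm2_sqr; apply: mean_eq => t _.
by rewrite cmodM exprMn cmod_real real_normK ?num_real// sqr_sqrtr.
Qed.

Lemma cvg_wmean (T : Type) (F : set_system T) (FF : Filter F) (f : T -> R -> R[i]) l :
  L2circle l -> (\forall r \near F, L2circle (f r)) ->
  (fun r => norm2 (f r - l)) @ F --> (0 : R) ->
  (fun r => wmean W (f r)) @ F --> wmean W l.
Proof.
move=> Ll Lf fl.
have ms := cmeas_sqrt_weight.
have sM t : cmod (s t) <= Num.sqrt M.
  by rewrite cmod_real ger0_norm ?sqrtr_ge0// ler_wsqrtr.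
have Ls f' : L2circle f' -> L2circle (fun t => s t * f' t).
  by move=> Lf'; exact: (L2_mulb ms (fun t _ => sM t) Lf').
have h : (fun r => Num.sqrt M * norm2 (f r - l)) @ F --> (0 : R).
  by rewrite -[X in _ --> X](mulr0 (Num.sqrt M)); apply: cvgM => //; exact: cvg_cst.
have h2 : (fun r => norm2 (fun t => s t * f r t)) @ F --> norm2 (fun t => s t * l t).
  apply/cvgrPdist_lt => e e0; move/cvgrPdist_lt : h => /(_ _ e0) h.
  apply: filterS2 Lf h => r Lr; rewrite sub0r normrN.
  move=> /(le_lt_trans (ler_norm _)); apply: le_lt_trans.
  rewrite distrC !norm2E (le_trans (nrm_dist HI (Ls _ Lr) (Ls _ Ll)))// -norm2E.
  rewrite (_ : _ - _ = (fun t => s t * (f r - l) t)); last first.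
    by apply/funext => t; rewrite fctE mulrBr.
  rewrite -norm2E; exact: (norm2_mulb (sqrtr_ge0 M) ms (fun t _ => sM t) (L2_sub Lr Ll)).
have E f' : wmean W f' = norm2 (fun t => s t * f' t) * norm2 (fun t => s t * f' t).
  by rewrite wmeanE expr2.
by rewrite E; under eq_fun do rewrite E; exact: cvgM.
Qed.

End Weight.

Variables (u : R[i] -> R[i]) (v : R -> R[i]).
Hypothesis uv : is_inner u v.
Let K := model_space u.

(** Replacing e^(it) by r e^(it) costs at most (1 - r) |w| <= 1 - r |w|, and the latter is at most
    the modulus on the right. The square of this 2 is the 4 in front of [B] below. *)
Lemma dist_dilate_le w (r t : R) : cmod w <= 1 -> 0 <= r < 1 ->
  cmod (expi t - w) <= 2 * cmod (1 - conjc w * (r%:C%C * expi t)).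
Proof.
move=> w1 /andP[r0 r1]; rewrite dist_expi.
have -> : 1 - conjc w * expi t = (1 - conjc w * (r%:C%C * expi t)) -
    (1 - r)%:C%C * (conjc w * expi t).
  by rewrite rmorphB /=; ring.
rewrite (le_trans (cmodB _ _))// mulr_natl mulr2n lerD2l.
have z1 : cmod (r%:C%C * expi t) <= 1.
  by rewrite cmodM cmod_expi mulr1 cmod_real ger0_norm// ltW.
have wr : cmod (w * r%:C%C) <= r by rewrite cmodM cmod_real ger0_norm// ler_piMl.
have d := disk_denom_ge (w * r%:C%C) (_ : cmod (expi t) <= 1).
rewrite cmod_expi in d; have {}d := d (lexx _).
have E : conjc (w * r%:C%C) * expi t = conjc w * (r%:C%C * expi t).
  by rewrite rmorphM /= oppr0 mulrA.
rewrite E in d; apply: le_trans d.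
rewrite !cmodM cmod_expi mulr1 cmod_conj cmod_real ger0_norm ?subr_ge0 ?(ltW r1)//.
have h1 : (1 - r) * cmod w <= 1 - r by rewrite ler_piMr// subr_ge0 ltW.
by apply: (le_trans h1); rewrite lerD2l lerN2 -cmodM.
Qed.

Section TraceBound.
(** [Am] covers both applications: zeros in the disk, where m n = 1 - |zeta n|^2, and atoms on the
    circle, where Aq n = 0. *)
Variables (W : R -> R) (M B S : R) (zeta : nat -> R[i]) (m Aq : nat -> R).
Hypotheses (mW : measurable_fun A W) (W0 : forall t, 0 <= W t) (WM : forall t, W t <= M)
  (zeta1 : forall n, cmod (zeta n) <= 1) (m0 : forall n, 0 <= m n)
  (Aq0 : forall n, 0 <= Aq n) (B0 : 0 <= B)
  (WA : forall n t, 0 < m n -> W t <= Aq n + B * cmod (expi t - zeta n) ^+ 2)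
  (Am : forall n, Aq n * m n <= Aq n * (1 - cmod (zeta n) ^+ 2))
  (uD : forall w, cmod w < 1 ->
    (((1 - cmod (u w) ^+ 2) / (1 - cmod w ^+ 2))%:E <=
     \sum_(0 <= n <oo) (m n / cmod (1 - conjc (zeta n) * w) ^+ 2)%:E)%E)
  (hS : (\sum_(0 <= n <oo) (Aq n + 4 * B * m n)%:E <= S%:E)%E).

Let pk (r : R) n t : R := m n / cmod (1 - conjc (zeta n) * (r%:C%C * expi t)) ^+ 2.

Let denom_gt0 n r t : 0 <= r < 1 -> 0 < cmod (1 - conjc (zeta n) * (r%:C%C * expi t)).
Proof.
move=> r01; have z1 := cmod_dil_lt1 t r01.
have := cmod_dist_le 1 (conjc (zeta n) * (r%:C%C * expi t)).
rewrite cmod1 cmodM cmod_conj; apply: lt_le_trans.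
rewrite subr_gt0; apply: le_lt_trans z1.
by rewrite ler_piMl ?cmod_ge0.
Qed.

Let pk_ge0 r n t : 0 <= pk r n t.
Proof. by rewrite divr_ge0// sqr_ge0. Qed.

Let scaled_lt1 r n : 0 <= r < 1 -> cmod (zeta n * r%:C%C) < 1.
Proof.
move=> /andP[r0 r1]; rewrite cmodM cmod_real ger0_norm//.
by apply: le_lt_trans r1; rewrite ler_piMl.
Qed.

Let pkE r n t : 0 <= r < 1 -> pk r n t = m n * cmod (szego (zeta n * r%:C%C) t) ^+ 2.
Proof.
move=> r01; rewrite /pk /szego cmodV exprVn; congr (_ / cmod (1 - _) ^+ 2).
by rewrite rmorphM /= oppr0 mulrA.
Qed.

Let mint_pk r n : 0 <= r < 1 -> mint (pk r n).
Proof.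
move=> r01; have /L2circleP[_ i2] := L2_szego (scaled_lt1 n r01).
by apply: mint_eq (mintZ (m n) i2) => t _; rewrite pkE.
Qed.

Let mean_pk r n : 0 <= r < 1 -> Aq n * mean (pk r n) <= Aq n.
Proof.
move=> r01; have /andP[r0 r1] := r01; have z1 := scaled_lt1 n r01.
have /L2circleP[_ i2] := L2_szego z1.
rewrite (@mean_eq _ _ (fun t => m n * cmod (szego (zeta n * r%:C%C) t) ^+ 2)); last first.
  by move=> t _; exact: pkE.
rewrite meanZ// -norm2_sqr norm2_szego// mulrA ler_pdivrMr ?sq_lt1//.
apply: (le_trans (Am n)); rewrite ler_wpM2l//.
rewrite lerD2l lerN2 ler_pXn2r// ?nnegrE ?cmod_ge0//.
by rewrite cmodM cmod_real ger0_norm// ler_piMr ?cmod_ge0// ltW.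
Qed.

Let mint_Wpk r n : 0 <= r < 1 -> mint (fun t => W t * pk r n t).
Proof.
move=> r01; apply: (mint_le _ _ (mintZ M (mint_pk n r01))).
  by apply: measurable_funM => //; apply: mint_measurable; exact: mint_pk.
move=> t _; have p0 := pk_ge0 r n t.
by rewrite /= ger0_norm; [exact: ler_wpM2r|exact: mulr_ge0].
Qed.

(** Of the two parts of the bound [WA], the constant one is integrated exactly through the norm of a
    Szego kernel, and the quadratic one cancels the denominator of [pk] by [dist_dilate_le]. *)
Let mean_Wpk r n : 0 <= r < 1 -> mean (fun t => W t * pk r n t) <= Aq n + 4 * B * m n.
Proof.
move=> r01; have ip := mint_pk n r01.
have [mn0|mn0] := leP (m n) 0.
  have {}mn0 : m n = 0 by apply/eqP; rewrite eq_le mn0 m0.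
  rewrite (@mean_eq _ _ (fun=> 0)) ?mean_cst ?mn0 ?mulr0 ?addr0// => t _.
  by rewrite /pk mn0 mul0r mulr0.
apply: (@le_trans _ _ (mean (fun t => Aq n * pk r n t + 4 * B * m n))).
  apply: mean_le; first exact: mint_Wpk.
    by apply: mintD; [exact: mintZ|exact: mint_cst].
  move=> t _; apply: (@le_trans _ _ ((Aq n + B * cmod (expi t - zeta n) ^+ 2) * pk r n t)).
    by rewrite ler_wpM2r// WA.
  rewrite mulrDl lerD2l /pk; set d := cmod (1 - _).
  have d0 : 0 < d by exact: denom_gt0.
  have h : cmod (expi t - zeta n) <= 2 * d by exact: dist_dilate_le.
  have h2 : cmod (expi t - zeta n) ^+ 2 <= 4 * d ^+ 2.
    apply: (@le_trans _ _ ((2 * d) ^+ 2)).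
      by rewrite ler_pXn2r// ?nnegrE ?cmod_ge0// mulr_ge0// ltW.
    by rewrite exprMn -natrX.
  rewrite mulrA ler_pdivrMr ?exprn_gt0//.
  have -> : 4 * B * m n * d ^+ 2 = B * (4 * d ^+ 2) * m n by ring.
  by rewrite ler_wpM2r// ler_wpM2l.
rewrite meanD; [|exact: mintZ|exact: mint_cst].
by rewrite mean_cst meanZ// lerD2r mean_pk.
Qed.

(** The kernel bound [uD] is available only inside the disk. So each e_k is replaced by its dilate
    of radius r, the sum over the points zeta is exchanged with the integral, and r tends to 1 at
    the end. *)
Lemma trace_bound n (e : nat -> R -> R[i]) :
  @finite_family R (R -> R[i]^o) (@inner_prod R) K n e ->
  \sum_(k < n) wmean W (e k) <= S.
Proof.
move=> fe; have [Ke _] := fe.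
pose fr r k : R -> R[i] := fun t => ext (e k) (r%:C%C * expi t).
have Lfr r k : 0 <= r < 1 -> (k < n)%N -> L2circle (fr r k).
  move=> r01 /Ke/model_H2/H2P[a ha].
  exact: h2coef_L2 (h2coef_dil (fun w => ext_series ha) r01).
have lim : (fun r : R => \sum_(k < n) wmean W (fr r k)) @ 1^'- -->
    \sum_(k < n) wmean W (e k).
  apply: (@cvg_finsum R R _ _ _ _ _ _ (fun (k : 'I_n) r => wmean W (fr r k))).
  move=> k _; have Kk := Ke k (ltn_ord k).
  have /H2P[a ha] := model_H2 Kk.
  apply: (cvg_wmean mW W0 WM) => //; first exact: model_L2 Kk.
    by apply: near_left1 => r r01; apply: Lfr.
  exact: (h2coef_dil_cvg (fun w => ext_series ha) ha).
apply: (rcvg_le lim (cvg_cst S)); apply: near_left1 => r r01.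
rewrite /wmean -mean_sum; last by move=> k _; exact: (mint_weight mW W0 WM (Lfr r k r01 (ltn_ord k))).
have i1 : mint (fun t => \sum_(k < n) W t * cmod (fr r k t) ^+ 2).
  by apply: mint_sum => k _; exact: (mint_weight mW W0 WM (Lfr r k r01 (ltn_ord k))).
rewrite -(ler_pM2l (twopi_gt0 R)) -lee_fin -mint_integral//.
have mpk j : measurable_fun A (fun t => (W t * pk r j t)%:E).
  by apply/measurable_EFinP; apply: mint_measurable; exact: mint_Wpk.
have pk0 j t : (0 <= (W t * pk r j t)%:E)%E by rewrite lee_fin mulr_ge0.
apply: (@le_trans _ _ (\int[mu]_(t in A) (\sum_(0 <= j <oo) (W t * pk r j t)%:E))%E).
  apply: ge0_le_integral => //.
  - by move=> t _; rewrite lee_fin sumr_ge0// => k _; rewrite mulr_ge0// sqr_ge0.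
  - by apply/measurable_EFinP; exact: mint_measurable.
  - apply: ge0_emeasurable_sum; first by move=> j t _ _; exact: pk0.
    by move=> j _; exact: mpk.
  move=> t _; under eq_eseriesr do rewrite EFinM.
  rewrite nneseriesZl; last by move=> j _; rewrite lee_fin.
  have Wt0 : (0 <= (W t)%:E)%E by rewrite lee_fin.
  rewrite -mulr_sumr EFinM; apply: (lee_wpmul2l Wt0).
  have w1 := cmod_dil_lt1 t r01.
  apply: le_trans (uD w1); rewrite lee_fin.
  exact: (sum_ext_le uv w1 fe).
rewrite integral_nneseries//.
apply: (@le_trans _ _ (\sum_(0 <= j <oo) ((2 * pi)%:E * (Aq j + 4 * B * m j)%:E))%E).
  apply: lee_nneseries => [j _ _|j _].
    by apply: integral_ge0 => t _; exact: pk0.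
  rewrite mint_integral; last exact: mint_Wpk.
  by rewrite -EFinM lee_fin ler_pM2l ?twopi_gt0// mean_Wpk.
rewrite nneseriesZl; last first.
  by move=> j _; rewrite lee_fin addr_ge0// !mulr_ge0.
have pi0 : (0 <= (2 * pi : R)%:E)%E by rewrite lee_fin ltW ?twopi_gt0.
by rewrite (EFinM (2 * pi) S); exact: (lee_wpmul2l pi0 hS).
Qed.

End TraceBound.

Lemma toeplitz_compact (phi : R -> R[i]) (C : R) : 0 <= C -> cmeas phi ->
  (forall t, cmod (phi t) <= C) ->
  (forall eps : R, 0 < eps -> exists (W : R -> R) (M S : R), [/\ measurable_fun A W,
    (forall t, 0 <= W t <= M), (forall t, cmod (phi t) ^+ 2 <= eps + 2 * W t) &
    forall n (e : nat -> R -> R[i]),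
      @finite_family R (R -> R[i]^o) (@inner_prod R) K n e ->
      \sum_(k < n) wmean W (e k) <= S]) ->
  compact_op K (toeplitz u phi).
Proof.
move=> C0 mphi phiC hW; apply/compact_opE.
have HK := model_subspace uv.
have mphi' := cmeas_conj mphi.
have phi'C t : cmod (conjc (phi t)) <= C by rewrite cmod_conj.
apply: (compact_of_finite_rank_approx HI HK (S := toeplitz u (fun t => conjc (phi t))) (B := C)) => //.
- by move=> f; exact: (toeplitz_model uv mphi phiC).
- by move=> f; exact: (toeplitz_model uv mphi' phi'C).
- by move=> f g; exact: (toeplitz_adjoint uv mphi phiC).
- by move=> f Kf; rewrite -!norm2E; exact: (norm2_toeplitz_bound uv C0 mphi phiC).
- exact: (model_weakly_compact uv).
move=> eps eps0.
(* On the complement of the finite family, |phi|^2 <= eps^2/2 + 2 W and [wmean W f] <= (eps^2/4)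
   ||f||^2 add up to eps^2 ||f||^2. *)
have e2 : 0 < eps ^+ 2 / 2 by rewrite divr_gt0// exprn_gt0.
have e4 : 0 < eps ^+ 2 / 4 by rewrite divr_gt0// exprn_gt0.
have [W [M [S [mW W0M phiW trW]]]] := hW _ e2.
have W0 t : 0 <= W t by have /andP[] := W0M t.
have WM t : W t <= M by have /andP[] := W0M t.
have [n [e [fe he]]] := @finite_trace_small _ _ _ _ HI _ HK (wmean W) S M
  (fun f Kf => introT andP (conj (wmean_ge0 W0 f)
     (eq_ind _ (fun x => wmean W f <= M * x ^+ 2) (wmean_le mW W0 WM (model_L2 Kf)) _ (norm2E f))))
  (fun a f Kf => wmeanZ mW W0 WM a (model_L2 Kf)) trW _ e4.
exists n, e; split=> // f Kf fperp.
have Lf := model_L2 Kf; have /L2circleP[_ if2] := Lf.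
rewrite -!norm2E -(@ler_pXn2r _ 2)// ?nnegrE ?norm2_ge0//; last first.
  by rewrite mulr_ge0 ?norm2_ge0// ltW.
have h1 := norm2_toeplitz_le uv mphi phiC Kf.
apply: (@le_trans _ _ (norm2 (fun t => phi t * f t) ^+ 2)).
  by rewrite ler_pXn2r// ?nnegrE ?norm2_ge0.
have := he f Kf fperp; rewrite -norm2E => h2.
rewrite norm2_sqr exprMn.
have Lpf := L2_symbol mphi phiC Lf; have /L2circleP[_ ipf] := Lpf.
have iW := mint_weight mW W0 WM Lf.
apply: (@le_trans _ _ (mean (fun t => eps ^+ 2 / 2 * cmod (f t) ^+ 2 +
   2 * (W t * cmod (f t) ^+ 2)))).
  apply: mean_le => //; first by apply: mintD; exact: mintZ.
  move=> t _; rewrite cmodM exprMn mulrA -mulrDl ler_wpM2r ?sqr_ge0//.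
rewrite meanD; [|exact: mintZ|exact: mintZ].
rewrite !meanZ// -norm2_sqr -/(wmean W f); lra.
Qed.

End HilbertSchmidt.

(** * Singular inner functions *)

Section Atomic.
Variable R : realType.
Implicit Types (f g h : R -> R[i]) (w z : R[i]).

Lemma lee_nneseries_lim (a : nat -> R) (x : R) : (forall n, 0 <= a n) ->
  (fun n => \sum_(0 <= k < n) a k) @ \oo --> x ->
  (x%:E <= \sum_(0 <= n <oo) (a n)%:E)%E.
Proof.
move=> a0 ax.
have h n : ((\sum_(0 <= k < n) a k)%:E <= \sum_(0 <= n <oo) (a n)%:E)%E.
  rewrite -sumEFin; apply: nneseries_lim_ge => k _ _; rewrite lee_fin//.
have s0 : (0 <= \sum_(0 <= n <oo) (a n)%:E)%E.
  by apply: nneseries_ge0 => n _ _; rewrite lee_fin.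
case: (\sum_(0 <= n <oo) (a n)%:E)%E h s0 => [y h _|_ _|_]; [|exact: leey|by []].
rewrite lee_fin; apply: (rcvg_le ax (cvg_cst y)); apply: nearW => n.
by rewrite -lee_fin.
Qed.

Lemma nneseries_le_bound (a : nat -> R) (S : R) : (forall n, 0 <= a n) ->
  (forall n, \sum_(0 <= k < n) a k <= S) -> (\sum_(0 <= n <oo) (a n)%:E <= S%:E)%E.
Proof.
move=> a0 aS; apply: lime_le; first by apply: is_cvg_nneseries => n _ _; rewrite lee_fin.
by apply: nearW => n; rewrite sumEFin lee_fin.
Qed.

Lemma series_bounded (a : nat -> R) : (forall n, 0 <= a n) -> cvgn (series a) ->
  exists S : R, 0 <= S /\ forall n, \sum_(0 <= k < n) a k <= S.
Proof.
move=> a0 ca; exists (limn (series a)).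
have h n : \sum_(0 <= k < n) a k <= limn (series a).
  by apply: nondecreasing_cvgn_le => //; apply: nondecreasing_series => k _ _.
by split=> //; have := h 0%N; rewrite big_geq.
Qed.

(** For [z] on the circle this is the Poisson kernel. *)
Lemma Re_herglotz z w : z != w ->
  complex.Re (herglotz z w) = (cmod z ^+ 2 - cmod w ^+ 2) / cmod (z - w) ^+ 2.
Proof.
move=> zw; have d0 : z - w != 0 by rewrite subr_eq0.
have c0 : cmod (z - w) ^+ 2 != 0 by rewrite expf_neq0// cmod_eq0.
have -> : herglotz z w = ((cmod (z - w) ^+ 2)^-1)%:C%C * ((z + w) * conjc (z - w)).
  have -> : ((cmod (z - w) ^+ 2)^-1)%:C%C = ((z - w) * conjc (z - w))^-1.
    by rewrite mul_conjc -fmorphV.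
  have cd0 : conjc (z - w) != 0 by rewrite conjc_eq0.
  by rewrite /herglotz invfM mulrC -mulrA (mulrC (_^-1) ((z + w) * _)) -mulrA mulfV// mulr1 mulrC.
rewrite ReM_real mulrC; congr (_ / _).
rewrite !cmod_sqrE; case: z w {zw d0 c0} => a b [c d] /=; ring.
Qed.

Lemma cmod_expi_sub w (t : R) : cmod w < 1 -> 0 < cmod (expi t - w).
Proof. by move=> w1; rewrite dist_expi disk_denom_gt0// cmod_expi. Qed.

Lemma cmod_expi_sub' w (t : R) : cmod (expi t - w) = cmod (1 - conjc (expi t) * w).
Proof.
rewrite dist_expi -cmod_conj conj_denom; congr (cmod (1 - _)).
by rewrite mulrC.
Qed.

(** Linearizes 1 - |u|^2 in the Poisson sum of the atoms; this is why each atom carries the mass 2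
    r_n in the trace bound. *)
Lemma one_minus_expR2 (x : R) : 1 - expR (- x) ^+ 2 <= 2 * x.
Proof.
have := expR_ge1Dx (- (2 * x)).
have -> : expR (- x) ^+ 2 = expR (- (2 * x)) by rewrite expr2 -expRD; congr expR; ring.
by lra.
Qed.

Variables (u : R[i] -> R[i]) (v : R -> R[i]).
Hypothesis uv : is_inner u v.
Let K := model_space u.
Variable q : {poly {poly R[i]}}.
Let T := toeplitz u (symbol q).

Lemma compact_symbol_zero (c : R) z : compact_op K T -> c < 1 -> cmod z <= 1 ->
  (forall d : R, 0 < d -> exists w,
    [/\ 1 - d < cmod w, cmod w < 1, cmod (z - w) < d & cmod (u w) <= c]) ->
  polyval q z = 0.
Proof.
move=> cT c1 z1 hz; apply/eqP; rewrite -cmod_eq0 eq_le cmod_ge0 andbT.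
apply/ler_addgt0Pr => e e0; rewrite add0r.
have [L [M [L0 M0 hM hL]]] := polyval_lipschitz q.
have e2 : 0 < e / 2 by rewrite divr_gt0.
have [d d0 hd] := compact_symbol_small uv cT c1 e2.
have L1 : 0 < L + 1 by rewrite ltr_wpDl.
pose d' := Num.min d (e / 2 / (L + 1)).
have d'0 : 0 < d' by rewrite lt_min d0 !divr_gt0.
have [w [w0 w1 zw uw]] := hz d' d'0.
have wd : 1 - d < cmod w.
  by apply: le_lt_trans w0; rewrite lerB// ge_min lexx.
have qw := hd w (introT andP (conj wd w1)) uw.
have h := hL _ _ z1 (ltW w1).
have zw2 : cmod (z - w) * (L + 1) < e / 2.
  by rewrite -ltr_pdivlMr//; apply: (lt_le_trans zw); rewrite ge_min lexx orbT.
have := cmod_dist_le (polyval q z) (polyval q w); have := cmod_ge0 (z - w).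
nra.
Qed.

Lemma zero_of_infinite_circle_zeros (Z : set R[i]) : infinite_set Z ->
  (forall z, Z z -> cmod z = 1 /\ polyval q z = 0) -> zero_op K T.
Proof.
move=> iZ hZ; have [L [M [_ M0 hM _]]] := polyval_lipschitz q.
apply: (zero_op_toeplitz uv (cmeas_symbol q) (C := M)).
  by move=> t; apply: hM; rewrite cmod_expi.
by move=> t _; apply: (polyval_circle_eq0 iZ hZ); exact: cmod_expi.
Qed.

Variables (r theta : nat -> R).
Hypothesis hu : atomic_singular_inner u r theta.

Let r0 n : 0 <= r n. Proof. by have [] := hu. Qed.

Lemma atomic_series w : cmod w < 1 -> exists h : R,
  (fun n => \sum_(0 <= k < n) r k * ((1 - cmod w ^+ 2) / cmod (expi (theta k) - w) ^+ 2))
     @ \oo --> h /\ cmod (u w) = expR (- h).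
Proof.
move=> w1; have [_ _ _ /(_ w w1) [h ch uw]] := hu.
exists (complex.Re h); split; last by rewrite uw cmod_cexp ReN.
apply: cvg_trans (ccvg_Re ch); apply: near_eq_cvg; apply: nearW => n.
rewrite Re_sum; apply: eq_bigr => k _; rewrite ReM_real Re_herglotz.
  by rewrite cmod_expi expr1n.
by rewrite -subr_eq0 -cmod_gt0 cmod_expi_sub.
Qed.

(** Take W = |q|^2. As q is Lipschitz and vanishes at the atoms, W <= L^2 |z - zeta_n|^2 for each
    atom, so the trace is at most 8 L^2 times the sum of the masses. *)
Lemma atomic_compact : (forall n, 0 < r n -> polyval q (expi (theta n)) = 0) ->
  compact_op K T.
Proof.
move=> qz; have [L [M [L0 M0 hM hL]]] := polyval_lipschitz q.
have sM t : cmod (symbol q t) <= M by apply: hM; rewrite cmod_expi.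
have [_ cr _ _] := hu; have [S [S0 hS]] := series_bounded r0 cr.
apply: (toeplitz_compact uv M0 (cmeas_symbol q) sM) => eps eps0.
pose W t := cmod (symbol q t) ^+ 2.
have W0 t : 0 <= W t by exact: sqr_ge0.
have WM t : W t <= M ^+ 2 by rewrite ler_pXn2r// ?nnegrE ?cmod_ge0.
exists W, (M ^+ 2), (4 * L ^+ 2 * 2 * S); split.
- by apply: cmeas_cmod2; exact: cmeas_symbol.
- by move=> t; rewrite W0 WM.
- by move=> t; have := W0 t; rewrite /W; have := eps0; lra.
apply: (@trace_bound _ _ _ uv W (M ^+ 2) (L ^+ 2) _ (fun n => expi (theta n))
  (fun n => 2 * r n) (fun=> 0)) => //.
- by apply: cmeas_cmod2; exact: cmeas_symbol.
- by move=> n; rewrite cmod_expi.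
- by move=> n; rewrite mulr_ge0.
- exact: sqr_ge0.
- move=> n t; rewrite pmulr_rgt0// => /qz qn; rewrite add0r /W -exprMn.
  rewrite ler_pXn2r// ?nnegrE ?cmod_ge0 ?mulr_ge0 ?cmod_ge0//.
  have := hL (expi t) (expi (theta n)); rewrite qn subr0 !cmod_expi.
  by apply.
- by move=> n; rewrite !mul0r.
- move=> w w1; have [h [ch uw]] := atomic_series w1; have d0 := sq_lt1 w1.
  apply: (@le_trans _ _ (2 * h / (1 - cmod w ^+ 2))%:E).
    rewrite lee_fin ler_wpM2r ?invr_ge0 ?(ltW d0)// uw.
    exact: one_minus_expR2.
  apply: lee_nneseries_lim; first by move=> n; rewrite divr_ge0 ?sqr_ge0// mulr_ge0.
  rewrite [X in _ --> X](_ : _ = 2 / (1 - cmod w ^+ 2) * h); last by rewrite mulrAC.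
  apply: cvg_trans (cvgM (cvg_cst (2 / (1 - cmod w ^+ 2))) ch).
  apply: near_eq_cvg; apply: nearW => n /=.
  rewrite /GRing.mul_fun /= mulr_sumr; apply: eq_bigr => k _.
  have Xn : cmod (1 - conjc (expi (theta k)) * w) != 0.
    by rewrite -cmod_expi_sub' gt_eqF// cmod_expi_sub.
  have Dn := gt_eqF d0; rewrite cmod_expi_sub'; field.
  by rewrite Xn Dn.
- apply: nneseries_le_bound => [n|n]; first by rewrite add0r !mulr_ge0 ?sqr_ge0.
  rewrite (eq_bigr (fun k => 4 * L ^+ 2 * 2 * r k)); last first.
    by move=> k _; rewrite add0r; ring.
  by rewrite -mulr_sumr ler_wpM2l// !mulr_ge0// sqr_ge0.
Qed.

(** At distance x from the origin on the radius to the atom, its Poisson kernel is (1 + x) / (1 - x)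
    >= 1, so that one term already gives |u| <= exp(- r n). *)
Lemma atomic_compact_zero n : compact_op K T -> 0 < r n ->
  polyval q (expi (theta n)) = 0.
Proof.
move=> cT rn; apply: (compact_symbol_zero (c := expR (- r n)) cT).
- by rewrite expR_lt1 oppr_lt0.
- by rewrite cmod_expi.
move=> d d0; pose x := Num.max (1 - d / 2) (1 / 2).
have [x0 x1 xd] : [/\ 0 < x, x < 1 & 1 - x < d].
  have xa : 1 - d / 2 <= x by rewrite le_max lexx.
  have xb : 1 / 2 <= x by rewrite le_max lexx orbT.
  have xc : x < 1 by rewrite gt_max; apply/andP; split; lra.
  by split=> //; lra.
pose w := x%:C%C * expi (theta n).
have cw : cmod w = x by rewrite cmodM cmod_expi mulr1 cmod_real gtr0_norm.
have dist : cmod (expi (theta n) - w) = 1 - x.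
  have -> : expi (theta n) - w = (1 - x)%:C%C * expi (theta n).
    by rewrite rmorphB /= mulrBl mul1r.
  by rewrite cmodM cmod_expi mulr1 cmod_real gtr0_norm// subr_gt0.
have w1 : cmod w < 1 by rewrite cw.
clearbody w; exists w; rewrite cw dist; split=> //; first lra.
have [h [ch ->]] := atomic_series w1.
rewrite ler_expR lerN2; apply: (rcvg_le (cvg_cst (r n)) ch).
exists n.+1 => // N /= nN.
rewrite big_mkord (bigD1 (Ordinal nN))//= -[leLHS]addr0 lerD//; last first.
  rewrite sumr_ge0// => i _; apply: mulr_ge0 => //; apply: divr_ge0.
    exact/ltW/sq_lt1.
  exact: sqr_ge0.
rewrite dist cw ler_peMr//.
have p : 0 < (1 - x) ^+ 2 by rewrite exprn_gt0// subr_gt0.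
rewrite ler_pdivlMr// mul1r; nra.
Qed.

(** Infinitely many atoms are essential here: for the single atom u = exp(-(1 + z) / (1 - z)) and q
    = z - 1 the operator is compact but not 0. Distinctness of the atoms turns infinitely many
    indices into infinitely many zeros of q, through a left inverse [g] of the parametrization. *)
Lemma atomic_zero : infinite_set [set n | 0 < r n] -> compact_op K T -> zero_op K T.
Proof.
move=> ir cT; have [_ _ inj _] := hu.
apply: (@zero_of_infinite_circle_zeros ((fun n => expi (theta n)) @` [set n | 0 < r n])).
  pose g z := xget 0%N [set n | 0 < r n /\ expi (theta n) = z].
  move=> /(finite_image g) fin; apply: ir; apply: sub_finite_set fin => n rn.
  exists (expi (theta n)); first by exists n.
  by rewrite /g; case: xgetP => [m _ [rm] /inj|/(_ n)/(_ (conj rn erefl))//]; exact.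
by move=> _ [n rn <-]; rewrite cmod_expi atomic_compact_zero.
Qed.

End Atomic.

(** * The angular parametrization of the circle *)

Section Circle.
Variable R : realType.

Lemma dist_cos_sin (a b : R) : `|cos a - cos b| <= `|a - b| /\ `|sin a - sin b| <= `|a - b|.
Proof.
wlog ab : a b / b <= a.
  move=> h; have [/h//|/ltW/h] := leP b a.
  by rewrite (distrC (cos b)) (distrC (sin b)) (distrC b).
have lip (f g : R -> R) : (forall x, is_derive x (1 : R) f (g x)) ->
    (forall x, `|g x| <= 1) -> `|f a - f b| <= `|a - b|.
  move=> df g1; have cf : continuous f.
    by move=> x; apply/differentiable_continuous/derivable1_diffP; have [] := df x.
  have [c _ ->] := MVT_segment ab (fun x _ => df x) (continuous_subspaceT cf).
  by rewrite normrM ler_piMl.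
split; first apply: (lip cos (fun x => - sin x)) => x.
- by rewrite normrN ler_norml sin_geN1 sin_le1.
- by apply: (lip sin cos) => x; rewrite ler_norml cos_geN1 cos_le1.
Qed.

Lemma cmod_expiB (a b : R) : cmod (expi a - expi b) <= 2 * `|a - b|.
Proof.
apply: (le_trans (cmod_le_ReIm _)); have [] := dist_cos_sin a b.
by rewrite ReD ReN ImD ImN /=; lra.
Qed.

(** Equality of the points gives cos (a - b) = 1, hence sin ((a - b) / 2) = 0; but for a > b the
    half difference lies strictly between 0 and pi. *)
Lemma expi_inj (a b : R) : `|a - b| < 2 * pi -> expi a = expi b -> a = b.
Proof.
wlog ab : a b / b <= a.
  move=> h; have [/h//|/ltW ba] := leP b a.
  by rewrite distrC => d /esym eab; apply/esym; exact: h.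
rewrite ger0_norm ?subr_ge0// => ab2 [ec es].
apply/eqP; rewrite -subr_eq0; apply/negPn/negP => ne.
have ab0 : 0 < a - b by rewrite lt_neqAle eq_sym ne subr_ge0.
have : 0 < sin ((a - b) / 2).
  by apply: sin_gt0_pi; apply/andP; split; lra.
have : sin ((a - b) / 2) ^+ 2 = 0.
  have c1 : cos (a - b) = 1.
    by rewrite cosD cosN sinN ec es mulrN opprK -!expr2 cos2Dsin2.
  have := cos2Dsin2 ((a - b) / 2); have := cosD ((a - b) / 2) ((a - b) / 2).
  rewrite -splitr c1 -!expr2; lra.
by move/eqP; rewrite sqrf_eq0 => /eqP ->; rewrite ltxx.
Qed.

End Circle.

(** * Support and local density of finite measures *)

Section Atomless.
Variables (R : realType) (sigma : {finite_measure set (measurableTypeR R) -> \bar R}).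
Local Notation mu := (@lebesgue_measure R).

Lemma countable_negligible (D : set (measurableTypeR R)) :
  (forall t : R, sigma [set t] = 0%E) -> countable D -> sigma.-negligible D.
Proof.
move=> s0 /countable_injP[f injf].
apply: (@negligibleS _ _ _ _ (\bigcup_n [set x | D x /\ f x = n])).
  by move=> x Dx; exists (f x).
apply: negligible_bigcup => n.
have m1 (x : R) : sigma.-negligible [set x].
  by exists [set x]; split=> //; exact: measurable_set1.
have [[x [Dx fx]]|h] := pselect (exists x, D x /\ f x = n).
  apply: negligibleS (m1 x) => y [Dy fy]; apply: injf; rewrite ?inE//.
  by rewrite fx.
apply: negligibleS (m1 0) => y hy; case: h; exists y; exact: hy.
Qed.

Definition angle_support : set (measurableTypeR R) :=
  [set t : R | forall U : set R, open U -> U t -> (0 < sigma U)%E].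

(** The complement of the support is covered by the countably many null intervals with rational
    endpoints, enumerated by [unpickle]. *)
Lemma off_support_negligible : sigma.-negligible (~` angle_support).
Proof.
pose J (p : rat * rat) : set (measurableTypeR R) := `]ratr p.1, ratr p.2[%classic.
pose F n : set (measurableTypeR R) := if @unpickle (rat * rat)%type n is Some p then
  (if sigma (J p) == 0%E then J p else set0) else set0.
apply: (@negligibleS _ _ _ _ (\bigcup_n F n)).
  move=> t /existsNP[U /not_implyP[oU /not_implyP[Ut sU]]].
  have /nbhs_ballP[e /= e0 eU] : nbhs t U by exact: open_nbhs_nbhs.
  have te : t - e < t by rewrite ltrBlDr ltrDl.
  have et : t < t + e by rewrite ltrDl.
  have [a] := rat_in_itvoo te; have [b] := rat_in_itvoo et.
  rewrite !in_itv /= => /andP[tb be] /andP[ea at'].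
  exists (pickle (a, b)); [exact: I|rewrite /F pickleK].
  suff -> : sigma (J (a, b)) = 0%E by rewrite eqxx /J /= in_itv /= at' tb.
  apply/eqP; rewrite eq_le measure_ge0 andbT.
  have : (sigma U <= 0)%E by rewrite leNgt; apply/negP.
  apply: le_trans; apply: le_measure.
  - by apply: mem_set; exact: measurable_itv.
  - by apply: mem_set; exact: open_measurable.
  move=> x; rewrite /J /= in_itv /= => /andP[ax xb]; apply: eU.
  rewrite /ball /= ltr_distlC; apply/andP; split; [exact: lt_trans ax|exact: lt_trans be].
apply: negligible_bigcup => n; rewrite /F; case: unpickle => [p|]; last exact: negligible_set0.
case: ifPn => [/eqP h|_]; last exact: negligible_set0.
by exists (J p); split=> //; exact: measurable_itv.
Qed.

(* Cover the null set by half-open intervals of small total length. *)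
Lemma null_of_density (I N : set R) (C : R) : 0 <= C ->
  measurable (I : set (measurableTypeR R)) -> measurable (N : set (measurableTypeR R)) ->
  mu N = 0%E ->
  (forall a b, a < b -> (sigma (I `&` `]a, b]) <= (C * (b - a))%:E)%E) ->
  sigma (I `&` N) = 0%E.
Proof.
move=> C0 mI mN N0 hC; apply/eqP; rewrite eq_le measure_ge0 andbT.
apply/lee_addgt0Pr => e e0; rewrite add0e.
have C1 : 0 < C + 1 by rewrite ltr_wpDl.
have d0 : 0 < e / (C + 1) by rewrite divr_gt0.
have : (mu N < (e / (C + 1))%:E)%E by rewrite N0 lte_fin.
move=> /ereal_inf_lt[z [/= M' [mM cov] sMz zDe]].
have mM' n : measurable (M' n : set (measurableTypeR R)).
  by apply: sub_sigma_algebra; exact: mM.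
apply: (@le_trans _ _ (\sum_(0 <= n <oo) sigma (I `&` M' n))%E).
  apply: measure_sigma_subadditive => //.
  - by move=> n; exact: measurableI.
  - exact: measurableI.
  by rewrite -setI_bigcupr; apply: setIS.
apply: (@le_trans _ _ (\sum_(0 <= n <oo) ((C + 1)%:E * wlength idfun (M' n)))%E).
  apply: lee_nneseries => // n _.
  have /ocitvP[->|[[a b] /= ab ->]] := mM n.
    by rewrite setI0 measure0 wlength0 mule0.
  apply: le_trans (hC a b ab) _.
  have -> : wlength idfun `]a, b] = (b - a)%:E by rewrite wlength_itv /= lte_fin ab.
  by rewrite -EFinM lee_fin ler_wpM2r ?subr_ge0 ?(ltW ab)// lerDl ler01.
rewrite nneseriesZl => [|i _]; last exact: wlength_ge0.
rewrite sMz.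
have -> : e%:E = ((C + 1)%:E * (e / (C + 1))%:E)%E.
  by rewrite -EFinM mulrC divfK// gt_eqF.
by rewrite lee_pmul2l ?lte_fin// ltW.
Qed.

End Atomless.

(** * Continuous singular inner functions *)

Section ContinuousSingular.
Variable R : realType.
Local Notation A := (@angles R : set (measurableTypeR R)).
Local Notation HI := (L2_semi_ip R).
Implicit Types (f g h : R -> R[i]) (w z : R[i]).
Lemma H2_ext_eq0 f : H2 f -> (forall w, cmod w < 1 -> ext f w = 0) -> norm2 f = 0.
Proof.
move=> Hf ext0; have /H2P[a ha] := Hf.
have cv := h2coef_dil_cvg (fun w => ext_series ha) ha.
suff cf : (fun r : R => norm2 ((fun t : R => ext f (r%:C%C * expi t)) - f)) @ 1^'- --> norm2 f.
  exact: rcvg_unique cf cv.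
have cc : (fun _ : R => norm2 f) @ 1^'- --> norm2 f by exact: cvg_cst.
apply: cvg_trans cc; apply: near_eq_cvg.
apply: near_left1 => r r01.
transitivity (norm2 (fun t => - f t)).
  by rewrite !norm2E (nrmN HI)//; exact: H2_L2.
congr norm2; apply/funext => t.
rewrite [RHS](_ : _ = ext f (r%:C%C * expi t) - f t)// ext0 ?sub0r//.
exact: cmod_dil_lt1.
Qed.

Variables (u : R[i] -> R[i]) (v : R -> R[i]).
Hypothesis uv : is_inner u v.
Let K := model_space u.

(** The reproducing kernels have norm 0 when |u| = 1 in the disk, so every function of the model
    space is null. This disposes of sigma = 0. *)
Lemma zero_op_unimodular T : (forall f, K f -> K (T f)) ->
  (forall w, cmod w < 1 -> cmod (u w) = 1) -> zero_op K T.
Proof.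
move=> KT u1 f /KT; move: (T f) => {}f Kf.
apply/(norm2_eq0 (model_L2 Kf)); apply: (H2_ext_eq0 (model_H2 Kf)) => w w1.
rewrite -(ker_repr uv w1 Kf); apply/eqP; rewrite -cmod_eq0 eq_le cmod_ge0 andbT.
have := cmod_inner_le (model_L2 Kf) (model_L2 (ker_model uv w1)).
have /eqP : norm2 (ker u v w) ^+ 2 = 0 by rewrite norm2_ker// u1// expr1n subrr mul0r.
by rewrite sqrf_eq0 => /eqP ->; rewrite mulr0.
Qed.

Variable sigma : {finite_measure set (measurableTypeR R) -> \bar R}.
Hypothesis hu : continuous_singular_inner u sigma.

Let P w (t : R) : R := (1 - cmod w ^+ 2) / cmod (expi t - w) ^+ 2.

Lemma cs_modulus w : cmod w < 1 -> cmod (u w) = expR (- Rintegral sigma A (P w)).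
Proof.
move=> w1; have [_ _ _ /(_ w w1) ->] := hu.
rewrite cmod_cexp ReN; congr (expR (- _)); apply: eq_Rintegral => t _.
rewrite Re_herglotz ?cmod_expi ?expr1n//.
by rewrite -subr_eq0 -cmod_gt0 cmod_expi_sub.
Qed.

Let P_ge0 w t : cmod w < 1 -> 0 <= P w t.
Proof. by move=> w1; rewrite divr_ge0 ?sqr_ge0// ltW// sq_lt1. Qed.

Let PE w t : P w t = (1 - cmod w ^+ 2) * cmod (szego w t) ^+ 2.
Proof. by rewrite /P /szego dist_expi cmodV exprVn. Qed.

Let mP w : cmod w < 1 -> measurable_fun A (fun t => (P w t)%:E).
Proof.
move=> w1; apply/measurable_EFinP.
rewrite (_ : P w = (fun t => (1 - cmod w ^+ 2) * cmod (szego w t) ^+ 2)); last first.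
  by apply/funext => t; exact: PE.
by apply: measurable_funM => //; apply: cmeas_cmod2; exact: cmeas_szego.
Qed.

Let P_fin w : cmod w < 1 -> (\int[sigma]_(t in A) (P w t)%:E < +oo)%E.
Proof.
move=> w1; pose M := (1 - cmod w ^+ 2) * (1 - cmod w)^-1 ^+ 2.
apply: (@le_lt_trans _ _ (\int[sigma]_(t in A) (cst M%:E t))%E).
  apply: ge0_le_integral => //.
  - by move=> t _; rewrite lee_fin P_ge0.
  - exact: mP.
  move=> t _; rewrite lee_fin PE ler_wpM2l ?(ltW (sq_lt1 w1))//.
  by rewrite ler_pXn2r ?nnegrE ?cmod_ge0 ?invr_ge0 ?subr_ge0 ?(ltW w1)// cmod_szego_le.
rewrite integral_cst//.
apply: lte_mul_pinfty => //.
  by rewrite lee_fin mulr_ge0 ?sqr_ge0// ltW// sq_lt1.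
by rewrite ltey_eq; apply/orP; left; exact: (fin_num_measure sigma _ (@measurable_angles R)).
Qed.

Lemma cs_local_bound w (I : set (measurableTypeR R)) (c : R) : cmod w < 1 -> measurable I ->
  0 <= c -> (forall t, I t -> c <= P w t) ->
  (c%:E * sigma I <= (Rintegral sigma A (P w))%:E)%E.
Proof.
move=> w1 mI c0 hc; have [sA _ _ _] := hu.
have mIA : measurable (I `&` A) by exact: measurableI.
have -> : sigma I = sigma (I `&` A).
  rewrite (measureDI sigma mI (@measurable_angles R)) [X in (X + _)%E](_ : _ = 0%E) ?add0e//.
  apply/eqP; rewrite eq_le measure_ge0 andbT -sA; apply: le_measure.
  - by apply: mem_set; exact: measurableD.
  - by apply: mem_set; exact: measurableC.
  - by move=> x [].
rewrite -(integral_cst sigma mIA).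
rewrite /Rintegral fineK; last first.
  rewrite ge0_fin_numE; first exact: P_fin.
  by apply: integral_ge0 => t _; rewrite lee_fin P_ge0.
apply: (@le_trans _ _ (\int[sigma]_(t in I `&` A) (P w t)%:E)%E).
  apply: ge0_le_integral => //.
  - by apply: measurable_funS (mP w1) => //; exact: subIsetr.
  - by move=> t [It _]; rewrite lee_fin hc.
apply: ge0_subset_integral => //; first exact: mP.
by move=> t _; rewrite lee_fin P_ge0.
Qed.

Variable q : {poly {poly R[i]}}.
Let T := toeplitz u (symbol q).

(** Otherwise |u| > exp(-1) at all points of the disk close enough to z, so the Poisson integrals of
    sigma are at most 1 there. Testing at (1 - x) e^(is) bounds the mass of [s - x, s + x] by 9 x,
    so near the angle of z sigma has a density bounded by a constant. Being singular, it vanishes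
    there, against the choice of z in the support. *)
Lemma cs_compact_zero z : compact_op K T -> circle_support sigma z -> polyval q z = 0.
Proof.
move=> cT [tau supp <-{z}].
apply: (compact_symbol_zero (c := expR (- 1)) uv cT).
- by rewrite expR_lt1 oppr_lt0.
- by rewrite cmod_expi.
move=> d d0; apply: contrapT => hd.
have J1 w : 1 - d < cmod w -> cmod w < 1 -> cmod (expi tau - w) < d ->
    Rintegral sigma A (P w) <= 1.
  move=> wd w1 tw; rewrite leNgt; apply/negP => J1; apply: hd.
  by exists w; split=> //; rewrite cs_modulus// ler_expR lerN2 ltW.
pose eta := Num.min (d / 4) (1 / 2).
have [eta0 etad eta1] : [/\ 0 < eta, eta <= d / 4 & eta <= 1 / 2].
  by rewrite lt_min !divr_gt0// !ge_min !lexx ?orbT.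
clearbody eta.
have [_ _ [N [mN N0 sN]] _] := hu.
pose Icc (a b : R) : set (measurableTypeR R) := `[a, b]%classic.
have mIcc a b : measurable (Icc a b) by exact: measurable_itv.
have dens (s x : R) : `|s - tau| < eta -> 0 < x < eta ->
    (sigma (Icc (s - x)%R (s + x)%R) <= (9 * x)%:E)%E.
  move=> st /andP[x0 xe]; pose w := (1 - x)%:C%C * expi s.
  have cw : cmod w = 1 - x.
    by rewrite cmodM cmod_expi mulr1 cmod_real ger0_norm//; lra.
  have dist t : cmod (expi t - w) <= 2 * `|t - s| + x.
    have -> : expi t - w = (expi t - expi s) + x%:C%C * expi s.
      by rewrite /w rmorphB /= mulrBl mul1r opprB addrA addrAC.
    apply: le_trans (cmodD _ _) _; rewrite cmodM cmod_expi mulr1 cmod_real gtr0_norm//.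
    by rewrite lerD2r cmod_expiB.
  have w1 : cmod w < 1 by rewrite cw; lra.
  have wd : cmod (expi tau - w) < d.
    by apply: le_lt_trans (dist _) _; rewrite distrC; lra.
  have Jw : Rintegral sigma A (P w) <= 1 by apply: J1 => //; rewrite cw; lra.
  have x9 : 0 < 9 * x by rewrite mulr_gt0.
  have : ((9 * x)^-1%:E * sigma (Icc (s - x)%R (s + x)%R) <= (Rintegral sigma A (P w))%:E)%E.
    apply: cs_local_bound => //; first by rewrite invr_ge0 ltW.
    move=> t; rewrite /Icc /= in_itv /= => /andP[t1 t2].
    have ts : `|t - s| <= x by rewrite ler_distlC; apply/andP; split; lra.
    have := dist t; have p := cmod_expi_sub t w1; clearbody w.
    rewrite /P cw; move: (cmod _) p => D p hD.
    (* With 1 - (1 - x)^2 = x (2 - x) >= x this makes the Poisson kernel at least 1 / (9 x) on the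
       interval. *)
    have D3 : D <= 3 * x by lra.
    rewrite ler_pdivlMr ?exprn_gt0// ler_pdivrMl//.
    nra.
  have /fineK <- := @fin_num_measure _ _ _ sigma (Icc (s - x)%R (s + x)%R) (mIcc _ _).
  rewrite -EFinM !lee_fin ler_pdivrMl// => h.
  by apply: (le_trans h); rewrite ler_piMr// ltW.
pose I : set (measurableTypeR R) := `]tau - eta / 2, tau + eta / 2[%classic.
have mI : measurable I by exact: measurable_itv.
have : (0 < sigma I)%E.
  apply: supp; first exact: interval_open.
  by rewrite /I /= in_itv /=; apply/andP; split; lra.
rewrite (measureDI sigma mI mN) [X in (_ + X)%E](_ : _ = 0%E); last first.
  have C0 : 0 <= 9 / 2 :> R by rewrite divr_ge0.
  apply: (null_of_density C0 mI mN N0) => a b ab.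
  (* The half-open interval is clipped to [I] and then seen as a closed interval about its midpoint
     with radius x = (b' - a') / 2, whence the constant 9 / 2. *)
  pose a' := Num.max a (tau - eta / 2); pose b' := Num.min b (tau + eta / 2).
  have [ba|ba] := leP b' a'.
    rewrite [X in sigma X](_ : _ = set0) ?measure0 ?lee_fin ?mulr_ge0 ?subr_ge0 ?(ltW ab)//.
    apply/seteqP; split=> // t [] /=; rewrite !in_itv /= => /andP[t1 t2] /andP[t3 t4].
    rewrite !bnd_simp in t1 t2.
    have : a' < t by rewrite gt_max t3 t1.
    have : t <= b' by rewrite le_min t4 (ltW t2).
    by move=> h1 h2; have := lt_le_trans h2 (le_trans h1 ba); rewrite ltxx.
  have [a1 a2 b1 b2] : [/\ a <= a', tau - eta / 2 <= a', b' <= b & b' <= tau + eta / 2].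
    by rewrite /a' /b' !le_max !ge_min !lexx !orbT.
  apply: (@le_trans _ _ (sigma (Icc ((a' + b') / 2 - (b' - a') / 2) ((a' + b') / 2 + (b' - a') / 2)))).
    apply: le_measure.
    - by apply: mem_set; apply: measurableI => //; exact: measurable_itv.
    - by apply: mem_set; exact: mIcc.
    move=> t []; rewrite /Icc /= !in_itv /= => /andP[t1 t2] /andP[t3 t4].
    rewrite !bnd_simp in t1 t2.
    have h1 : a' <= t by rewrite ge_max (ltW t1) (ltW t3).
    have h2 : t <= b' by rewrite le_min t4 (ltW t2).
    by apply/andP; split; lra.
  clearbody a' b'.
  apply: le_trans (dens _ _ _ _) _.
  - by rewrite ltr_distlC; apply/andP; split; lra.
  - by apply/andP; split; lra.
  by rewrite lee_fin; lra.
rewrite adde0 => hpos.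
have : (sigma (I `\` N) <= sigma (~` N))%E.
  apply: le_measure.
  - by apply: mem_set; exact: measurableD.
  - by apply: mem_set; exact: measurableC.
  - by move=> x [].
by rewrite sN leNgt hpos.
Qed.

(** An infinite support gives q = 0 on the circle. If the support is finite, sigma is carried by
    finitely many angles; having no atoms it is 0, so |u| = 1 in the disk. *)
Lemma cs_zero : (forall z, circle_support sigma z -> polyval q z = 0) -> zero_op K T.
Proof.
move=> hz; have [fin|inf] := pselect (finite_set (circle_support sigma)); last first.
  apply: (zero_of_infinite_circle_zeros uv inf) => z sz; split; last exact: hz.
  by have [t _ <-] := sz; rewrite cmod_expi.
have [sA s1 _ _] := hu.
have [L [M [_ M0 hM _]]] := polyval_lipschitz q.
apply: zero_op_unimodular.
  by move=> f; apply: (toeplitz_model uv (cmeas_symbol q) (C := M)) => t; apply: hM; rewrite cmod_expi.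
(* The right end is left out so that [expi] is injective on [D]; the angle 2 pi is added later as a
   single point. *)
pose D : set (measurableTypeR R) := angle_support sigma `&` `[0, 2 * pi[%classic.
have finD : finite_set D.
  pose g z : R := xget 0 (D `&` [set t : R | expi t = z]).
  apply: sub_finite_set (finite_image g fin) => t Dt.
  exists (expi t); first by case: Dt => st _; exists t.
  rewrite /g; case: xgetP => [s _ [[_ +] es]|/(_ t)]; last by case.
  have [_ +] := Dt; rewrite /= !in_itv /= => /andP[t1 t2] /andP[s3 s4].
  by apply: expi_inj es; rewrite ltr_distlC; apply/andP; split; lra.
have sA0 : sigma A = 0%E.
  apply: measure_negligible => //.
  apply: (@negligibleS _ _ _ _ ((~` angle_support sigma) `|` (D `|` [set 2 * pi]))).
    move=> t; rewrite /angles /= in_itv /= => /andP[t0]; rewrite le_eqVlt => /orP[/eqP ->|t2].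
      by right; right.
    have [st|st] := pselect (angle_support sigma t); last by left.
    by right; left; split=> //=; rewrite in_itv /= t0 t2.
  apply: negligibleU; first exact: off_support_negligible.
  apply: negligibleU; apply: countable_negligible => //; exact: finite_set_countable.
move=> w w1; rewrite cs_modulus// /Rintegral null_set_integral//; last exact: mP.
by rewrite /= oppr0 expR0.
Qed.

End ContinuousSingular.

(** * Blaschke products *)

Section Powers.
Variable R : realType.
Implicit Types (x y r p : R).

(** The graph of the r-th power lies above its tangent at [y]. In this arrangement it is Young's
    inequality with exponents r and r / (r - 1); the case r = 1, which has no finite conjugate
    exponent, is trivial. *)
Lemma powR_tangent r x y : 1 <= r -> 0 <= x -> 0 <= y ->
  r * (x * y `^ (r - 1)) <= x `^ r + (r - 1) * y `^ r.
Proof.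
rewrite le_eqVlt => /orP[/eqP <-|r1] x0 y0.
  by rewrite subrr powRr0 mul0r addr0 mul1r mulr1 powRr1.
have r0 : 0 < r by exact: lt_trans r1.
have s0 : 0 < r - 1 by rewrite subr_gt0.
have q0 : 0 < r / (r - 1) by rewrite divr_gt0.
have pq : r^-1 + (r / (r - 1))^-1 = 1.
  rewrite invfM invrK mulrC -[X in X + _](mul1r r^-1) -mulrDl addrC subrK mulfV//.
  by rewrite gt_eqF.
have := conjugate_powR x0 (powR_ge0 y (r - 1)) r0 q0 pq.
rewrite -powRrM mulrCA mulfV ?gt_eqF// mulr1.
rewrite -(ler_pM2l r0) mulrDr (mulrCA r (x `^ r)) mulfV ?gt_eqF// mulr1.
have -> : r * (y `^ r / (r / (r - 1))) = (r - 1) * y `^ r.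
  by field; rewrite !gt_eqF.
by [].
Qed.

Lemma powR_even (r x : R) : 0 <= x -> (x ^+ 2) `^ r = x `^ (2 * r).
Proof. by move=> x0; rewrite -powR_mulrn// -powRrM. Qed.

Lemma powR_le_sqr p x : 2 <= p -> 0 <= x <= 1 -> x `^ p <= x ^+ 2.
Proof.
move=> p2 /andP[x0 x1]; have [->|xn0] := eqVneq x 0.
  by rewrite powR0 ?expr0n// gt_eqF// (lt_le_trans _ p2).
rewrite -powR_mulrn//; by apply: ger_powR => //; rewrite x1 lt_neqAle eq_sym xn0 x0.
Qed.

Lemma powRD_le p x y : 0 <= p -> 0 <= x -> 0 <= y ->
  (x + y) `^ p <= 2 `^ p * (x `^ p + y `^ p).
Proof.
move=> p0; wlog xy : x y / y <= x.
  move=> h x0 y0; have [/h|/ltW/h] := leP y x; first exact.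
  by rewrite addrC (addrC (y `^ p)); exact.
move=> x0 y0; apply: (@le_trans _ _ ((2 * x) `^ p)).
  by apply: ge0_ler_powR => //; rewrite ?nnegrE ?addr_ge0 ?mulr_ge0//; lra.
by rewrite powRM// ler_wpM2l ?powR_ge0// lerDl powR_ge0.
Qed.

(** Sum the tangent inequalities at the point m, the weighted sum, with weights c_k. The tangent's
    constant term has a favourable sign, so a total weight of at most 1 is enough. *)
Lemma jensen_sum (n : nat) r (c x : nat -> R) : 1 <= r ->
  (forall k, 0 <= c k) -> (forall k, 0 <= x k) -> \sum_(k < n) c k <= 1 ->
  (\sum_(k < n) c k * x k) `^ r <= \sum_(k < n) c k * x k `^ r.
Proof.
move=> r1 c0 x0 c1; set m := \sum_(k < n) c k * x k.
have m0 : 0 <= m by apply: sumr_ge0 => k _; rewrite mulr_ge0.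
have r0 : 0 < r by exact: lt_le_trans r1.
have h : r * (m * m `^ (r - 1)) <= \sum_(k < n) c k * x k `^ r + (r - 1) * m `^ r.
  rewrite {1}/m mulr_suml mulr_sumr.
  apply: (@le_trans _ _ (\sum_(k < n) c k * (x k `^ r + (r - 1) * m `^ r))).
    apply: ler_sum => k _.
    by rewrite -mulrA mulrCA ler_wpM2l//; exact: powR_tangent.
  rewrite (eq_bigr (fun k : 'I_n => c k * x k `^ r + c k * ((r - 1) * m `^ r))).
    by rewrite big_split /= lerD2l -mulr_suml ler_piMl// mulr_ge0 ?powR_ge0// subr_ge0.
  by move=> k _; rewrite mulrDr.
have mr : m * m `^ (r - 1) = m `^ r.
  rewrite -{1}(powRr1 m0) -powRD ?(addrC 1) ?subrK//.
  by rewrite gt_eqF.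
by move: h; rewrite mr; lra.
Qed.

Lemma lp_seqP p (a : nat -> R) : lp_seq p a <->
  exists C, forall n, \sum_(k < n) `|a k| `^ p <= C.
Proof.
split=> [h|[C hC]].
  exists (fine (\sum_(0 <= n <oo) (`|a n| `^ p)%:E)%E) => n; rewrite -lee_fin fineK.
    rewrite -(big_mkord xpredT (fun k => `|a k| `^ p)) -sumEFin.
    by apply: nneseries_lim_ge => k _ _; rewrite lee_fin powR_ge0.
  rewrite ge0_fin_numE//; apply: nneseries_ge0 => k _ _; by rewrite lee_fin powR_ge0.
apply: (@le_lt_trans _ _ C%:E); last exact: ltry.
apply: nneseries_le_bound => [n|n]; first exact: powR_ge0.
by rewrite big_mkord.
Qed.

Lemma lp_seq_cvg0 p (a : nat -> R) : 0 < p -> lp_seq p a -> a @ \oo --> (0 : R).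
Proof.
move=> p0 /lp_seqP[C hC].
have cs : cvgn (series (fun k => `|a k| `^ p)).
  apply: nondecreasing_is_cvgn.
    by apply: nondecreasing_series => k _ _; exact: powR_ge0.
  by exists C => _ [n _ <-]; rewrite /series /= big_mkord.
have /cvgrPdist_lt h := cvg_series_cvg_0 cs.
apply/cvgrPdist_lt => e e0; have ep : 0 < e `^ p by exact: powR_gt0.
apply: filterS (h _ ep) => n; rewrite !sub0r !normrN => hn.
rewrite ltNge; apply/negP => en; move: hn; apply/negP; rewrite -leNgt.
rewrite ger0_norm ?powR_ge0//; apply: ge0_ler_powR => //; rewrite ?nnegrE ?ltW//.
Qed.

End Powers.

(** * Blaschke factors *)

Section BlaschkeFactor.
Variable R : realType.
Local Notation HI := (L2_semi_ip R).
Implicit Types (f g h : R -> R[i]) (a w z : R[i]).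

Lemma blaschke_self a : blaschke_factor a a = 0.
Proof. by rewrite /blaschke_factor; case: eqP => // _; rewrite subrr mul0r mulr0. Qed.

Lemma cmod_blaschke a w : cmod (blaschke_factor a w) = cmod (a - w) / cmod (1 - conjc a * w).
Proof.
rewrite /blaschke_factor; case: eqVneq => [->|a0].
  by rewrite conjc0 mul0r subr0 cmod1 divr1 sub0r cmodN.
rewrite !cmodM !cmodV cmod_real ger0_norm ?cmod_ge0// mulfV ?mul1r//.
by rewrite cmod_eq0.
Qed.

Lemma blaschke_defect a w : cmod a < 1 -> cmod w <= 1 ->
  1 - cmod (blaschke_factor a w) ^+ 2 =
  (1 - cmod a ^+ 2) * (1 - cmod w ^+ 2) / cmod (1 - conjc a * w) ^+ 2.
Proof.
move=> a1 w1; have d0 := disk_denom_gt0 a1 w1.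
have d2 : cmod (1 - conjc a * w) ^+ 2 != 0 by rewrite expf_neq0// gt_eqF.
rewrite cmod_blaschke exprMn exprVn.
apply: (mulIf d2); rewrite mulrBl mul1r !divfK//.
rewrite !cmod_sqrE; case: a w {a1 w1 d0 d2} => x y [s t] /=; ring.
Qed.

Lemma cmod_blaschke_le1 a w : cmod a < 1 -> cmod w <= 1 -> cmod (blaschke_factor a w) <= 1.
Proof.
move=> a1 w1; have := blaschke_defect a1 w1; have := cmod_ge0 (blaschke_factor a w).
have : 0 <= (1 - cmod a ^+ 2) * (1 - cmod w ^+ 2) / cmod (1 - conjc a * w) ^+ 2.
  by rewrite divr_ge0 ?sqr_ge0// mulr_ge0// subr_ge0 exprn_ile1 ?cmod_ge0// ltW.
nra.
Qed.

Lemma is_inner_ext F f : H2 f -> cmeas f -> (forall t, cmod (f t) = 1) ->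
  (forall w, cmod w < 1 -> cmod (F w) <= 1) ->
  (forall w, cmod w < 1 -> ext f w = F w) -> is_inner F f.
Proof.
move=> Hf mf f1 F1 fF; have [[[a ha] _] [Lf hb]] := H2_ext Hf.
split=> //.
  by exists a => w w1; rewrite -fF//; exact: ha.
split=> //; apply: cvg_trans hb; apply: near_eq_cvg; apply: near_left1 => r r01.
by apply: eq_integral => t _; rewrite fF//; exact: cmod_dil_lt1.
Qed.

Lemma h2coef_expi : h2coef (fun k => (k == 1)%N%:R) (@expi R).
Proof.
split.
  rewrite (_ : @expi R = @zpow R 1); last by apply/funext => t; rewrite /zpow expr1.
  exact: L2_zpow.
apply/cvgrPdist_lt => e e0; exists 2%N => // n /= n2.
rewrite (_ : tsum _ n - _ = 0); first by rewrite norm2E (nrm0 HI) subr0 normr0.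
apply/funext => t; rewrite fctE /tsum (bigD1 (Ordinal n2))//= mul1r expr1.
rewrite big1 ?addr0 ?subrr// => i ni.
by rewrite (_ : (i == 1 :> nat)%N = false) ?mul0r//; apply/negbTE.
Qed.

Lemma ext_expi w : cmod w < 1 -> ext (@expi R) w = w.
Proof.
move=> w1; suff cw : (fun n => \sum_(0 <= k < n) ((k == 1)%N%:R : R[i]) * w ^+ k) @ \oo --> (w : R[i]^o).
  exact: ccvg_unique (ext_series h2coef_expi w1) cw.
have cc : (fun _ : nat => w) @ \oo --> (w : R[i]^o) by exact: ccvg_cst.
apply: cvg_trans cc; apply: near_eq_cvg; exists 2%N => // n /= n2.
rewrite big_mkord (bigD1 (Ordinal n2))//= mul1r expr1.
rewrite big1 ?addr0// => i ni.
by rewrite (_ : (i == 1 :> nat)%N = false) ?mul0r//; apply/negbTE.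
Qed.

(** Partial fractions write the factor as a combination of the Szego kernels at [a] and at 0, which
    places it in [H2] with the expected extension. They divide by conj(a), so a = 0 is treated
    apart, through [expi]. *)
Lemma blaschke_inner a : cmod a < 1 ->
  is_inner (blaschke_factor a) (fun t => blaschke_factor a (expi t)).
Proof.
move=> a1.
have F1 w : cmod w < 1 -> cmod (blaschke_factor a w) <= 1.
  by move=> w1; rewrite cmod_blaschke_le1// ltW.
have f1 t : cmod (blaschke_factor a (expi t)) = 1.
  rewrite cmod_blaschke cmod_distC dist_expi mulfV//.
  by rewrite gt_eqF// disk_denom_gt0// cmod_expi.
have [a0|a0] := eqVneq a 0.
  have E w : blaschke_factor a w = w by rewrite /blaschke_factor a0 eqxx.
  have Ef : (fun t => blaschke_factor a (expi t)) = @expi R by apply/funext => t; rewrite E.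
  apply: is_inner_ext => //; rewrite ?Ef.
  - by apply/H2P; exists (fun k => (k == 1)%N%:R); exact: h2coef_expi.
  - exact: cmeas_expi.
  - by move=> w w1; rewrite ext_expi// E.
pose c : R[i] := (cmod a)%:C%C / a.
have ca0 : conjc a != 0 by rewrite conjc_eq0.
have z1 : cmod (0 : R[i]) < 1 by rewrite cmod0.
have Sa := H2_szego a1; have S0 := H2_szego z1.
have HS := H2_subspace R.
have pt (x : R[i]) : 1 - conjc a * x != 0 ->
    blaschke_factor a x = (c * (a - (conjc a)^-1)) * (1 - conjc a * x)^-1 +
      c * (conjc a)^-1 * (1 - conjc 0 * x)^-1.
  move=> d0; rewrite /blaschke_factor (negbTE a0) -/c conjc0 mul0r subr0 invr1 mulr1.
  by field; rewrite ca0 d0.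
have dn x : cmod x <= 1 -> 1 - conjc a * x != 0.
  by move=> x1; rewrite -cmod_gt0 disk_denom_gt0.
have Ef : (fun t => blaschke_factor a (expi t)) =
    (fun t => (c * (a - (conjc a)^-1)) * szego a t) + (fun t => (c * (conjc a)^-1) * szego 0 t).
  by apply/funext => t; rewrite pt// dn// cmod_expi.
have HZ1 : H2 (fun t => (c * (a - (conjc a)^-1)) * szego a t) by exact: (subZ HS).
have HZ2 : H2 (fun t => (c * (conjc a)^-1) * szego 0 t) by exact: (subZ HS).
apply: (is_inner_ext _ _ f1 F1).
- by rewrite Ef; exact: (subD HS).
- rewrite Ef; apply: cmeasD; apply: cmeasM; try exact: cmeas_cst.
    exact: cmeas_szego.
  exact: cmeas_szego.
- move=> w w1; rewrite Ef /ext.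
  have Lw := L2_szego w1.
  have -> := ipDl HI (H2_L2 HZ1) (H2_L2 HZ2) Lw.
  have -> := ipZl HI (c * (a - (conjc a)^-1)) (H2_L2 Sa) Lw.
  have -> := ipZl HI (c * (conjc a)^-1) (H2_L2 S0) Lw.
  rewrite -!/(ext _ w) !ext_szego// -pt// dn//.
  exact: ltW.
Qed.

End BlaschkeFactor.

(** * The Malmquist-Takenaka system *)

Section MalmquistTakenaka.
Variable R : realType.
Local Notation HI := (L2_semi_ip R).
Implicit Types (f g h : R -> R[i]) (w : R[i]).
Variable z : nat -> R[i].
Hypothesis z1 : forall n, cmod (z n) < 1.

Definition bprod m n f : R -> R[i] :=
  fun t => \prod_(m <= k < n) blaschke_factor (z k) (expi t) * f t.

Lemma bprod_H2 m n f : H2 f -> H2 (bprod m n f) /\ forall w, cmod w < 1 ->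
  ext (bprod m n f) w = \prod_(m <= k < n) blaschke_factor (z k) w * ext f w.
Proof.
have triv g k : (k <= m)%N -> bprod m k g = g.
  by move=> km; apply/funext => t; rewrite /bprod big_geq// mul1r.
have trivw k w : (k <= m)%N -> \prod_(m <= j < k) blaschke_factor (z j) w = 1.
  by move=> km; rewrite big_geq.
elim: n f => [|n IH] f Hf.
  by rewrite triv//; split=> // w w1; rewrite trivw// mul1r.
have [mn|nm] := leqP m n; last first.
  by rewrite triv//; split=> // w w1; rewrite trivw// mul1r.
have [Hb eb] := inner_mul_H2 (blaschke_inner (z1 n)) Hf.
have E : bprod m n.+1 f = bprod m n (fun t => blaschke_factor (z n) (expi t) * f t).
  by apply/funext => t; rewrite /bprod big_nat_recr//= mulrA.
have [HB eB] := IH _ Hb; rewrite E; split=> // w w1; rewrite eB// eb// big_nat_recr//=.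
by rewrite mulrA.
Qed.

Lemma cmod_bprod_factor m n t : cmod (\prod_(m <= k < n) blaschke_factor (z k) (expi t)) = 1.
Proof.
rewrite cmod_prod big1// => k _.
exact: inner_unimod (blaschke_inner (z1 k)) t.
Qed.

Lemma inner_bprod m n f g : inner_prod (bprod m n f) (bprod m n g) = inner_prod f g.
Proof. by apply: inner_mul_unimod => t; exact: cmod_bprod_factor. Qed.

Lemma bprod_cat m n p f : (m <= n)%N -> (n <= p)%N -> bprod m p f = bprod m n (bprod n p f).
Proof.
move=> mn np; apply/funext => t.
by rewrite /bprod (big_cat_nat mn np)/= mulrA.
Qed.

(** Pairing with the Szego kernel evaluates at [z n], where the factor of index n vanishes. *)
Lemma inner_szego_bprod n p f : (n < p)%N -> H2 f ->
  inner_prod (szego (z n)) (bprod n p f) = 0.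
Proof.
move=> np Hf; have [HB eB] := bprod_H2 n p Hf.
rewrite (ipC HI (H2_L2 HB) (L2_szego (z1 n))) -/(ext _ _) eB//.
by rewrite big_ltn// blaschke_self !mul0r conjc0.
Qed.

(* The Malmquist-Takenaka basis. *)
Definition mtake n : R -> R[i] :=
  fun t => (Num.sqrt (1 - cmod (z n) ^+ 2))%:C%C * bprod 0 n (szego (z n)) t.

Let Hbs n : H2 (bprod 0 n (szego (z n))).
Proof. by have [] := bprod_H2 0 n (H2_szego (z1 n)). Qed.

Lemma mtake_H2 n : H2 (mtake n).
Proof. by apply: (subZ (H2_subspace R)); exact: Hbs. Qed.

Lemma inner_mtake_bprod n p f : (n < p)%N -> H2 f -> inner_prod (mtake n) (bprod 0 p f) = 0.
Proof.
move=> np Hf; have [HB _] := bprod_H2 0 p Hf.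
have -> := ipZl HI (Num.sqrt (1 - cmod (z n) ^+ 2))%:C%C (H2_L2 (Hbs n)) (H2_L2 HB).
by rewrite (@bprod_cat 0 n p)// ?(ltnW np)// inner_bprod inner_szego_bprod// mulr0.
Qed.

Lemma cmod_mtake n t :
  cmod (mtake n t) = Num.sqrt (1 - cmod (z n) ^+ 2) * cmod (szego (z n) t).
Proof.
by rewrite !cmodM cmod_bprod_factor mul1r cmod_real ger0_norm.
Qed.

Lemma norm2_mtake n : norm2 (mtake n) = 1.
Proof.
have -> : norm2 (mtake n) = norm2 (fun t => (Num.sqrt (1 - cmod (z n) ^+ 2))%:C%C * szego (z n) t).
  rewrite !norm2_mean; congr (Num.sqrt _); apply: mean_eq => t _.
  by rewrite cmod_mtake cmodM cmod_real ger0_norm.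
rewrite norm2E; have -> := nrmZ HI (Num.sqrt (1 - cmod (z n) ^+ 2))%:C%C (L2_szego (z1 n)).
rewrite -norm2E cmod_real ger0_norm ?sqrtr_ge0// mulrC.
exact: norm2_szego_sqrt.
Qed.

Lemma mtake_orthonormal (P : pred nat) :
  @orthonormal_on R (R -> R[i]^o) (@inner_prod R) P mtake.
Proof.
have lt m n : (m < n)%N -> inner_prod (mtake m) (mtake n) = 0.
  move=> mn; have Hs := H2_szego (z1 n).
  have -> := ipZr HI (Num.sqrt (1 - cmod (z n) ^+ 2))%:C%C (H2_L2 (mtake_H2 m)) (H2_L2 (Hbs n)).
  by rewrite inner_mtake_bprod// mulr0.
move=> m n _ _; have [mn|nm|<-] := ltngtP m n.
- exact: lt.
- by rewrite (ipC HI (H2_L2 (mtake_H2 n)) (H2_L2 (mtake_H2 m))) lt// conjc0.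
- by rewrite (ipff HI (H2_L2 (mtake_H2 m))) -norm2E norm2_mtake expr1n.
Qed.

(* [bprod 0 N G] is orthogonal to [mtake n] for [n < N] and tends weakly to
   [conj c * u * G]. *)
Lemma mtake_model u v : is_inner u v -> infinite_blaschke u z -> forall n, model_space u (mtake n).
Proof.
move=> uv [_ _ [c c1 hu]] n; apply/(model_spaceP uv); split; first exact: mtake_H2.
move=> G HG; have [U [UU oU]] := ultra_oo.
have [HvG evG] := inner_mul_H2 uv HG.
have HB N : H2 (bprod 0 N G) by have [] := bprod_H2 0 N HG.
have nB N : norm2 (bprod 0 N G) <= norm2 G.
  rewrite !norm2_mean; apply: ler_wsqrtr; rewrite le_eqVlt; apply/orP; left.
  apply/eqP/mean_eq => t _.
  by rewrite cmodM cmod_bprod_factor mul1r.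
have [l [Hl hl]] := H2_weakly_compact UU HB nB.
have el w : cmod w < 1 -> c * ext l w = u w * ext G w.
  move=> w1; have h1 : (fun N => ext (bprod 0 N G) w) @ U --> (ext l w : R[i]^o).
    exact: hl _ (H2_szego w1).
  have h2 : (fun N => c * ext (bprod 0 N G) w) @ U --> (u w * ext G w : R[i]^o).
    have cG : (fun _ : nat => ext G w) @ \oo --> (ext G w : R[i]^o) by exact: ccvg_cst.
    have h3 := ccvgM (hu w w1) cG.
    have h4 : (fun N => c * \prod_(0 <= k < N) blaschke_factor (z k) w * ext G w) @ U
      --> (u w * ext G w : R[i]^o) by move=> P /h3; exact: oU.
    apply: cvg_trans h4; apply: near_eq_cvg; apply: nearW => N.
    by have [_ ->] := bprod_H2 0 N HG; rewrite ?mulrA.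
  have cc : (fun _ : nat => c) @ U --> (c : R[i]^o) by exact: ccvg_cst.
  have h3 := ccvgM cc h1.
  have h5 : (fun N => c * ext (bprod 0 N G) w) @ U --> (c * ext l w : R[i]^o) by exact: h3.
  exact: ccvg_unique h5 h2.
have HS := H2_subspace R.
have d0 : norm2 ((fun t => c * l t) - (fun t => v t * G t)) = 0.
  apply: H2_ext_eq0.
    by apply: (subB HS) => //; exact: (subZ HS).
  move=> w w1; have Lw := L2_szego w1.
  rewrite /ext; have -> := ipBl HI (H2_L2 (subZ HS c Hl)) (H2_L2 HvG) Lw.
  have -> := ipZl HI c (H2_L2 Hl) Lw.
  by rewrite -!/(ext _ w) el// evG// subrr.
have l0 : inner_prod (mtake n) l = 0.
  have h0 : (fun N => inner_prod (bprod 0 N G) (mtake n)) @ U --> (0 : R[i]^o).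
    have cc : (fun _ : nat => 0 : R[i]) @ U --> (0 : R[i]^o) by exact: ccvg_cst.
    apply: cvg_trans cc; apply: near_eq_cvg; apply: oU; exists n.+1 => // N /= nN.
    by rewrite (ipC HI (H2_L2 (mtake_H2 n)) (H2_L2 (HB N))) inner_mtake_bprod// conjc0.
  have e0 := ccvg_unique (hl _ (mtake_H2 n)) h0.
  by rewrite (ipC HI (H2_L2 Hl) (H2_L2 (mtake_H2 n))) e0 conjc0.
have Lcl := H2_L2 (subZ HS c Hl); have Lm := H2_L2 (mtake_H2 n).
have LvG := H2_L2 HvG.
have := cmod_inner_le Lm (L2_sub Lcl LvG).
rewrite d0 mulr0; have -> := ipBr HI Lm Lcl LvG.
have -> := ipZr HI c Lm (H2_L2 Hl).
rewrite l0 mulr0 sub0r cmodN => h; apply/eqP.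
by rewrite -cmod_eq0 eq_le h cmod_ge0.
Qed.

End MalmquistTakenaka.

(** * Compactness for Blaschke products *)

Section BlaschkeCompact.
Variable R : realType.
Local Notation A := (@angles R : set (measurableTypeR R)).
Implicit Types (f g h : R -> R[i]) (w : R[i]).
Variables (u : R[i] -> R[i]) (v : R -> R[i]).
Hypothesis uv : is_inner u v.
Let K := model_space u.
Variable z : nat -> R[i].
Hypothesis hz : infinite_blaschke u z.

Let z1 n : cmod (z n) < 1. Proof. by have [] := hz. Qed.
Let m n : R := 1 - cmod (z n) ^+ 2.
Let m_gt0 n : 0 < m n. Proof. exact: sq_lt1. Qed.

Lemma one_sub_prod (a : nat -> R) n : (forall k, 0 <= a k <= 1) ->
  1 - \prod_(0 <= k < n) a k <= \sum_(0 <= k < n) (1 - a k).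
Proof.
move=> a01; suff : 0 <= \prod_(0 <= k < n) a k <= 1 /\
    1 - \prod_(0 <= k < n) a k <= \sum_(0 <= k < n) (1 - a k) by case.
elim: n => [|n [/andP[IH0 IH1] IH]].
  by rewrite !big_geq// ler01 lexx subrr.
rewrite !big_nat_recr//=; have /andP[a0 a1] := a01 n.
by split; [apply/andP; split|]; nra.
Qed.

Lemma blaschke_mass : exists S : R, 0 <= S /\ forall n, \sum_(0 <= k < n) m k <= S.
Proof.
have [_ cz _] := hz.
have zn n : 0 <= 1 - cmod (z n) by rewrite subr_ge0 ltW.
have [S [S0 hS]] := series_bounded zn cz.
exists (2 * S); split=> [|n]; first by rewrite mulr_ge0.
apply: (@le_trans _ _ (\sum_(0 <= k < n) 2 * (1 - cmod (z k)))).
  apply: ler_sum => k _; rewrite /m; have := z1 k; have := cmod_ge0 (z k); nra.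
by rewrite -mulr_sumr ler_wpM2l.
Qed.

(** 1 - prod_k |b_k|^2 <= sum_k (1 - |b_k|^2) for numbers |b_k| <= 1, and [blaschke_defect]
    evaluates each defect of a Blaschke factor. *)
Lemma blaschke_kernel_le w : cmod w < 1 ->
  (((1 - cmod (u w) ^+ 2) / (1 - cmod w ^+ 2))%:E <=
   \sum_(0 <= n <oo) (m n / cmod (1 - conjc (z n) * w) ^+ 2)%:E)%E.
Proof.
move=> w1; have d0 := sq_lt1 w1; have [_ _ [c c1 /(_ w w1) hu]] := hz.
pose x n := m n / cmod (1 - conjc (z n) * w) ^+ 2.
have x0 n : 0 <= x n by rewrite divr_ge0 ?sqr_ge0// ltW.
have h n : ((\sum_(0 <= k < n) x k)%:E <= \sum_(0 <= n <oo) (x n)%:E)%E.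
  by rewrite -sumEFin; apply: nneseries_lim_ge => k _ _; rewrite lee_fin.
have s0 : (0 <= \sum_(0 <= n <oo) (x n)%:E)%E.
  by apply: nneseries_ge0 => n _ _; rewrite lee_fin.
rewrite -/(x _).
case: (\sum_(0 <= n <oo) (x n)%:E)%E h s0 => [y h _|_ _|_]; [|exact: leey|by []].
rewrite lee_fin ler_pdivrMr//.
have h2 : (fun n => cmod (c * \prod_(0 <= k < n) blaschke_factor (z k) w)) @ \oo --> cmod (u w).
  exact: ccvg_cmod hu.
have h3 : (fun n => 1 - cmod (c * \prod_(0 <= k < n) blaschke_factor (z k) w) *
    cmod (c * \prod_(0 <= k < n) blaschke_factor (z k) w)) @ \oo --> 1 - cmod (u w) ^+ 2.
  by rewrite expr2; apply: cvgB; [exact: cvg_cst|exact: (cvgM h2 h2)].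
apply: (rcvg_le h3 (cvg_cst _)); apply: nearW => n.
rewrite cmodM c1 mul1r cmod_prod -expr2 -prodrXl.
apply: le_trans (one_sub_prod _ _) _.
  move=> k; rewrite sqr_ge0 exprn_ile1 ?cmod_ge0//.
  by rewrite cmod_blaschke_le1// ltW.
have := h n; rewrite lee_fin => /(ler_wpM2r (ltW d0)); apply: le_trans.
rewrite mulr_suml; apply: ler_sum => k _.
by rewrite blaschke_defect ?(ltW w1)// /x mulrAC.
Qed.

Lemma blaschke_trace (W : R -> R) (M B S SA : R) (a : nat -> R) :
  measurable_fun A W -> (forall t, 0 <= W t) -> (forall t, W t <= M) -> 0 <= B ->
  (forall n, 0 <= a n) ->
  (forall n t, W t <= a n + B * cmod (expi t - z n) ^+ 2) ->
  (forall n, \sum_(0 <= k < n) m k <= S) ->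
  (forall n, \sum_(0 <= k < n) a k <= SA) ->
  forall n (e : nat -> R -> R[i]),
    @finite_family R (R -> R[i]^o) (@inner_prod R) K n e ->
    \sum_(k < n) wmean W (e k) <= SA + 4 * B * S.
Proof.
move=> mW W0 WM B0 a0 Wa hS hSA.
apply: (@trace_bound _ _ _ uv W M B _ z m a) => //.
- by move=> n; exact: ltW.
- by move=> n; exact: ltW.
- exact: blaschke_kernel_le.
- apply: nneseries_le_bound => [n|n].
    by rewrite addr_ge0// !mulr_ge0// ltW.
  by rewrite big_split /= -mulr_sumr lerD// ler_wpM2l// mulr_ge0.
Qed.

Variable q : {poly {poly R[i]}}.
Let T := toeplitz u (symbol q).

(** The sum of |q(z_n)|^2 may diverge, so |q| is first lowered by d and truncated at 0. At the zeros
    with |q(z_n)| <= d, which are all but finitely many, the truncated weight is at most L^2 |z -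
    z_n|^2; only finitely many zeros need a positive a_n. *)
Lemma blaschke_compact :
  (fun n => cmod (polyval q (z n))) @ \oo --> (0 : R) -> compact_op K T.
Proof.
move=> q0; have [L [M [L0 M0 hM hL]]] := polyval_lipschitz q.
have sM t : cmod (symbol q t) <= M by apply: hM; rewrite cmod_expi.
have [S [S0 hS]] := blaschke_mass.
apply: (toeplitz_compact uv M0 (cmeas_symbol q) sM) => eps eps0.
(* From |q| <= V + d one gets |q|^2 <= 2 V^2 + 2 d^2, and 2 d^2 = eps. *)
pose d := Num.sqrt (eps / 2).
have d0 : 0 < d by rewrite sqrtr_gt0 divr_gt0.
have d2 : d ^+ 2 = eps / 2 by rewrite sqr_sqrtr// ltW// divr_gt0.
pose V t : R := Num.max (cmod (symbol q t) - d) 0.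
have V0 t : 0 <= V t by rewrite le_max lexx orbT.
have VM t : V t <= M.
  by rewrite ge_max M0 andbT lerBlDr (le_trans (sM t))// lerDl ltW.
pose W t := V t ^+ 2.
have mW : measurable_fun A W.
  apply: (@measurable_funX _ _ _ _ V 2).
  apply: (@measurable_maxr _ _ _ _ (fun t => cmod (symbol q t) - d) (fun=> 0)) => //.
  by apply: measurable_funB => //; apply: cmeas_cmod; exact: cmeas_symbol.
have [N _ hN] : \forall n \near \oo, cmod (polyval q (z n)) <= d.
  move/cvgrPdist_lt : q0 => /(_ d d0); apply: filterS => n.
  by rewrite sub0r normrN ger0_norm ?cmod_ge0// => /ltW.
pose a n : R := if (n < N)%N then M ^+ 2 else 0.
have a0 n : 0 <= a n by rewrite /a; case: ifP => // _; exact: sqr_ge0.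
have W0 t : 0 <= W t by exact: sqr_ge0.
have WM t : W t <= M ^+ 2 by rewrite ler_pXn2r ?nnegrE.
exists W, (M ^+ 2), (N%:R * M ^+ 2 + 4 * L ^+ 2 * S); split=> //.
- by move=> t; rewrite W0 WM.
- move=> t; have qV : cmod (symbol q t) <= V t + d by rewrite -lerBlDr le_max lexx.
  have c0 := cmod_ge0 (symbol q t); have v0 := V0 t.
  have h : cmod (symbol q t) ^+ 2 <= (V t + d) ^+ 2.
    by rewrite ler_pXn2r// nnegrE addr_ge0// ltW.
  have eE : eps = 2 * d ^+ 2 by rewrite d2 mulrC divfK.
  have := sqr_ge0 (V t - d); rewrite /W eE; move: h; rewrite !expr2; lra.
apply: (blaschke_trace (M := M ^+ 2) (a := a)) => //; first exact: sqr_ge0.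
- move=> n t; rewrite /a; case: ltnP => [nN|Nn].
    by apply: le_trans (WM t) _; rewrite lerDl mulr_ge0 ?sqr_ge0.
  rewrite add0r -exprMn ler_pXn2r ?nnegrE ?mulr_ge0 ?cmod_ge0//.
  rewrite ge_max mulr_ge0 ?cmod_ge0// andbT lerBlDr.
  have qz : cmod (polyval q (z n)) <= d := hN n Nn.
  have h : cmod (polyval q (expi t) - polyval q (z n)) <= L * cmod (expi t - z n).
    by apply: hL; [rewrite cmod_expi|exact: ltW].
  have := cmod_dist_le (polyval q (expi t)) (polyval q (z n)); rewrite /symbol; lra.
- move=> n; have M2 : 0 <= M ^+ 2 by exact: sqr_ge0.
  apply: (@le_trans _ _ ((minn n N)%:R * M ^+ 2)); last first.
    by rewrite ler_wpM2r// ler_nat geq_minr.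
  elim: n => [|n IH]; first by rewrite big_geq// min0n mul0r.
  rewrite big_nat_recr//= /a; case: ltnP => nN.
    by move: IH; rewrite (minn_idPl nN) (minn_idPl (ltnW nN)) mulrSr mulrDl mul1r lerD2r.
  by move: IH; rewrite addr0 (minn_idPr nN) (minn_idPr (leqW nN)).
Qed.

(** [u] vanishes at every [z n], so [compact_symbol_small] applies with c = 0, and |z n| tends to 1
    because the series of 1 - |z n| converges. *)
Lemma blaschke_compact_cvg0 : compact_op K T ->
  (fun n => cmod (polyval q (z n))) @ \oo --> (0 : R).
Proof.
move=> cT; have [_ cz [c c1 hu]] := hz.
have u0 n : u (z n) = 0.
  have cc : (fun _ : nat => 0 : R[i]) @ \oo --> (0 : R[i]^o) by exact: ccvg_cst.
  apply: ccvg_unique (hu _ (z1 n)) _.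
  apply: cvg_trans cc; apply: near_eq_cvg; exists n.+1 => // N /= nN.
  by rewrite big_mkord (bigD1 (Ordinal nN))//= blaschke_self mul0r mulr0.
apply/cvgrPdist_lt => e e0.
have [d d0 hd] := compact_symbol_small uv cT (ltr01 : 0 < 1 :> R) e0.
have /cvgrPdist_lt/(_ d d0) := cvg_series_cvg_0 cz; apply: filterS => n.
rewrite !sub0r !normrN !ger0_norm ?cmod_ge0 ?subr_ge0 ?(ltW (z1 n))// => zd.
apply: hd; last by rewrite u0 cmod0.
by rewrite z1 andbT; lra.
Qed.

End BlaschkeCompact.

(** * Schatten classes for Blaschke products *)

Section Schatten.
Variable R : realType.
Local Notation mu := (@lebesgue_measure R).
Local Notation A := (@angles R : set (measurableTypeR R)).
Local Notation HI := (L2_semi_ip R).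
Implicit Types (f g h : R -> R[i]) (w : R[i]).

Lemma eq2_norm2 f g : L2circle f -> L2circle g -> eq2 f g <-> norm2 (f - g) = 0.
Proof.
move=> Lf Lg; have Ld := L2_sub Lf Lg.
split=> [h|/(norm2_eq0 Ld) h].
  apply/(norm2_eq0 Ld).
  have h1 : {ae mu, forall t, A t -> f t = g t} := h.
  by apply: filterS h1 => t ft At; have := ft At; rewrite fctE => ->; rewrite subrr.
have h1 : {ae mu, forall t, A t -> (f - g) t = 0} := h.
by apply: filterS h1 => t ft At; have := ft At; rewrite fctE => /eqP; rewrite subr_eq0 => /eqP.
Qed.

(** Jensen's inequality for the probability measure |f|^2 dm: the tangent inequality at the mean of
    [W] is integrated. *)
Lemma jensen_wmean (W : R -> R) (M r : R) f : measurable_fun A W ->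
  (forall t, 0 <= W t) -> (forall t, W t <= M) -> 1 <= r -> L2circle f -> norm2 f = 1 ->
  wmean W f `^ r <= wmean (fun t => W t `^ r) f.
Proof.
move=> mW W0 WM r1 Lf f1.
have r0 : 0 < r by exact: lt_le_trans r1.
have mWr : measurable_fun A (fun t => W t `^ r).
  by apply: (measurableT_comp (measurable_powR r)).
have Wr0 t : 0 <= W t `^ r by exact: powR_ge0.
have M0 : 0 <= M := le_trans (W0 0) (WM 0).
have WrM t : W t `^ r <= M `^ r.
  by apply: ge0_ler_powR; rewrite ?nnegrE// ltW.
pose x := wmean W f.
have x0 : 0 <= x by exact: wmean_ge0.
have iW := mint_weight mW W0 WM Lf.
have iWr := mint_weight mWr Wr0 WrM Lf.
have /L2circleP[_ i2] := Lf.
have h : r * (x * x `^ (r - 1)) <= wmean (fun t => W t `^ r) f + (r - 1) * x `^ r.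
  have -> : r * (x * x `^ (r - 1)) =
      mean (fun t => (r * x `^ (r - 1)) * (W t * cmod (f t) ^+ 2)).
    by rewrite meanZ// -/(wmean W f) -/x; ring.
  have -> : (r - 1) * x `^ r = mean (fun t => ((r - 1) * x `^ r) * cmod (f t) ^+ 2).
    by rewrite meanZ// -norm2_sqr f1 expr1n mulr1.
  rewrite /wmean -meanD//; last exact: mintZ.
  apply: mean_le; [exact: mintZ| |].
    by apply: mintD => //; exact: mintZ.
  move=> t _; rewrite mulrA -mulrDl ler_wpM2r ?sqr_ge0//.
  by rewrite -mulrA (mulrC (x `^ _)); exact: powR_tangent.
have mr : x * x `^ (r - 1) = x `^ r.
  rewrite -{1}(powRr1 x0) -powRD ?(addrC 1) ?subrK//.
  by rewrite gt_eqF.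
by move: h; rewrite mr /x; lra.
Qed.

Variables (u : R[i] -> R[i]) (v : R -> R[i]).
Hypothesis uv : is_inner u v.
Let K := model_space u.
Variable z : nat -> R[i].
Hypothesis hz : infinite_blaschke u z.
Variable q : {poly {poly R[i]}}.
Let T := toeplitz u (symbol q).
Variable p : R.
Hypothesis p2 : 2 <= p.

Let z1 n : cmod (z n) < 1. Proof. by have [] := hz. Qed.
Let p0 : 0 < p. Proof. exact: lt_le_trans p2. Qed.
Let r1 : 1 <= p / 2. Proof. by have := p2; lra. Qed.
Let pE (x : R) : 0 <= x -> (x ^+ 2) `^ (p / 2) = x `^ p.
Proof. by move=> x0; rewrite powR_even// mulrC divfK. Qed.

Lemma blaschke_schatten :
  lp_seq p (fun n => cmod (polyval q (z n))) -> schatten p K T.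
Proof.
move=> qp; have cT : compact_op K T.
  by apply: (blaschke_compact uv hz); exact: lp_seq_cvg0 qp.
split=> //.
have [L [M [L0 M0 hM hL]]] := polyval_lipschitz q.
have sM t : cmod (symbol q t) <= M by apply: hM; rewrite cmod_expi.
have ms := cmeas_symbol q; have ms' := cmeas_conj ms.
have sM' t : cmod (conjc (symbol q t)) <= M by rewrite cmod_conj.
have HK := model_subspace uv.
have KT := toeplitz_model uv ms sM; have KS := toeplitz_model uv ms' sM'.
have TS := toeplitz_adjoint uv ms sM.
have TB f : K f -> @nrm R (R -> R[i]^o) (@inner_prod R) (T f) <=
    M * @nrm R (R -> R[i]^o) (@inner_prod R) f.
  by move=> Kf; rewrite -!norm2E; exact: (norm2_toeplitz_bound uv M0 ms sM).
have cT' : @compact_on R (R -> R[i]^o) (@inner_prod R) K T by apply/compact_opE.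
have [s [e [s0 smono Ke oe [se te ce]]]] :=
  singular_value_decomposition HI HK KT KS TS M0 TB cT'.
exists s.
  split=> //; exists (toeplitz u (fun t => conjc (symbol q t))), e; split=> //.
  - move=> n n0; have Kn := Ke n; have LST := model_L2 (KS _ (KT _ Kn)).
    apply/(eq2_norm2 LST); first exact: L2_scale (model_L2 Kn).
    by rewrite norm2E; exact: te.
  - move=> f Kf fe; have LST := model_L2 (KS _ (KT _ Kf)).
    by apply/(norm2_eq0 LST); rewrite norm2E; exact: ce.
have [C hC] := (proj1 (lp_seqP p _)) qp.
have [S [S0 hS]] := blaschke_mass hz.
pose W t := cmod (symbol q t) ^+ 2.
pose Wp t := cmod (symbol q t) `^ p.
have mW : measurable_fun A W by exact: cmeas_cmod2.
have W0 t : 0 <= W t by exact: sqr_ge0.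
have WM t : W t <= M ^+ 2 by rewrite ler_pXn2r ?nnegrE ?cmod_ge0.
have mWp : measurable_fun A Wp.
  by apply: (measurableT_comp (measurable_powR p)); exact: cmeas_cmod.
have Wp0 t : 0 <= Wp t by exact: powR_ge0.
have WpM t : Wp t <= M `^ p.
  by apply: ge0_ler_powR; rewrite ?nnegrE ?cmod_ge0// ltW.
pose a n := 2 `^ p * cmod (polyval q (z n)) `^ p.
(* |z - z_n|^p is at most 2^(p-2) |z - z_n|^2, since p >= 2 and two points of the closed disk are at
   distance at most 2. The factor 2^p comes from [powRD_le]. *)
pose B := 2 `^ p * (L `^ p * 2 `^ (p - 2)).
have B0 : 0 <= B by rewrite !mulr_ge0// powR_ge0.
have Wpa n t : Wp t <= a n + B * cmod (expi t - z n) ^+ 2.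
  have D0 := cmod_ge0 (expi t - z n).
  have h : cmod (symbol q t) <= cmod (polyval q (z n)) + L * cmod (expi t - z n).
    have := cmod_dist_le (polyval q (expi t)) (polyval q (z n)).
    have : cmod (polyval q (expi t) - polyval q (z n)) <= L * cmod (expi t - z n).
      by apply: hL; [rewrite cmod_expi|exact: ltW].
    by rewrite /symbol; lra.
  apply: (@le_trans _ _ ((cmod (polyval q (z n)) + L * cmod (expi t - z n)) `^ p)).
    apply: ge0_ler_powR => //; rewrite ?nnegrE ?cmod_ge0 ?(ltW p0)//.
    by rewrite addr_ge0 ?cmod_ge0// mulr_ge0.
  apply: le_trans (powRD_le (ltW p0) (cmod_ge0 _) (mulr_ge0 L0 D0)) _.
  rewrite mulrDr lerD2l powRM// /B -!mulrA !ler_wpM2l ?powR_ge0//.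
  have D2 : cmod (expi t - z n) <= 2.
    by rewrite (le_trans (cmodB _ _))// cmod_expi; have := ltW (z1 n); lra.
  have -> : cmod (expi t - z n) `^ p =
      cmod (expi t - z n) `^ (p - 2) * cmod (expi t - z n) ^+ 2.
    rewrite -(powR_mulrn 2 D0) -powRD ?subrK//.
    by rewrite gt_eqF.
  rewrite ler_wpM2r ?sqr_ge0//; apply: ge0_ler_powR; rewrite ?nnegrE ?subr_ge0//.
have asum n : \sum_(0 <= k < n) a k <= 2 `^ p * C.
  rewrite -mulr_sumr ler_wpM2l ?powR_ge0// big_mkord.
  apply: le_trans (hC n); apply: ler_sum => k _.
  by rewrite ger0_norm ?cmod_ge0.
have tr := blaschke_trace uv hz mWp Wp0 WpM B0 (fun n => mulr_ge0 (powR_ge0 _ _) (powR_ge0 _ _)) Wpa hS asum.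
apply/lp_seqP; exists (2 `^ p * C + 4 * B * S) => n.
(* The singular values decrease, so the positive ones occupy an initial segment, and only there is
   [e] known to be orthonormal. *)
have [N nN [sN0 sN]] : exists2 N, (N <= n)%N & (forall k, (k < N)%N -> 0 < s k) /\
    \sum_(k < n) `|s k| `^ p <= \sum_(k < N) `|s k| `^ p.
  elim: n => [|n [N nN [IH1 IH2]]]; first by exists 0%N; rewrite // !big_ord0.
  have [sn|sn] := leP (s n) 0.
    exists N; first exact: leqW.
    split=> //; rewrite big_ord_recr /=.
    have -> : s n = 0 by apply/eqP; rewrite eq_le sn s0.
    by rewrite normr0 powR0 ?addr0// gt_eqF.
  exists n.+1 => //; split=> // k; rewrite ltnS => kn.
  exact: lt_le_trans sn (smono _ _ kn).
apply: (le_trans sN).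
have fe : @finite_family R (R -> R[i]^o) (@inner_prod R) K N e.
  by split=> [k _|k l kN lN]; [exact: Ke|exact: oe (sN0 _ kN) (sN0 _ lN)].
apply: le_trans (tr N e fe); apply: ler_sum => k _.
have sk := sN0 k (ltn_ord k); have Kk := Ke k; have Lk := model_L2 Kk.
have k1 : norm2 (e k) = 1.
  apply/eqP; rewrite -(@eqrXn2 _ 2)// ?norm2_ge0// expr1n.
  have := oe k k sk sk; rewrite (ipff HI Lk) -norm2E eqxx => /(congr1 (@complex.Re R)) /= ->.
  by [].
(* s_k^p = (||T e_k||^2)^(p/2), where ||T e_k||^2 is at most the mean of |q|^2 |e_k|^2; Jensen's
   inequality moves the power p/2 onto |q|^2. *)
rewrite ger0_norm// -pE//.
have -> : Wp = (fun t => W t `^ (p / 2)).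
  by apply/funext => t; rewrite /W pE// cmod_ge0.
apply: le_trans (jensen_wmean mW W0 WM r1 Lk k1).
have x0 := wmean_ge0 W0 (e k).
apply: ge0_ler_powR => //; rewrite ?nnegrE ?sqr_ge0//; first by rewrite divr_ge0// ltW.
rewrite -(se _ sk) -norm2E.
apply: (@le_trans _ _ (norm2 (fun t => symbol q t * e k t) ^+ 2)).
  by rewrite ler_pXn2r ?nnegrE ?norm2_ge0//; exact: (norm2_toeplitz_le uv ms sM Kk).
rewrite norm2_sqr /wmean le_eqVlt; apply/orP; left; apply/eqP/mean_eq => t _.
by rewrite cmodM exprMn.
Qed.

(** The matrix |<g_j, e_k>|^2 is doubly substochastic, by Bessel's inequality for each of the two
    families. The sums over k are the weights in Jensen's inequality for a single ||T g_j||^p; the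
    sums over j allow the results to be added up. *)
Lemma schatten_form_sum (s : nat -> R) (e g : nat -> R -> R[i]) (S : (R -> R[i]) -> R -> R[i]) (C : R) :
  compact_op K T -> (forall n, 0 <= s n) -> adjoint_op K T S -> (forall n, K (e n)) ->
  (forall m n, 0 < s m -> 0 < s n -> inner_prod (e m) (e n) = (m == n)%:R) ->
  (forall n, 0 < s n -> eq2 (S (T (e n))) (fun t => ((s n) ^+ 2)%:C%C * e n t)) ->
  (forall f, K f -> (forall n, 0 < s n -> inner_prod f (e n) = 0) -> eq2 (S (T f)) (fun=> 0)) ->
  (forall n, \sum_(k < n) s k `^ p <= C) ->
  (forall n, K (g n)) -> @orthonormal_on R (R -> R[i]^o) (@inner_prod R) predT g ->
  forall N, \sum_(j < N) norm2 (T (g j)) `^ p <= C.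
Proof.
move=> cT s0 [KS TS] Ke oe se ce sC Kg og N.
have [L [M [L0 M0 hM hL]]] := polyval_lipschitz q.
have sM t : cmod (symbol q t) <= M by apply: hM; rewrite cmod_expi.
have KT := toeplitz_model uv (cmeas_symbol q) sM.
have HK := model_subspace uv.
have cT' : @compact_on R (R -> R[i]^o) (@inner_prod R) K T by apply/compact_opE.
have se' n : 0 < s n -> @nrm R (R -> R[i]^o) (@inner_prod R)
    (S (T (e n)) - (fun t => (s n ^+ 2)%:C%C * e n t)) = 0.
  move=> n0; have Kn := Ke n; have LST := model_L2 (KS _ (KT _ Kn)).
  rewrite -norm2E; apply/(eq2_norm2 LST); last exact: se.
  exact: L2_scale (model_L2 Kn).
have ce' f : K f -> (forall n, 0 < s n -> inner_prod f (e n) = 0) ->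
    @nrm R (R -> R[i]^o) (@inner_prod R) (S (T f)) = 0.
  move=> Kf fe; have LST := model_L2 (KS _ (KT _ Kf)).
  by rewrite -norm2E; apply/(norm2_eq0 LST); exact: ce.
have bound := nrm_op_singular_le HI HK KT KS TS (model_weakly_compact uv) cT' Ke oe se' ce'.
have Le n := model_L2 (Ke n); have Lg n := model_L2 (Kg n).
have g1 n : norm2 (g n) = 1.
  apply/eqP; rewrite -(@eqrXn2 _ 2)// ?norm2_ge0// expr1n.
  by have := og n n isT isT; rewrite (ipff HI (Lg n)) -norm2E eqxx => /(congr1 (@complex.Re R)) /= ->.
have e1 n : 0 < s n -> norm2 (e n) = 1.
  move=> n0; apply/eqP; rewrite -(@eqrXn2 _ 2)// ?norm2_ge0// expr1n.
  by have := oe n n n0 n0; rewrite (ipff HI (Le n)) -norm2E eqxx => /(congr1 (@complex.Re R)) /= ->.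
(* Where s k = 0 the vector [e k] is arbitrary and may have any norm, so its weight is set to 0. *)
pose c j k : R := if 0 < s k then cmod (inner_prod (g j) (e k)) ^+ 2 else 0.
have c0 j k : 0 <= c j k by rewrite /c; case: ifP => // _; exact: sqr_ge0.
have c_col j n : \sum_(k < n) c j k <= 1.
  rewrite -big_mkcond /=.
  have := bessel HI (fun k _ => Le k) oe n (Lg j).
  by rewrite -norm2E g1 expr1n.
have c_row n k : \sum_(j < n) c j k <= 1.
  rewrite /c; case: ltP => sk; last by rewrite big1.
  have := bessel HI (fun k _ => Lg k) og n (Le k).
  rewrite -norm2E e1// expr1n; apply: le_trans; apply: ler_sum => j _.
  by rewrite (ipC HI (Le k) (Lg j)) cmod_conj.
have sp0 k : 0 <= s k `^ p by exact: powR_ge0.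
have /choice[Y hY] : forall j, exists y : R,
    (fun n => \sum_(0 <= k < n) c j k * s k `^ p) @ \oo --> y.
  move=> j; have : cvgn (series (fun k => c j k * s k `^ p)).
    apply: nondecreasing_is_cvgn.
      by apply: nondecreasing_series => k _ _; rewrite mulr_ge0.
    exists C => _ [n _ <-]; apply: le_trans (sC n).
    rewrite /series /= big_mkord; apply: ler_sum => k _; rewrite ler_piMl//.
    have := c_col j k.+1; rewrite big_ord_recr /=; apply: le_trans.
    by rewrite lerDr sumr_ge0.
  by move=> cs; exists (limn (series (fun k => c j k * s k `^ p))).
have Yle j n : \sum_(k < n) c j k * s k `^ p <= Y j.
  apply: (rcvg_le (cvg_cst _) (hY j)); exists n => // m /= nm.
  rewrite -(big_mkord xpredT (fun k => c j k * s k `^ p)) (big_cat_nat (leq0n n) nm)/=.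
  by rewrite lerDl sumr_ge0// => k _; rewrite mulr_ge0.
have rp : 0 < p / 2 by exact: lt_le_trans r1.
have Y0 j : 0 <= Y j by have := Yle j 0%N; rewrite big_ord0.
have TY j : norm2 (T (g j)) `^ p <= Y j.
  have h : norm2 (T (g j)) ^+ 2 <= Y j `^ (p / 2)^-1.
    rewrite norm2E; apply: (bound _ _ (Kg j)) => n.
    rewrite big_mkcond /= (eq_bigr (fun k : 'I_n => c j k * s k ^+ 2)); last first.
      by move=> k _; rewrite /c; case: (0 < s k); [exact: mulrC|rewrite mul0r].
    set x := \sum_(k < n) _.
    have x0 : 0 <= x by apply: sumr_ge0 => k _; rewrite mulr_ge0 ?sqr_ge0.
    have hx : x `^ (p / 2) <= Y j.
      apply: le_trans (Yle j n).
      rewrite (eq_bigr (fun k : 'I_n => c j k * (s k ^+ 2) `^ (p / 2))).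
        by apply: (jensen_sum (c := c j) (x := fun k => s k ^+ 2) r1 (c0 j) _ (c_col j n)) => k; exact: sqr_ge0.
      by move=> k _; rewrite pE.
    have -> : x = (x `^ (p / 2)) `^ (p / 2)^-1.
      by rewrite -powRrM mulfV ?gt_eqF// powRr1.
    by apply: ge0_ler_powR => //; rewrite ?nnegrE ?powR_ge0// invr_ge0 ltW.
  rewrite -pE ?norm2_ge0//.
  apply: (@le_trans _ _ ((Y j `^ (p / 2)^-1) `^ (p / 2))).
    by apply: ge0_ler_powR => //; rewrite ?nnegrE ?powR_ge0 ?sqr_ge0// ltW.
  by rewrite -powRrM mulVf ?gt_eqF// powRr1.
apply: (@le_trans _ _ (\sum_(j < N) Y j)); first by apply: ler_sum => j _; exact: TY.
have lim : (fun n => \sum_(j < N) \sum_(0 <= k < n) c j k * s k `^ p) @ \oo --> \sum_(j < N) Y j.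
  apply: (@cvg_finsum R R _ _ _ _ _ _ (fun (j : 'I_N) n => \sum_(0 <= k < n) c j k * s k `^ p)).
  by move=> j _; exact: hY.
apply: (rcvg_le lim (cvg_cst C)); apply: nearW => n.
rewrite exchange_big /=; apply: le_trans (sC n).
rewrite big_mkord; apply: ler_sum => k _.
rewrite -mulr_suml; exact: (ler_piMl (sp0 k) (c_row N k)).
Qed.

(** On the circle |z - z_k| times the modulus of the k-th Malmquist-Takenaka function is the
    constant sqrt(1 - |z_k|^2). Hence the diagonal entry of A_q differs from q(z_k) by at most L
    sqrt(1 - |z_k|^2), and since p >= 2 the p-th power of this square root is at most 1 - |z_k|^2,
    which is summable. *)
Lemma schatten_blaschke :
  schatten p K T -> lp_seq p (fun n => cmod (polyval q (z n))).
Proof.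
move=> [cT [s [s0 _ [S [e [adj Ke oe se ce]]]] /lp_seqP[C hC]]].
have [L [M [L0 M0 hM hL]]] := polyval_lipschitz q.
have sM t : cmod (symbol q t) <= M by apply: hM; rewrite cmod_expi.
have KT := toeplitz_model uv (cmeas_symbol q) sM.
have [Sm [S0 hS]] := blaschke_mass hz.
have Kg := mtake_model z1 uv hz.
have sC n : \sum_(k < n) s k `^ p <= C.
  by apply: le_trans (hC n); apply: ler_sum => k _; rewrite ger0_norm.
have main := schatten_form_sum cT s0 adj Ke oe se ce sC Kg
  (mtake_orthonormal z1 (P := predT)).
apply/lp_seqP; exists (2 `^ p * (C + L `^ p * Sm)) => n.
apply: (@le_trans _ _ (\sum_(k < n) 2 `^ p *
    (norm2 (T (mtake z k)) `^ p + L `^ p * (1 - cmod (z k) ^+ 2)))); last first.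
  rewrite -mulr_sumr ler_wpM2l ?powR_ge0// big_split /=.
  apply: lerD; first exact: main.
  rewrite -mulr_sumr ler_wpM2l ?powR_ge0//.
  by rewrite -(big_mkord xpredT (fun k => 1 - cmod (z k) ^+ 2)).
apply: ler_sum => k _; rewrite ger0_norm ?cmod_ge0//.
set g := mtake z k; have Kk : K g by exact: Kg.
have Lk := model_L2 Kk; have g1 : norm2 g = 1 by exact: norm2_mtake.
have mk := sq_lt1 (z1 k).
have h1 := toeplitz_form_dist uv L0 hL Kk g1 (z1 k).
have d1 : norm2 (fun t => (expi t - z k) * g t) = Num.sqrt (1 - cmod (z k) ^+ 2).
  rewrite norm2_mean (@mean_eq _ _ (fun=> 1 - cmod (z k) ^+ 2)) ?mean_cst// => t _.
  rewrite cmodM cmod_mtake// dist_expi /szego cmodV exprMn exprMn sqr_sqrtr ?(ltW mk)//.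
  rewrite mulrCA -exprMn mulfV ?expr1n ?mulr1// gt_eqF//.
  by rewrite disk_denom_gt0// cmod_expi.
have h2 : cmod (inner_prod (T g) g) <= norm2 (T g).
  by rewrite (le_trans (cmod_inner_le (model_L2 (KT _ Kk)) Lk))// g1 mulr1.
have h3 : cmod (polyval q (z k)) <= norm2 (T g) + L * Num.sqrt (1 - cmod (z k) ^+ 2).
  have := cmod_dist_le (polyval q (z k)) (inner_prod (T g) g).
  by rewrite cmod_distC -d1; have := h1; have := h2; rewrite /T; lra.
apply: (@le_trans _ _ ((norm2 (T g) + L * Num.sqrt (1 - cmod (z k) ^+ 2)) `^ p)).
  apply: ge0_ler_powR => //; rewrite ?nnegrE ?cmod_ge0 ?(ltW p0)//.
  by rewrite addr_ge0 ?norm2_ge0// mulr_ge0.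
apply: le_trans (powRD_le (ltW p0) (norm2_ge0 _) (mulr_ge0 L0 (sqrtr_ge0 _))) _.
rewrite ler_wpM2l ?powR_ge0// lerD2l powRM// ler_wpM2l ?powR_ge0//.
apply: le_trans (powR_le_sqr p2 _) _; last by rewrite sqr_sqrtr// ltW.
rewrite sqrtr_ge0 -[X in _ <= X]sqrtr1 ler_wsqrtr// gerBl.
exact: sqr_ge0.
Qed.

End Schatten.

Theorem theorem7 (R : realType) (q : {poly {poly R[i]}}) (u : R[i] -> R[i])
    (hu : inner_function u) :
  let K := model_space u in
  let A := toeplitz u (symbol q) in
  [/\ (forall z : nat -> R[i], infinite_blaschke u z ->
         (forall p : R, 2 <= p ->
            (schatten p K A <-> lp_seq p (fun n => cmod (polyval q (z n))))) /\
         (compact_op K A <->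
            (fun n => polyval q (z n) : R[i]^o) @ \oo --> (0 : R[i]^o))),
      (forall sigma : {finite_measure set (measurableTypeR R) -> \bar R},
         continuous_singular_inner u sigma ->
         (compact_op K A <->
            (forall z, circle_support sigma z -> polyval q z = 0)) /\
         (compact_op K A -> zero_op K A)) &
      (forall r theta : nat -> R, atomic_singular_inner u r theta ->
         (compact_op K A <->
            (forall n, 0 < r n -> polyval q (expi (theta n)) = 0)) /\
         (infinite_set [set n | 0 < r n] ->
            compact_op K A -> zero_op K A))].
Proof.
have [v uv] := inner_functionP hu; move=> K A.
have [L [M [_ _ hM _]]] := polyval_lipschitz q.
have sM t : cmod (symbol q t) <= M by apply: hM; rewrite cmod_expi.
split=> [z hz|sigma hs|r theta hr].
- split=> [p p2|].
    split; first exact: (schatten_blaschke uv hz p2).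
    exact: (blaschke_schatten uv hz p2).
  have E : (fun n => polyval q (z n) : R[i]^o) @ \oo --> (0 : R[i]^o) <->
      (fun n => cmod (polyval q (z n))) @ \oo --> (0 : R).
    have P := @ccvgP R nat \oo _ (fun n => polyval q (z n)) 0.
    by split=> [/P|h]; [|apply/P]; under eq_fun do rewrite subr0.
  split=> [cT|/E h]; first by apply/E; exact: (blaschke_compact_cvg0 uv hz cT).
  exact: (blaschke_compact uv hz h).
- have zero h := cs_zero uv hs (q := q) h.
  split; first split=> [cT z|h].
  + exact: (cs_compact_zero uv hs cT).
  + exact: (zero_op_compact uv (cmeas_symbol q) sM (zero h)).
  + by move=> cT; apply: zero => z; exact: (cs_compact_zero uv hs cT).
- split; first split=> [cT n|h].
  + exact: (atomic_compact_zero uv hr cT).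
  + exact: (atomic_compact uv hr h).
  + exact: (atomic_zero uv hr).
Qed.
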